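(* Assume that $k>0$, $S>0$, $P\in\mathbb R$, $\alpha\in\mathbb R$ and $g\in L^2(\Omega)$. The dynamical system $(S_t,Y)$ corresponding to generalized solutions of the plate problem (PL) has a bounded, uniformly absorbing set $\mathscr B\subset Y$: $\mathscr B$ is closed and bounded, and for any bounded set $D\subset Y$ there exists $t_0(D)$ such that $S_t(D)\subset\mathscr B$ for all $t>t_0(D)$.
   Context: Let $\ell>0$, $\Omega=(0,\pi)\times(-\ell,\ell)$ with coordinates $(x,y)$, and $\sigma\in(0,1)$. $\|\cdot\|_0$ is the $L^2(\Omega)$ norm. Let $H^2_*=\{u\in H^2(\Omega): u=0 \text{ on } \{0,\pi\}\times[-\ell,\ell]\}$ with scalar product $a(u,v)=\int_\Omega(\Delta u\Delta v-(1-\sigma)[u_{xx}v_{yy}+u_{yy}v_{xx}-2u_{xy}v_{xy}])$ and norm $\|u\|_{H^2_*}=\sqrt{a(u,u)}$. Let $Y=H^2_*\times L^2(\Omega)$ with $\|(u,v)\|_Y^2=\|u\|_{H^2_*}^2+\|v\|_0^2$. Let $\mathcal D(A)=\{u\in H^4(\Omega)\cap H^2_*: u_{xx}=0 \text{ on }\{0,\pi\}\times[-\ell,\ell],\ u_{yy}+\sigma u_{xx}=u_{yyy}+(2-\sigma)u_{xxy}=0\text{ on }[0,\pi]\times\{-\ell,\ell\}\}$. The plate problem (PL), $g$ time-independent: $u_{tt}+ku_t+\Delta^2u+[P-S\int_\Omega u_x^2]u_{xx}=g+\alpha u_y$ in $\Omega\times(0,\infty)$; $u=u_{xx}=0$ on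 $\{0,\pi\}\times[-\ell,\ell]$; $u_{yy}+\sigma u_{xx}=u_{yyy}+(2-\sigma)u_{xxy}=0$ on $[0,\pi]\times\{-\ell,\ell\}$; $u(0)=u_0$, $u_t(0)=v_0$. Generalized solutions are $C^0([0,T];Y)$ limits of strong solutions (those with data in $\mathcal D(A)\times H^2_*$). For every $y_0=(u_0,v_0)\in Y$ there is a unique generalized solution, and $S_ty_0=(u(t),u_t(t))$, $t\ge0$, defines a continuous semigroup on $Y$. *)

(* Defs.v *)
From HB Require Import structures.
From mathcomp Require Import all_boot all_order all_algebra.
From mathcomp Require Import all_classical all_reals all_analysis.

Set Implicit Arguments.
Unset Strict Implicit.
Unset Printing Implicit Defensive.
Import Order.TTheory GRing.Theory Num.Theory.
Import numFieldNormedType.Exports.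
Local Open Scope classical_set_scope.
Local Open Scope ring_scope.

(* Elements of L^2, H^2_* etc. are represented by functions on the whole of
   R * R, only their values a.e. in the plate matter: the measure below lives
   on the plate, and equality is understood modulo null sets of it. *)
Section Plate.
Context {R : realType}.
Variable l : R.

Local Notation RR := (measurableTypeR R * measurableTypeR R)%type.

Definition plate : set RR := `]0, pi[ `*` `](- l), l[.

Lemma measurable_plate : measurable plate.
Proof. by apply: measurableX; exact: measurable_itv. Qed.

Definition plate_measure : {measure set RR -> \bar R} :=
  mrestr (lebesgue_measure \x lebesgue_measure)%E measurable_plate.

Local Notation mu := plate_measure.
Implicit Types (u v w f : R * R -> R) (p : R * R).

Definition L2 u : Prop := u \in Lfun mu 2%:E.

Definition L2norm u : R := fine 'N[mu]_(2%:E)[EFin \o u]%E.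

Definition e_x : R * R := (1, 0).
Definition e_y : R * R := (0, 1).

Definition pderiv (i j : nat) f : R * R -> R :=
  iter i (fun h => 'D_e_x h) (iter j (fun h => 'D_e_y h) f).

Fixpoint Ck (k : nat) f : Prop :=
  continuous f /\
  if k is k'.+1 then
    (forall p, derivable f p e_x /\ derivable f p e_y) /\
    Ck k' ('D_e_x f) /\ Ck k' ('D_e_y f)
  else True.

Definition smooth f : Prop := forall k, Ck k f.

Definition test_function f : Prop :=
  smooth f /\
  exists K : set (R * R),
    [/\ compact K, K `<=` plate & forall p, ~ K p -> f p = 0].

Definition is_wderiv (i j : nat) u w : Prop :=
  forall f, test_function f ->
    \int[mu]_p (u p * pderiv i j f p) =
    (-1) ^+ (i + j) * \int[mu]_p (w p * f p).

(* Meaningful only when such a w exists; it is then unique a.e. in the plate. *)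
Definition wderiv (i j : nat) u : R * R -> R :=
  xget (cst 0) [set w | L2 w /\ is_wderiv i j u w].

Definition sobolev (m : nat) u : Prop :=
  L2 u /\
  forall i j, (i + j <= m)%N -> exists w, L2 w /\ is_wderiv i j u w.

Definition H1_cvg (f_ : nat -> R * R -> R) w : Prop :=
  [/\ (fun n => L2norm (f_ n - w)) @ \oo --> (0 : R),
      (fun n => L2norm ('D_e_x (f_ n) - wderiv 1 0 w)) @ \oo --> (0 : R) &
      (fun n => L2norm ('D_e_y (f_ n) - wderiv 0 1 w)) @ \oo --> (0 : R)].

(* The trace operator H^1 -> L^2(edge) is the continuous extension of the
   restriction of smooth functions; this says that w in H^1 is mapped to 0.
   The edge is parametrized by s in I. *)
Definition zero_trace (edge : R -> R * R) (I : set R) w : Prop :=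
  exists f_ : nat -> R * R -> R,
    [/\ forall n, smooth (f_ n),
        H1_cvg f_ w &
        (fun n => \int[lebesgue_measure]_(s in I) (f_ n (edge s)) ^+ 2)
          @ \oo --> (0 : R)].

Definition zero_on_vertical (a : R) w : Prop :=
  zero_trace (fun y => (a, y)) `](- l), l[ w.

Definition zero_on_horizontal (b : R) w : Prop :=
  zero_trace (fun x => (x, b)) `]0, pi[ w.

Definition zero_on_hinged_edges w : Prop :=
  zero_on_vertical 0 w /\ zero_on_vertical pi w.

Definition zero_on_free_edges w : Prop :=
  zero_on_horizontal (- l) w /\ zero_on_horizontal l w.

Definition H2s u : Prop := sobolev 2 u /\ zero_on_hinged_edges u.

Definition laplacian u : R * R -> R := wderiv 2 0 u + wderiv 0 2 u.

Definition bilaplacian u : R * R -> R :=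
  wderiv 4 0 u + 2 *: wderiv 2 2 u + wderiv 0 4 u.

Variable sigma : R.

Definition bending u v : R :=
  \int[mu]_p (laplacian u p * laplacian v p
    - (1 - sigma) * (wderiv 2 0 u p * wderiv 0 2 v p
                     + wderiv 0 2 u p * wderiv 2 0 v p
                     - 2 * wderiv 1 1 u p * wderiv 1 1 v p)).

Definition H2s_norm u : R := Num.sqrt (bending u u).

Definition domA u : Prop :=
  [/\ sobolev 4 u, H2s u, zero_on_hinged_edges (wderiv 2 0 u),
      zero_on_free_edges (wderiv 0 2 u + sigma *: wderiv 2 0 u) &
      zero_on_free_edges (wderiv 0 3 u + (2 - sigma) *: wderiv 2 1 u)].

Definition state : Type := ((R * R -> R) * (R * R -> R))%type.
Implicit Types (y : R -> state) (B D : set state).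

Definition Yspace : set state := [set z | H2s z.1 /\ L2 z.2].

Definition Ynorm (z : state) : R :=
  Num.sqrt (H2s_norm z.1 ^+ 2 + L2norm z.2 ^+ 2).

Definition Ybounded B : Prop :=
  exists M : R, forall z, B z -> Ynorm z <= M.

Definition Yclosed B : Prop :=
  forall z, Yspace z ->
    (forall e : R, 0 < e -> exists2 b, B b & Ynorm (z - b) < e) -> B z.

Variables (k S P alpha : R) (g : R * R -> R).

Definition plate_equation u (ut utt : R * R -> R) : Prop :=
  {ae mu, forall p,
    utt p + k * ut p + bilaplacian u p
      + (P - S * \int[mu]_q (wderiv 1 0 u q) ^+ 2) * wderiv 2 0 u p
    = g p + alpha * wderiv 0 1 u p}.

(* y = (u, u_t) is of class C^1 from [0, T] to Y, with derivative (u_t, u_tt),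
   and takes its values in D(A) x H^2_*. *)
Definition strong_solution (T : R) y : Prop :=
  exists utt : R -> R * R -> R,
    forall t, 0 <= t <= T ->
      [/\ domA (y t).1 /\ H2s (y t).2, L2 (utt t),
          Ynorm ((s - t)^-1 *: (y s - y t) - ((y t).2, utt t))
            @[s --> within `[0, T] t^'] --> (0 : R),
          Ynorm ((y s).2 - (y t).2, utt s - utt t)
            @[s --> within `[0, T] (nbhs t)] --> (0 : R) &
          plate_equation (y t).1 (y t).2 (utt t)].

Definition generalized_solution y : Prop :=
  (forall t, 0 <= t -> Yspace (y t)) /\
  forall T, 0 < T ->
    exists y_ : nat -> R -> state,
      (forall n, strong_solution T (y_ n)) /\
      forall e : R, 0 < e -> \forall n \near \oo,
        forall t, 0 <= t <= T -> Ynorm (y_ n t - y t) < e.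

(* The initial condition is an equality in Y, i.e. modulo null sets. *)
Definition solution_semigroup (St : R -> state -> state) : Prop :=
  forall y0 : state, Yspace y0 ->
    generalized_solution (fun t => St t y0) /\ Ynorm (St 0 y0 - y0) = 0.

Definition uniformly_absorbing (St : R -> state -> state) B : Prop :=
  forall D, D `<=` Yspace -> Ybounded D ->
    exists t0 : R, forall t, 0 <= t -> t0 < t -> St t @` D `<=` B.

End Plate.

(* Main.v *)
(* A perturbed energy decays. For a strong solution (u, v) put q = |u_x|^2 and
   V = |v|^2/2 + a(u, u)/2 - P q/2 + S q^2/4 - (g, u) + e (u, v) with e = k/4.
   Green's formula (bilaplacian u, w) = a(u, w) for u in D(A) and w in H^2_*
   turns the equation into V' + e V = -(5k/8)|v|^2 - (k/8) a(u, u)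
   - (3kS/16) q^2 + alpha (u_y, v) + lower order terms. The quartic term, which
   is there because S > 0, absorbs every multiple of q, hence of |u|^2 (Poincare
   in x); Ehrling's inequality |u_y|^2 <= eta a(u, u) + C |u|^2 absorbs the
   nonconservative term alpha u_y. So V' + e V <= C, and by Gronwall
   V(t) <= exp(-e t) V(0) + C/e. As V is bounded below by |(u, v)|_Y^2/4 - C and
   above by a polynomial in |(u, v)|_Y^2, a fixed ball absorbs all strong
   solutions, at a time depending only on a bound of the data; generalized
   solutions inherit this from approximating strong ones.

   Sobolev theory is only needed in one direction at a time: by Fubini, a
   function with a weak x-derivative w is the primitive of w on slices plus a
   function of y alone, and a zero trace means that the latter is 0 and that w
   has mean 0 on slices. Integration by parts, Poincare's and Ehrling's
   inequalities follow from this representation. *)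
Require Import Defs.
From mathcomp Require Import all_boot all_order all_algebra.
From mathcomp Require Import all_classical all_reals all_analysis.
From mathcomp Require Import measurable_realfun ring lra.
Import Order.TTheory GRing.Theory Num.Theory.
Import numFieldNormedType.Exports.
Local Open Scope classical_set_scope.
Local Open Scope ring_scope.
Set Implicit Arguments.
Unset Strict Implicit.
Unset Printing Implicit Defensive.

(** * Square-integrable functions *)

(** Slices of an L^2 function are controlled only for almost every y, so functions are compared
    through their pairings with L^2 functions, and an operation on slices is moved to the other
    factor by adjunction. Weak derivatives are tested on products phi(x) psi(y) only: their
    derivatives are one-variable derivatives, and a pi-lambda argument shows that products separate
    integrable functions, with no mollification. Green's formula needs u_y, u_yy and w_y to vanish
    on the hinged edges, whereas the hypotheses speak of u, w and u_xx there. These tangential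
    derivatives are reached by testing in y with weights in x that need not vanish at the two ends.
    Ehrling's inequality is obtained without compactness: integration by parts produces edge terms,
    and each of them is averaged over a strip along its edge. Statements in the y direction come
    from those in x by exchanging the coordinates. The value e = k/4 leaves the coefficient -k +
    3e/2 = -5k/8 in front of |v|^2, enough to pay k/8 for the term alpha (u_y, v) and k/8 for the
    cross term (u, v). *)

Section SquareIntegrable.
Context d (T : measurableType d) (R : realType).
Variable mu : {measure set T -> \bar R}.
Implicit Types f g h : T -> R.

Definition sqint f : Prop :=
  measurable_fun setT f /\ mu.-integrable setT (EFin \o (fun x => f x ^+ 2)).

Definition ip f g : R := \int[mu]_x (f x * g x).

Lemma LfunP2 f : f \in Lfun mu 2%:E <-> sqint f.
Proof.
split=> [f2|[mf f2]].
  split; last exact: Lfun2_integrable_sqr.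
  by move: f2; rewrite inE => /andP[/[!inE]].
rewrite inE; apply/andP; split; rewrite inE//=.
rewrite /finite_norm unlock /Lnorm poweR_lty//.
have /integrableP[_] := f2; apply: le_lt_trans.
rewrite le_eqVlt; apply/orP; left; apply/eqP; apply: eq_integral => x _ /=.
by rewrite powR_mulrn// normrX.
Qed.

Lemma sqint_meas f : sqint f -> measurable_fun setT f.
Proof. by case. Qed.

Lemma sqint_le f g : measurable_fun setT f -> sqint g ->
  (forall x, `|f x| <= `|g x|) -> sqint f.
Proof.
move=> mf [mg g2] fg; split=> //.
apply: (le_integrable measurableT) g2.
  by apply/measurable_EFinP; exact: measurable_funX.
move=> x _ /=; rewrite lee_fin !normrX.
by rewrite lerXn2r ?nnegrE.
Qed.

Lemma sqintZ a f : sqint f -> sqint (a *: f).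
Proof.
move=> [mf f2]; split; first exact: measurable_funM.
have := integrableZl measurableT (a ^+ 2) f2.
apply: eq_integrable => // x _ /=.
by rewrite -EFinM -exprMn.
Qed.

Lemma ip_integrable f g : sqint f -> sqint g ->
  mu.-integrable setT (EFin \o (fun x => f x * g x)).
Proof.
move=> /[dup] [[mf _]] /LfunP2 f2 /[dup] [[mg _]] /LfunP2 g2.
by have /Lfun1_integrable := Lfun2_mul_Lfun1 f2 g2.
Qed.

Lemma sqintD f g : sqint f -> sqint g -> sqint (f + g).
Proof.
move=> hf hg; have [mf f2] := hf; have [mg g2] := hg.
split; first exact: measurable_funD.
have h : mu.-integrable setT (EFin \o (fun x => 2 * (f x * g x))).
  have := integrableZl measurableT 2 (ip_integrable hf hg).
  exact: eq_integrable.
have := integrableD measurableT (integrableD measurableT f2 h) g2.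
apply: eq_integrable => // x _ /=.
rewrite -!EFinD; congr EFin.
by rewrite fctE sqrrD mulr_natl.
Qed.

Lemma sqintN f : sqint f -> sqint (- f).
Proof. by move=> /(sqintZ (-1)); rewrite scaleN1r. Qed.

Lemma sqintB f g : sqint f -> sqint g -> sqint (f - g).
Proof. by move=> hf hg; apply: sqintD => //; exact: sqintN. Qed.

Lemma sqint0 : sqint 0.
Proof.
split; first exact: measurable_cst.
have := integrable0 mu setT.
apply: eq_integrable => // x _ /=.
by rewrite expr0n.
Qed.

Lemma ipC f g : ip f g = ip g f.
Proof. by apply: eq_Rintegral => x _; rewrite mulrC. Qed.

Lemma ipDl f g h : sqint f -> sqint g -> sqint h ->
  ip (f + g) h = ip f h + ip g h.
Proof.
move=> hf hg hh; rewrite /ip -RintegralD//; try exact: ip_integrable.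
by apply: eq_Rintegral => x _; rewrite fctE mulrDl.
Qed.

Lemma ipZl a f h : sqint f -> sqint h -> ip (a *: f) h = a * ip f h.
Proof.
move=> hf hh; rewrite /ip -RintegralZl//; last exact: ip_integrable.
by apply: eq_Rintegral => x _; rewrite fctE -mulrA.
Qed.

Lemma ipNl f h : sqint f -> sqint h -> ip (- f) h = - ip f h.
Proof. by move=> hf hh; rewrite -scaleN1r ipZl// mulN1r. Qed.

Lemma ipBl f g h : sqint f -> sqint g -> sqint h ->
  ip (f - g) h = ip f h - ip g h.
Proof. by move=> hf hg hh; rewrite ipDl ?ipNl//; exact: sqintN. Qed.

Lemma ipDr f g h : sqint f -> sqint g -> sqint h ->
  ip h (f + g) = ip h f + ip h g.
Proof. by move=> *; rewrite ipC ipDl// ipC (ipC g). Qed.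

Lemma ipZr a f h : sqint f -> sqint h -> ip h (a *: f) = a * ip h f.
Proof. by move=> *; rewrite ipC ipZl// ipC. Qed.

Lemma ipNr f h : sqint f -> sqint h -> ip h (- f) = - ip h f.
Proof. by move=> *; rewrite ipC ipNl// ipC. Qed.

Lemma ipBr f g h : sqint f -> sqint g -> sqint h ->
  ip h (f - g) = ip h f - ip h g.
Proof. by move=> *; rewrite ipC ipBl// ipC (ipC g). Qed.

Lemma ip_ge0 f : 0 <= ip f f.
Proof. by apply: Rintegral_ge0 => x _; rewrite -expr2 sqr_ge0. Qed.

Lemma ip_ae f g h : sqint f -> sqint g -> sqint h ->
  (\forall x \ae mu, f x = g x) -> ip f h = ip g h.
Proof.
move=> hf hg hh fg; congr fine; apply: ae_eq_integral => //.
- exact: measurable_int (ip_integrable hf hh).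
- exact: measurable_int (ip_integrable hg hh).
- by apply: filterS fg => x /= -> .
Qed.

Lemma ip_eq0_ae f : sqint f -> ip f f = 0 -> \forall x \ae mu, f x = 0.
Proof.
move=> hf f0; have /integrableP[mff _] := ip_integrable hf hf.
pose F := EFin \o (fun x => f x * f x).
have : (\int[mu]_(x in setT) `|F x| = 0)%E.
  have i0 : (\int[mu]_x F x = 0)%E.
    rewrite -(fineK (integrable_fin_num measurableT (ip_integrable hf hf))).
    by congr EFin.
  rewrite -[RHS]i0.
  by apply: eq_integral => x _ /=; rewrite ger0_norm// -expr2 sqr_ge0.
move=> /ae_eq_integral_abs => /(_ measurableT mff).
apply: filterS => x /(_ I) [] /eqP.
by rewrite mulf_eq0 orbb => /eqP.
Qed.

Lemma ip_eq0 f h : sqint f -> sqint h -> ip f f = 0 -> ip f h = 0.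
Proof.
move=> hf hh /(ip_eq0_ae hf) f0.
rewrite (ip_ae hf sqint0 hh f0).
by rewrite -(scale0r f) ipZl// mul0r.
Qed.

Lemma ip_sqD f g : sqint f -> sqint g ->
  ip (f + g) (f + g) = ip f f + 2 * ip f g + ip g g.
Proof.
move=> hf hg; have hfg := sqintD hf hg.
rewrite ipDl// !ipDr// (ipC g f); lra.
Qed.

Lemma ip_cs f g : sqint f -> sqint g -> ip f g ^+ 2 <= ip f f * ip g g.
Proof.
move=> hf hg.
have H t : 0 <= ip f f - 2 * t * ip f g + t ^+ 2 * ip g g.
  have := ip_ge0 (f + (- t) *: g).
  rewrite ip_sqD//; last exact: sqintZ.
  by rewrite !ipZr ?ipZl//; try exact: sqintZ; move=> h; lra.
have := ip_ge0 g; rewrite le_eqVlt => /predU1P[g0|g0].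
  by rewrite ipC ip_eq0// -?g0// expr0n mulr0.
(* The minimizer of the quadratic in [H]; its minimum, multiplied by |g|^2, is the difference of the
   two sides. *)
have := H (ip f g / ip g g) => /(mulr_ge0 (ltW g0)).
rewrite [X in 0 <= X](_ : _ = ip f f * ip g g - ip f g ^+ 2) ?subr_ge0//.
by field; rewrite gt_eqF.
Qed.

(** Expand the square of f - (s/t) g and multiply by t/2; the signs s = 1 and s = -1 together give
    the absolute value. *)
Lemma ip_young (t : R) f g : 0 < t -> sqint f -> sqint g ->
  `|ip f g| <= t / 2 * ip f f + ip g g / (2 * t).
Proof.
move=> t0 hf hg.
have H s : s ^+ 2 = 1 -> s * ip f g <= t / 2 * ip f f + ip g g / (2 * t).
  move=> s1.
  have := ip_ge0 (f + (- s / t) *: g).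
  rewrite ip_sqD//; last exact: sqintZ.
  rewrite !ipZr ?ipZl//; try exact: sqintZ.
  move=> /(mulr_ge0 (ltW t0)).
  rewrite [X in 0 <= X](_ : _ = t * ip f f - 2 * s * ip f g + s ^+ 2 * ip g g / t); last first.
    by field; rewrite gt_eqF.
  rewrite s1 mul1r invfM => h; have := h; lra.
have := H 1; have := H (-1); rewrite sqrrN expr1n => /(_ erefl) h1 /(_ erefl) h2.
by rewrite ler_norml; apply/andP; split; lra.
Qed.

Lemma ip_tri f g : sqint f -> sqint g ->
  ip (f + g) (f + g) <= 2 * ip f f + 2 * ip g g.
Proof.
move=> hf hg; rewrite ip_sqD//.
have := ip_young ltr01 hf hg; rewrite ler_norml => /andP[_].
rewrite mulr1; lra.
Qed.

Lemma fine_Lnorm2 f : sqint f ->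
  fine ('N[mu]_(2%:E)[EFin \o f])%E = Num.sqrt (ip f f).
Proof.
move=> [mf f2]; rewrite unlock /Lnorm /=.
have -> : (\int[mu]_x `|(f x)%:E| `^ 2 = \int[mu]_x (f x * f x)%:E)%E.
  apply: eq_integral => x _ /=.
  by rewrite powR_mulrn// -normrX ger0_norm ?sqr_ge0// expr2.
have /fineK <- := integrable_fin_num measurableT f2.
rewrite poweR_EFin /= powR12_sqrt//.
by rewrite fine_ge0// integral_ge0// => x _; rewrite lee_fin sqr_ge0.
Qed.

End SquareIntegrable.

(** * Test functions *)

Section Smooth1.
Context {R : realType}.
Implicit Types f g : R -> R.

(** The recursion is that of [Ck] in one variable, which lets products of two such functions be
    treated by induction on k. *)
Fixpoint smooth1 (k : nat) f : Prop :=
  continuous f /\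
  if k is k'.+1 then (forall x : R, derivable f x 1) /\ smooth1 k' (derive1 f) else True.

Lemma smooth1_cont k f : smooth1 k f -> continuous f.
Proof. by case: k => [|k] []. Qed.

Lemma smooth1S k f : smooth1 k.+1 f -> smooth1 k f.
Proof.
elim: k f => [|k IH] f; first by case.
by move=> [cf [df sf]]; split=> //; split=> //; exact: IH.
Qed.

Lemma smooth1_is_derive k f g : (forall x : R, is_derive x 1 f (g x)) ->
  smooth1 k g -> smooth1 k.+1 f.
Proof.
move=> fg sg; split.
  move=> x; apply: differentiable_continuous; apply/derivable1_diffP.
  by have [] := fg x.
split; first by move=> x; have [] := fg x.
suff -> : (derive1 f) = g by [].
by apply/funext => x; rewrite derive1E; exact: derive_val.
Qed.

Lemma smooth1_derive k f (x : R) : smooth1 k.+1 f -> is_derive x 1 f ((derive1 f) x).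
Proof. by move=> [_ [df _]]; rewrite derive1E; exact: derivableP. Qed.

Lemma smooth1D k f g : smooth1 k f -> smooth1 k g -> smooth1 k (f + g).
Proof.
elim: k f g => [|k IH] f g sf sg.
  by split=> // x; apply: continuousD; [exact: sf.1|exact: sg.1].
apply: (@smooth1_is_derive _ _ ((derive1 f) + (derive1 g))).
  by move=> x; exact: is_deriveD (smooth1_derive x sf) (smooth1_derive x sg).
by apply: IH; [exact: sf.2.2|exact: sg.2.2].
Qed.

Lemma smooth1Z k c f : smooth1 k f -> smooth1 k (c *: f).
Proof.
elim: k f => [|k IH] f sf.
  by split=> // x; apply: continuousZr; exact: sf.1.
apply: (@smooth1_is_derive _ _ (c *: (derive1 f))).
  by move=> x; exact: is_deriveZ (smooth1_derive x sf).
by apply: IH; exact: sf.2.2.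
Qed.

Lemma smooth1M k f g : smooth1 k f -> smooth1 k g -> smooth1 k (f * g).
Proof.
elim: k f g => [|k IH] f g sf sg.
  by split=> // x; apply: continuousM; [exact: sf.1|exact: sg.1].
apply: (@smooth1_is_derive _ _ (f * (derive1 g) + g * (derive1 f))).
  by move=> x; exact: is_deriveM (smooth1_derive x sf) (smooth1_derive x sg).
by apply: smooth1D; apply: IH; [exact: smooth1S|exact: sg.2.2|exact: smooth1S|exact: sf.2.2].
Qed.

Lemma smooth1_affine k f (c e : R) : smooth1 k f ->
  smooth1 k (fun x => f (c * x + e)).
Proof.
have da (x : R) : is_derive x 1 (fun x : R => c * x + e) c.
  by apply: is_derive_eq; rewrite addr0 /GRing.scale/= mulr1.
have ca : continuous (fun x : R => c * x + e).
  move=> x; apply: differentiable_continuous; apply/derivable1_diffP.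
  by have [] := da x.
elim: k f => [|k IH] f sf.
  by split=> // x; apply: continuous_comp; [exact: ca|exact: sf.1].
apply: (@smooth1_is_derive _ _ (c *: (fun x => (derive1 f) (c * x + e)))).
  move=> x; have df := smooth1_derive (c * x + e) sf.
  have h := @is_derive1_comp _ f (fun x => c * x + e) x _ _ df (da x).
  by rewrite mulrC in h.
by apply: smooth1Z; apply: IH; exact: sf.2.2.
Qed.

(* flat 0 is the standard smooth function vanishing on the negative half-line. *)
Definition flat (n : nat) (x : R) : R :=
  if 0 < x then x ^- n * expR (- x^-1) else 0.

(** The exponential of 1/x dominates the term of order n + 2 of its series. A quadratic bound is
    what makes the difference quotient at 0 vanish. *)
Lemma flat_le n x : 0 < x -> flat n x <= n.+2`!%:R * x ^+ 2.
Proof.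
move=> x0; rewrite /flat x0 expRN.
have xV0 : 0 <= x^-1 by rewrite invr_ge0 ltW.
have := expR_ge1Dxn n.+1 xV0; set t := expR _ => h.
have t0 : 0 < t := expR_gt0 _.
have xn : 0 < x ^+ n.+2 by rewrite exprn_gt0.
have {h} : x ^- n.+2 <= n.+2`!%:R * t.
  rewrite mulrC -ler_pdivrMr ?ltr0n ?fact_gt0// -exprVn.
  by apply: le_trans h; rewrite lerDr.
move=> h; rewrite ler_pdivrMr//.
rewrite (_ : x ^- n = x ^- n.+2 * x ^+ 2).
  by rewrite mulrAC ler_wpM2r// sqr_ge0.
by rewrite -addn2 exprD; field; rewrite expf_neq0 gt_eqF.
Qed.

Lemma flat_ge0 n x : 0 <= flat n x.
Proof.
rewrite /flat; case: ifP => // x0.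
by rewrite mulr_ge0 ?expR_ge0// invr_ge0 exprn_ge0// ltW.
Qed.

(** The family is closed under differentiation, so one induction yields smoothness of all its
    members. For x > 0 this is the product rule, and at 0 it follows from [flat_le]. *)
Lemma flat_derive n (x : R) :
  is_derive x 1 (flat n) (flat n.+2 x - n%:R * flat n.+1 x).
Proof.
have [x0|x0|x0] := ltgtP x 0.
- rewrite /flat ltNge (ltW x0)/= mulr0 subr0.
  apply: (@near_eq_is_derive _ _ _ (cst 0)).
  near=> y; rewrite ifF//; apply/negbTE; rewrite -leNgt; apply: ltW.
  by near: y; exact: lt_nbhsl.
- have nz : x != 0 by rewrite gt_eqF.
  have xn : x ^+ n != 0 by rewrite expf_neq0.
  have d0 : is_derive x 1 (fun x : R => x ^+ n) (n%:R * x ^+ n.-1).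
    have := is_deriveX n (is_derive_id x (1 : R)).
    by rewrite exprfctE /GRing.scale/= mulr1.
  have d1 := @is_deriveV _ (fun x => x ^+ n) x _ 1 xn d0.
  have d2 := @is_deriveV _ id x _ 1 nz (is_derive_id x 1).
  have d3 := @is_derive1_comp _ expR (fun x => - x^-1) x _ _ (is_derive_expR _) (is_deriveN d2).
  have nf : \near x, ((fun y => (y ^+ n)^-1) * (expR \o (fun x => - x^-1))) x = flat n x.
    near=> y; rewrite /flat ifT//.
    by near: y; exact: lt_nbhsr.
  have d4 := near_eq_is_derive nf (is_deriveM d1 d3).
  apply: is_derive_eq d4 _; clear -x0 nz.
  rewrite /flat x0.
  case: n => [|n]; rewrite /GRing.scale/= ?expr0 ?mulr1 ?mul0r.
    by field.
  by rewrite !exprS; field; rewrite nz expf_neq0.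
- rewrite x0 /flat ltxx mulr0 subr0.
  have H : (fun h : R => h^-1 *: ((flat n \o shift 0) (h *: 1) - flat n 0)) @ 0^' --> (0 : R).
    apply/cvgrPdist_lt => e e0; near=> h.
    rewrite sub0r normrN /flat ltxx subr0 /= addr0 /GRing.scale/= mulr1.
    case: ifPn => [h0|]; last by rewrite mulr0 normr0.
    have := flat_le n h0; rewrite /flat h0 => hle.
    rewrite normrM normfV (gtr0_norm h0) ger0_norm; last first.
      by have := flat_ge0 n h; rewrite /flat h0.
    rewrite ltr_pdivrMl//; apply: le_lt_trans hle _.
    rewrite expr2 mulrA (mulrC h e) ltr_pM2r// mulrC.
    rewrite -ltr_pdivlMr ?ltr0n ?fact_gt0//.
    apply: le_lt_trans (ler_norm _) _.
    near: h; apply: dnbhs0_lt.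
    by rewrite divr_gt0// ltr0n fact_gt0.
  apply: DeriveDef; first by apply/cvg_ex; exists 0; exact: H.
  by rewrite /derive; exact: (cvg_lim _ H).
Unshelve. all: by end_near. Qed.

Lemma flat_smooth k n : smooth1 k (flat n).
Proof.
elim: k n => [|k IH] n.
  split=> // x; apply: differentiable_continuous; apply/derivable1_diffP.
  by have [] := flat_derive n x.
apply: (@smooth1_is_derive _ _ (flat n.+2 + (- n%:R) *: flat n.+1)).
  move=> x; have := flat_derive n x.
  by rewrite !fctE /GRing.scale/= mulNr.
by apply: smooth1D => //; exact: smooth1Z.
Qed.

Definition test1 (a b : R) f : Prop :=
  (forall k, smooth1 k f) /\
  exists ab : R * R, [/\ a < ab.1, ab.2 < b &
    forall x, ~ (ab.1 <= x <= ab.2) -> f x = 0].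

Lemma test1_derive a b f : test1 a b f -> test1 a b (derive1 f).
Proof.
move=> [sf [[p q] /= [ap qb f0]]]; split; first by move=> k; have [] := sf k.+1 => _ [].
exists (p, q); split=> //= x nx.
suff nf : \near x, cst 0 x = f x.
  rewrite derive1E.
  by have [_ ->] := near_eq_is_derive nf (is_derive_cst (0 : R) x (1 : R)).
move: nx; have [xp _|px] := ltP x p.
  apply: filterS (lt_nbhsl xp) => y yp.
  by rewrite /= f0// => /andP[/(lt_le_trans yp)]; rewrite ltxx.
have [qx _|//] := ltP q x.
apply: filterS (lt_nbhsr qx) => y qy.
by rewrite /= f0// => /andP[_ /(lt_le_trans qy)]; rewrite ltxx.
Qed.

(** The shift by 1 keeps each factor zero up to distance 1/(n+1) from its endpoint. Inside ]a, b[
    the arguments of [flat 0] tend to infinity, so both factors tend to 1. *)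
Definition cutoff (a b : R) (n : nat) (x : R) : R :=
  flat 0 (n.+1%:R * (x - a) - 1) * flat 0 (n.+1%:R * (b - x) - 1).

Lemma cutoff_test a b n : test1 a b (cutoff a b n).
Proof.
have n0 : 0 < n.+1%:R :> R by rewrite ltr0n.
split=> [k|].
  rewrite (_ : cutoff a b n = (fun x => flat 0 (n.+1%:R * x + (- n.+1%:R * a - 1)))
    * (fun x => flat 0 (- n.+1%:R * x + (n.+1%:R * b - 1)))); last first.
    by apply/funext => x; rewrite /cutoff fctE; congr (flat 0 _ * flat 0 _); ring.
  by apply: smooth1M; apply: smooth1_affine; exact: flat_smooth.
exists (a + n.+1%:R^-1, b - n.+1%:R^-1); split => /=.
- by rewrite ltrDl invr_gt0.
- by rewrite ltrBlDr ltrDl invr_gt0.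
move=> x /negP; rewrite negb_and -!ltNge /cutoff /flat => /orP[h|h].
  rewrite ifF ?mul0r//; apply/negbTE; rewrite -leNgt subr_le0.
  by rewrite -ler_pdivlMl// mulr1 lerBlDl ltW.
rewrite [X in _ * X]ifF ?mulr0//; apply/negbTE; rewrite -leNgt subr_le0.
rewrite -ler_pdivlMl// mulr1; move: h; set v := _^-1; lra.
Qed.

Lemma flat0_le1 x : flat 0 x <= 1.
Proof.
rewrite /flat; case: ifP => // x0; rewrite expr0 invr1 mul1r.
by rewrite -expR0 ler_expR oppr_le0 invr_ge0 ltW.
Qed.

Lemma cutoff_bound a b n x : `|cutoff a b n x| <= 1.
Proof.
rewrite ger0_norm; last by rewrite mulr_ge0 ?flat_ge0.
by rewrite -[leRHS]mulr1 ler_pM ?flat_ge0 ?flat0_le1.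
Qed.

Lemma flat0_cvg (c : R) : 0 < c -> flat 0 (n.+1%:R * c - 1) @[n --> \oo] --> (1 : R).
Proof.
move=> c0.
have npos : \forall n \near \oo, 0 < n.+1%:R * c - 1.
  exists (Num.trunc `|c^-1|).+1 => // n /= hn.
  rewrite subr_gt0 -ltr_pdivrMr// div1r.
  apply: le_lt_trans (ler_norm _) _.
  apply: (@lt_trans _ _ n%:R); last by rewrite ltr_nat.
  by apply: lt_le_trans (truncnS_gt _) _; rewrite ler_nat.
have H : (fun n : nat => expR (- (n.+1%:R * c - 1)^-1)) @ \oo --> (1 : R).
  suff : (fun n : nat => - (n.+1%:R * c - 1)^-1) @ \oo --> (- 0 : R).
    rewrite oppr0 => h; have := cvg_comp _ _ h (@continuous_expR R 0).
    by rewrite expR0.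
  apply: cvgN.
  have h0 : (fun n : nat => n.+1%:R * c - 1) @ \oo --> +oo.
    apply/cvgryPge => A; near=> n.
    rewrite lerBrDr -ler_pdivrMr//.
    near: n; exists (Num.trunc `|(A + 1) / c|).+1 => // n /= hn.
    apply: le_trans (ler_norm _) _.
    apply: ltW; apply: (@lt_trans _ _ n%:R); last by rewrite ltr_nat.
    by apply: lt_le_trans (truncnS_gt _) _; rewrite ler_nat.
  have h1 : \forall n \near \oo, 0 < n.+1%:R * c - 1 by exact: npos.
  exact: (gtr0_cvgV0 h1).2 h0.
apply: cvg_trans H; apply: near_eq_cvg; near=> n.
rewrite /flat ifT ?expr0 ?invr1 ?mul1r//.
by near: n; exact: npos.
Unshelve. all: by end_near. Qed.

Lemma cutoff_cvg (a b x : R) :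
  cutoff a b n x @[n --> \oo] --> (\1_(`]a, b[%classic) x : R).
Proof.
rewrite indicE; have [|] := boolP (x \in _).
  rewrite inE /= in_itv /= => /andP[ax xb].
  suff : cutoff a b n x @[n --> \oo] --> (1 * 1 : R) by rewrite mulr1.
  by apply: cvgM; apply: flat0_cvg; rewrite subr_gt0.
rewrite notin_setE /= in_itv /= => /negP; rewrite negb_and -!leNgt => h.
rewrite (_ : cutoff a b ^~ x = cst 0); first exact: cvg_cst.
apply/funext => n; rewrite /cutoff /flat; case/orP: h => h.
  rewrite ifF ?mul0r//; apply/negbTE; rewrite -leNgt subr_le0.
  by apply: le_trans ler01; rewrite mulr_ge0_le0// subr_le0.
rewrite [X in _ * X]ifF ?mulr0//; apply/negbTE; rewrite -leNgt subr_le0.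
by apply: le_trans ler01; rewrite mulr_ge0_le0// subr_le0.
Qed.

End Smooth1.

(** * Products of one-variable test functions *)

Section Tensor.
Context {R : realType}.
Implicit Types f g : R -> R.

Definition tens f g : R * R -> R := fun p => f p.1 * g p.2.

Lemma tens_derive_x f g p : derivable f p.1 1 ->
  derivable (tens f g) p (@e_x R) /\
  'D_(@e_x R) (tens f g) p = tens (derive1 f) g p.
Proof.
case: p => x y /= df.
have E : (fun h : R => h^-1 *: ((tens f g \o shift (x, y)) (h *: e_x) - tens f g (x, y)))
    = (fun h => (h^-1 *: ((f \o shift x) (h *: 1) - f x)) * g y).
  apply/funext => h; rewrite /tens /e_x /e_y /=.
  rewrite [h *: 0](scaler0 _ h) add0r /GRing.scale /=.
  by rewrite -mulrBl mulrA.
have H : h^-1 *: ((f \o shift x) (h *: 1) - f x) * g y @[h --> 0^'] -->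
    'D_1 f x * g y by apply: cvgM; [exact: df|exact: cvg_cst].
split.
  by rewrite /derivable E; apply/cvg_ex; eexists; exact: H.
rewrite /derive E (cvg_lim _ H)//.
by rewrite /tens derive1E.
Qed.

Lemma tens_derive_y f g p : derivable g p.2 1 ->
  derivable (tens f g) p (@e_y R) /\
  'D_(@e_y R) (tens f g) p = tens f (derive1 g) p.
Proof.
case: p => x y /= df.
have E : (fun h : R => h^-1 *: ((tens f g \o shift (x, y)) (h *: e_y) - tens f g (x, y)))
    = (fun h => f x * (h^-1 *: ((g \o shift y) (h *: 1) - g y))).
  apply/funext => h; rewrite /tens /e_x /e_y /=.
  rewrite [h *: 0](scaler0 _ h) add0r /GRing.scale /=.
  by rewrite -mulrBr mulrCA.
have H : f x * (h^-1 *: ((g \o shift y) (h *: 1) - g y)) @[h --> 0^'] -->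
    f x * 'D_1 g y by apply: cvgM; [exact: cvg_cst|exact: df].
split.
  by rewrite /derivable E; apply/cvg_ex; eexists; exact: H.
rewrite /derive E (cvg_lim _ H)//.
by rewrite /tens derive1E.
Qed.

Lemma tens_cont f g : continuous f -> continuous g -> continuous (tens f g).
Proof.
move=> cf cg [x y]; apply: continuousM.
  by apply: continuous_comp; [exact: cvg_fst|exact: cf].
by apply: continuous_comp; [exact: cvg_snd|exact: cg].
Qed.

Lemma tens_Ck k f g : smooth1 k f -> smooth1 k g -> Ck k (tens f g).
Proof.
elim: k f g => [|k IH] f g sf sg; split=> //.
- by apply: tens_cont; [exact: sf.1|exact: sg.1].
- by apply: tens_cont; [exact: sf.1|exact: sg.1].
split; [|split].
- move=> p; split.
    by apply: (tens_derive_x _ _).1; exact: sf.2.1.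
  by apply: (tens_derive_y _ _).1; exact: sg.2.1.
- rewrite (_ : 'D_e_x _ = tens (derive1 f) g).
    by apply: IH; [exact: sf.2.2|exact: smooth1S].
  by apply/funext => p; apply: (tens_derive_x _ _).2; exact: sf.2.1.
- rewrite (_ : 'D_e_y _ = tens f (derive1 g)).
    by apply: IH; [exact: smooth1S|exact: sg.2.2].
  by apply/funext => p; apply: (tens_derive_y _ _).2; exact: sg.2.1.
Qed.

Lemma derive1n_test a b n f : test1 a b f -> test1 a b (derive1n n f).
Proof. by move=> tf; elim: n => //= n IH; exact: test1_derive. Qed.

Lemma tens_pderiv a b c d i j f g : test1 a b f -> test1 c d g ->
  pderiv i j (tens f g) = tens (derive1n i f) (derive1n j g).
Proof.
move=> tf tg; rewrite /pderiv.
have -> : iter j (fun h => 'D_e_y h) (tens f g) = tens f (derive1n j g).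
  elim: j => //= j ->; apply/funext => p.
  apply: (tens_derive_y _ _).2.
  exact: ((derive1n_test j tg).1 1%N).2.1.
elim: i => //= i ->; apply/funext => p.
apply: (tens_derive_x _ _).2.
exact: ((derive1n_test i tf).1 1%N).2.1.
Qed.

Lemma tens_test (l : R) f g : test1 0 pi f -> test1 (- l) l g ->
  test_function l (tens f g).
Proof.
move=> tf tg; split; first by move=> k; apply: tens_Ck; [exact: tf.1|exact: tg.1].
have [_ [[a b] [/= a0 bpi f0]]] := tf.
have [_ [[c d] [/= cl dl g0]]] := tg.
exists (`[a, b] `*` `[c, d]); split.
- by apply: compact_setX; exact: segment_compact.
- move=> [x y] [/= ]; rewrite !in_itv /= => /andP[ax xb] /andP[cy yd].
  split => /=; rewrite in_itv /=.
    by rewrite (lt_le_trans a0 ax) (le_lt_trans xb bpi).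
  by rewrite (lt_le_trans cl cy) (le_lt_trans yd dl).
- move=> [x y] nK; rewrite /tens /=.
  have [xab|/negP/f0 ->] := boolP (a <= x <= b); last by rewrite mul0r.
  have [ycd|/negP/g0 ->] := boolP (c <= y <= d); last by rewrite mulr0.
  by exfalso; apply: nK; split; rewrite /= in_itv.
Qed.

End Tensor.

(** * Primitives of test functions *)

Section Primitive.
Context {R : realType}.
Notation leb := (@lebesgue_measure R).
Variables (a b : R).
Hypothesis ab : a < b.
Implicit Types f g : R -> R.

Lemma test1_bounds f : test1 a b f ->
  forall x, (x <= a) || (b <= x) -> f x = 0.
Proof.
move=> [_ [[p q] [/= ap qb f0]]] x xab; apply: f0 => /andP[px xq].
case/orP: xab => h.
  by have := lt_le_trans (lt_le_trans ap px) h; rewrite ltxx.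
by have := le_lt_trans (le_trans h xq) qb; rewrite ltxx.
Qed.

Lemma cont_integrable f (x y : R) : continuous f ->
  leb.-integrable `[x, y] (EFin \o f).
Proof.
move=> cf; apply: continuous_compact_integrable; first exact: segment_compact.
exact: continuous_subspaceT.
Qed.

Lemma FTC_smooth f x y : smooth1 1 f -> x <= y ->
  \int[leb]_(s in `[x, y]) derive1 f s = f y - f x.
Proof.
move=> sf; rewrite le_eqVlt => /predU1P[->|xy].
  by rewrite set_itv1 Rintegral_set1 subrr.
have [cf [df [cf' _]]] := sf.
have fE : derivable_oo_LRcontinuous f x y.
  split; first by move=> z _; exact: df.
  + by apply: cvg_at_right_filter; exact: cf.
  + by apply: cvg_at_left_filter; exact: cf.
have cf2 : {within `[x, y], continuous (derive1 f)} by exact: continuous_subspaceT.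
have f'E : {in `]x, y[, derive1 f =1 derive1 f} by move=> z _.
by have := congr1 (@fine R) (continuous_FTC2 xy cf2 fE f'E).
Qed.

(** To the left of the support the primitive is 0; to the right it equals the total integral, so
    mean zero is what gives it compact support. *)
Lemma test1_primitive f : test1 a b f ->
  \int[leb]_(s in `[a, b]) f s = 0 ->
  exists2 F, test1 a b F & derive1 F = f.
Proof.
move=> tf f0; have [sf [[p q] [/= ap qb fpq]]] := tf.
have cf : continuous f := (sf 0%N).1.
(* Starting at a - 1 makes every x >= p interior to the segment on which the fundamental theorem is
   applied. *)
pose F x := \int[leb]_(s in `[a - 1, x]) f s.
have int0 x y : (forall s, x <= s <= y -> f s = 0) ->
    \int[leb]_(s in `[x, y]) f s = 0.
  move=> h; rewrite (@eq_Rintegral _ _ _ _ _ (cst 0)); first by rewrite Rintegral_cst// mul0r.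
  by move=> s; rewrite inE /= in_itv/= => /h.
have fp s : s < p -> f s = 0.
  by move=> sp; apply: fpq => /andP[/(lt_le_trans sp)]; rewrite ltxx.
have fq s : q < s -> f s = 0.
  by move=> qs; apply: fpq => /andP[_ /(lt_le_trans qs)]; rewrite ltxx.
have F0 x : x < p -> F x = 0.
  by move=> xp; apply: int0 => s /andP[_ sx]; apply: fp; exact: le_lt_trans xp.
have dF (x : R) : is_derive x 1 F (f x).
  have [xp|px] := ltP x p.
    rewrite fp//.
    have nf : \near x, cst 0 x = F x.
      by apply: filterS (lt_nbhsl xp) => y yp; rewrite F0.
    exact: near_eq_is_derive nf (is_derive_cst (0 : R) x (1 : R)).
  have [//|||//|d1 d2] := @continuous_FTC1_closed _ f (a - 1) x (x + 1).
  - by rewrite ltrDl.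
  - exact: cont_integrable.
  - by apply: lt_le_trans px; apply: lt_trans ap; rewrite ltrBlDr ltrDl.
  - exact: cf.
  by split; [exact: d1|exact: etrans (esym (derive1E _ _)) d2].
have sF k : smooth1 k F.
  case: k => [|k]; last exact: smooth1_is_derive dF (sf k).
  exact: smooth1S (smooth1_is_derive dF (sf 0%N)).
have F'E : derive1 F = f.
  by apply/funext => x; rewrite derive1E; have [] := dF x.
exists F => //; split => //; exists (p, q); split=> //= x nx.
have [xp|px] := ltP x p; first exact: F0.
have [qx|xq] := ltP q x; last by exfalso; apply: nx; rewrite px.
have Fb : F b = 0.
  have := FTC_smooth (sF 1%N) (ltW ab); rewrite F'E f0 (F0 a)// subr0.
  exact: esym.
have [xb|bx] := leP x b.
  have := FTC_smooth (sF 1%N) xb; rewrite F'E Fb sub0r int0.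
    by move=> /esym/eqP; rewrite oppr_eq0 => /eqP.
  by move=> s /andP[xs _]; apply: fq; exact: lt_le_trans xs.
have := FTC_smooth (sF 1%N) (ltW bx); rewrite F'E Fb subr0 int0//.
by move=> s /andP[bs _]; apply: fq; exact: lt_le_trans bs.
Qed.

End Primitive.

(** * Lebesgue measure on a rectangle *)

Section Measures.
Context {R : realType}.
Local Notation Rm := (measurableTypeR R).
Local Notation leb := (@lebesgue_measure R).

Lemma oo_fin (a b : R) : (leb `]a, b[%classic < +oo)%E.
Proof. by rewrite lebesgue_measure_itv; case: ifP => _; rewrite ?ltry// -EFinB ltry. Qed.

(** A finite measure on the whole line instead of integrals over an interval: product measures and
    Fubini's theorem then apply without tracking domains. *)
Definition seg (a b : R) : {finite_measure set Rm -> \bar R} :=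
  mfrestr (measurable_itv `]a, b[ : measurable (`]a, b[%classic : set Rm)) (oo_fin a b).

Definition rect (a b c d : R) : {measure set (Rm * Rm)%type -> \bar R} :=
  (seg a b \x seg c d)%E.

#[global] Instance rect_ae_filter a b c d :
  Filter (almost_everywhere (rect a b c d)) := ae_filter_ringOfSetsType _.

#[global] Instance seg_ae_filter a b :
  Filter (almost_everywhere (seg a b)) := ae_filter_ringOfSetsType _.

Lemma segE a b (A : set Rm) : seg a b A = leb (A `&` `]a, b[).
Proof. by []. Qed.

Lemma seg_setT a b : a < b -> seg a b setT = (b - a)%:E.
Proof. by move=> ab; rewrite segE setTI lebesgue_measure_itv/= lte_fin ab. Qed.

Lemma seg_ae a b : \forall x \ae seg a b, a < x < b.
Proof.
exists (~` `]a, b[%classic); split.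
- by apply: measurableC; exact: measurable_itv.
- by apply: eq_trans (segE _ _ _) _; rewrite setICl measure0.
- by move=> x /= h; rewrite in_itv.
Qed.

Lemma seg_set1 a b x : seg a b [set x] = 0%E.
Proof.
apply/eqP; rewrite segE -measure_le0.
apply: (@le_trans _ _ (leb [set x])); last by rewrite lebesgue_measure_set1.
apply: le_measure; rewrite ?inE.
- by apply: measurableI; [exact: measurable_set1|exact: measurable_itv].
- exact: measurable_set1.
- by move=> y [].
Qed.

Lemma seg_integral a b (f : R -> \bar R) : measurable_fun setT f ->
  (\int[seg a b]_x f x = \int[leb]_(x in `]a, b[) f x)%E.
Proof.
move=> mf.
have mI : measurable (`]a, b[%classic : set Rm) by exact: measurable_itv.
have mC : measurable (~` `]a, b[%classic : set Rm) by exact: measurableC.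
have H g : measurable_fun setT g -> (forall x, 0 <= g x)%E ->
    (\int[seg a b]_x g x = \int[leb]_(x in `]a, b[) g x)%E.
  move=> mg g0.
  rewrite (@ge0_negligible_integral _ Rm R (seg a b) setT (~` `]a, b[%classic))//.
    rewrite setTD setCK; apply: eq_measure_integral => A mA AI.
    by apply: eq_trans (segE _ _ _) _; rewrite setIidl.
  by apply: eq_trans (segE _ _ _) _; rewrite setICl measure0.
rewrite integralE [RHS]integralE !H//.
- exact: measurable_funeneg.
- exact: measurable_funepos.
Qed.

Lemma seg_Rintegral a b (f : R -> R) : measurable_fun setT f ->
  \int[seg a b]_x f x = \int[leb]_(x in `[a, b]) f x.
Proof.
move=> mf; rewrite /Rintegral seg_integral; last exact/measurable_EFinP.
rewrite [in RHS]integral_itv_bndoo//.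
by apply/measurable_EFinP; exact: measurable_funTS.
Qed.

Section Rect.
Variables a b c d : R.
Local Notation m := (seg a b).
Local Notation n := (seg c d).
Local Notation M := (rect a b c d).
Implicit Types f g h : R * R -> R.

Lemma rect_setX (A B : set Rm) : measurable A -> measurable B ->
  M (A `*` B) = (m A * n B)%E.
Proof. by move=> mA mB; exact: product_measure1E. Qed.

Lemma rect_fin : (M setT < +oo)%E.
Proof.
rewrite -setXTT rect_setX//; apply: lte_mul_pinfty.
- exact: measure_ge0.
- exact: fin_num_measure.
- by rewrite -ge0_fin_numE// fin_num_measure.
Qed.

Lemma ae_fst (P : R -> Prop) : (\forall x \ae m, P x) -> \forall p \ae M, P p.1.
Proof.
move=> [N [mN N0 PN]]; exists (N `*` setT); split.
- exact: measurableX.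
- by rewrite rect_setX// N0 mul0e.
- by move=> p /= np; split=> //; apply: PN.
Qed.

Lemma ae_snd (P : R -> Prop) : (\forall y \ae n, P y) -> \forall p \ae M, P p.2.
Proof.
move=> [N [mN N0 PN]]; exists (setT `*` N); split.
- exact: measurableX.
- by rewrite rect_setX// N0 mule0.
- by move=> p /= np; split=> //; apply: PN.
Qed.

Lemma rect_ae : \forall p \ae M, (a < p.1 < b) /\ (c < p.2 < d).
Proof.
by apply: filterS2 (ae_fst (seg_ae a b)) (ae_snd (seg_ae c d)) => p.
Qed.

Lemma bounded_sqint K g : measurable_fun setT g ->
  (\forall p \ae M, `|g p| <= K) -> sqint M g.
Proof.
move=> mg gK; split=> //; apply/integrableP; split.
  by apply/measurable_EFinP; exact: measurable_funX.
apply: (@le_lt_trans _ _ (\int[M]_x (K ^+ 2)%:E)%E).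
  apply: ae_ge0_le_integral => //.
  - apply: measurableT_comp => //; apply/measurable_EFinP; exact: measurable_funX.
  - by move=> x _; rewrite lee_fin sqr_ge0.
  - apply: filterS gK => p hp _ /=; rewrite lee_fin normrX lerXn2r ?nnegrE//.
    exact: le_trans hp.
by rewrite integral_cst// lte_mul_pinfty// ?lee_fin ?sqr_ge0// rect_fin.
Qed.

Lemma rect_integrable_le h g K : M.-integrable setT (EFin \o h) ->
  measurable_fun setT g -> (forall p, `|g p| <= K) ->
  M.-integrable setT (EFin \o (fun p => h p * g p)).
Proof.
move=> ih mg gK.
have K0 : 0 <= K by exact: le_trans (gK (0, 0)).
apply: (le_integrable measurableT) (integrableZl measurableT K ih).
  apply/measurable_EFinP; apply: measurable_funM => //.
  by have /integrableP[/measurable_EFinP] := ih.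
move=> x _ /=; rewrite lee_fin !normrM (ger0_norm K0) mulrC.
by rewrite ler_wpM2r.
Qed.

Lemma tens_meas (u v : R -> R) : measurable_fun setT u -> measurable_fun setT v ->
  measurable_fun setT (tens u v).
Proof.
by move=> mu mv; apply: measurable_funM; apply: measurableT_comp.
Qed.

Lemma smooth1_meas k (u : R -> R) : smooth1 k u -> measurable_fun setT u.
Proof. by move=> /smooth1_cont; exact: continuous_measurable_fun. Qed.

(** Products of cutoffs are admissible tests, are bounded by 1 and converge to the indicator of a
    box; dominated convergence with majorant |h| concludes. *)
Lemma rect_uniq_itv h : M.-integrable setT (EFin \o h) ->
  (forall u v, test1 a b u -> test1 c d v -> \int[M]_p (h p * tens u v p) = 0) ->
  forall p q r s, (\int[M]_(z in `]p, q[ `*` `]r, s[) (h z)%:E = 0)%E.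
Proof.
move=> ih h0 p q r s.
(* The box is clipped to the rectangle so that the cutoffs are supported in it; the part removed is
   null for [M]. *)
pose p' := Num.max p a; pose q' := Num.min q b.
pose r' := Num.max r c; pose s' := Num.min s d.
pose f_ k z := (h z * tens (cutoff p' q' k) (cutoff r' s' k) z)%:E.
pose f z := (h z * tens (\1_(`]p', q'[%classic)) (\1_(`]r', s'[%classic)) z)%:E.
have mh : measurable_fun setT h by have /integrableP[/measurable_EFinP] := ih.
have mcut (x y : R) k : measurable_fun setT (cutoff x y k).
  exact: smooth1_meas ((cutoff_test x y k).1 0%N).
have tb k : test1 a b (cutoff p' q' k).
  have [sb [[x y] /= [h1 h2 h3]]] := cutoff_test p' q' k.
  split=> //; exists (x, y); split=> //=.
    by apply: le_lt_trans h1; rewrite le_max lexx orbT.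
  by apply: lt_le_trans h2 _; rewrite ge_min lexx orbT.
have tb' k : test1 c d (cutoff r' s' k).
  have [sb [[x y] /= [h1 h2 h3]]] := cutoff_test r' s' k.
  split=> //; exists (x, y); split=> //=.
    by apply: le_lt_trans h1; rewrite le_max lexx orbT.
  by apply: lt_le_trans h2 _; rewrite ge_min lexx orbT.
have mf : measurable_fun setT f.
  apply/measurable_EFinP; apply: measurable_funM => //.
  by apply: tens_meas; apply: measurable_indic; exact: measurable_itv.
have f_0 k : (\int[M]_z f_ k z = 0)%E.
  have := h0 _ _ (tb k) (tb' k); rewrite /Rintegral => e0.
  rewrite -[RHS]/(0%:E) -e0 fineK//; apply: integrable_fin_num => //.
  apply: (@rect_integrable_le _ _ 1) => //; first exact: tens_meas.
  move=> z; rewrite normrM -[leRHS]mulr1; apply: ler_pM => //; exact: cutoff_bound.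
have [] := @dominated_convergence _ _ _ M setT measurableT f_ f
  (abse \o (EFin \o h)).
- move=> k; apply/measurable_EFinP; apply: measurable_funM => //.
  exact: tens_meas.
- exact: mf.
- apply: aeW => z _; apply: cvg_EFin; first exact: nearW.
  apply: cvgM; first exact: cvg_cst.
  by apply: cvgM; exact: cutoff_cvg.
- exact: integrable_abse.
- apply: aeW => z k _; rewrite /f_ /= lee_fin normrM ler_piMr//.
  by rewrite normrM -[leRHS]mulr1; apply: ler_pM => //; exact: cutoff_bound.
move=> _ _ /=; rewrite (_ : (fun k => _) = cst 0%E); last exact/funext.
move=> /(cvg_unique (@ereal_hausdorff R) (cvg_cst _)) If.
rewrite [RHS]If integral_mkcond; apply: ae_eq_integral => //.
- apply/(measurable_restrictT _ _).1; first by apply: measurableX; exact: measurable_itv.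
  by apply/measurable_EFinP; exact: measurable_funTS.
apply: filterS rect_ae => -[x y] /= [/andP[ax xb] /andP[cy yd]] _.
rewrite /f /tens /patch /= !indicE !mem_setE.
have -> : ((x, y) \in `]p, q[ `*` `]r, s[) = (x \in `]p, q[) && (y \in `]r, s[).
  apply/idP/idP; first by rewrite inE /= => -[-> ->].
  by move=> /andP[hx hy]; rewrite inE.
rewrite !in_itv /= !gt_max !lt_min ax xb cy yd !andbT.
case: (p < x < q); case: (r < y < s) => /=; rewrite ?mulr1 ?mulr0 ?mul0r ?mulr0//.
Qed.

End Rect.

(** The sets A on which the integral vanishes form a lambda-system. The map [p] allows one
    coordinate to be treated at a time: it will be each projection in turn, then the identity. *)
Lemma dynkin_integral0 d1 d2 (T1 : measurableType d1) (T2 : measurableType d2)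
    (mu : {measure set T1 -> \bar R}) (f : T1 -> \bar R) (E : set T1)
    (p : T1 -> T2) (G : set (set T2)) :
  mu.-integrable setT f -> measurable E -> measurable_fun setT p ->
  @measurable _ T2 = <<s G >> -> setI_closed G ->
  (\int[mu]_(x in E) f x = 0)%E ->
  (forall A, G A -> (\int[mu]_(x in E `&` p @^-1` A) f x = 0)%E) ->
  forall A, measurable A -> (\int[mu]_(x in E `&` p @^-1` A) f x = 0)%E.
Proof.
move=> fi mE mp GE GI E0 G0 A; rewrite GE.
have mpA B : measurable B -> measurable (E `&` p @^-1` B).
  by move=> mB; apply: measurableI => //; rewrite -[X in measurable X]setTI; exact: mp.
pose P A := (\int[mu]_(x in E `&` p @^-1` A) f x = 0)%E.
move: A; apply: (@dynkin_induction _ T2 G P GE GI); rewrite /P => //=.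
- by rewrite preimage_setT setIT.
- move=> S mS S0.
  have := E0.
  rewrite -{1}(setIT E) -(setUv (p @^-1` S)) setIUr integral_setU//.
  + by rewrite S0 add0e preimage_setC.
  + exact: mpA.
  + by rewrite preimage_setC; apply: mpA; exact: measurableC.
  + by apply: measurable_funTS; exact: measurable_int fi.
  + by apply/disj_setPS => x [[_ /= h] [_ /= /(_ h)]].
- move=> F mF tF F0; rewrite preimage_bigcup setI_bigcupr integral_bigcup.
  + by apply: eseries0 => k _ _; exact: F0.
  + apply/trivIsetP => i j _ _ ij; rewrite setIACA setIid -preimage_setI.
    by move/trivIsetP : tF => /(_ i j I I ij) ->; rewrite preimage_set0 setI0.
  + by move=> k; exact: mpA.
  + apply: (integrableS measurableT) => //; apply: bigcup_measurable => k _; exact: mpA.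
Qed.

Lemma itvoo_setI_closed : setI_closed (@RGenOpens.G R).
Proof.
move=> _ _ [p [q ->]] [r [s ->]]; exists (Num.max p r), (Num.min q s).
apply/seteqP; split=> x /=; rewrite !in_itv /= gt_max lt_min.
  by move=> [/andP[-> ->] /andP[-> ->]].
by move=> /andP[/andP[-> ->] /andP[-> ->]].
Qed.

(** The fundamental lemma of the calculus of variations, for product tests. The vanishing of the
    integrals passes from boxes to Borel x interval ([H2]), to Borel x Borel ([H3]) and to all
    measurable sets ([H4]). *)
Lemma rect_uniq a b c d (h : R * R -> R) :
  (rect a b c d).-integrable setT (EFin \o h) ->
  (forall u v, test1 a b u -> test1 c d v ->
    \int[rect a b c d]_p (h p * tens u v p) = 0) ->
  \forall p \ae rect a b c d, h p = 0.
Proof.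
move=> ih h0; set M := rect a b c d.
have H1 := rect_uniq_itv ih h0.
have mGE : @measurable _ Rm = <<s @RGenOpens.G R >> by exact: RGenOpens.measurableE.
have mo (x y : R) : measurable (`]x, y[%classic : set Rm) by exact: measurable_itv.
(* The full line is not one of the bounded intervals that generate the sigma-algebra, so the
   starting sets of the pi-lambda argument are first cut down to the rectangle, which carries all of
   [M]. *)
have HR (E : set (Rm * Rm)) : measurable E ->
    (\int[M]_(x in E) (h x)%:E = \int[M]_(x in E `&` (`]a, b[ `*` `]c, d[)) (h x)%:E)%E.
  move=> mE; have mR : measurable (`]a, b[ `*` `]c, d[ : set (Rm * Rm)).
    exact: measurableX.
  rewrite (@negligible_integral _ _ _ M E (~` (`]a, b[ `*` `]c, d[)))//.
  - by rewrite setDE setCK.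
  - exact: measurableC.
  - exact: integrableS ih.
  - apply/negligibleP; first exact: measurableC.
    have := rect_ae a b c d; apply: filterS => -[x y] /= [ha hb].
    by split; rewrite /= in_itv.
have H2 (A : set Rm) r s : measurable A ->
    (\int[M]_(x in A `*` `]r, s[) (h x)%:E = 0)%E.
  move=> mA; rewrite (_ : A `*` `]r, s[ = (setT `*` `]r, s[) `&` fst @^-1` A); last first.
    by apply/seteqP; split=> -[x y] /=; [move=> []|move=> [[]]].
  apply: (@dynkin_integral0 _ _ (Rm * Rm)%type Rm M (EFin \o h)
    (setT `*` `]r, s[) fst (@RGenOpens.G R)) => //.
  - exact: measurableX.
  - exact: itvoo_setI_closed.
  - rewrite HR; last exact: measurableX.
    rewrite (_ : _ `&` _ = `]a, b[ `*` `]Num.max r c, Num.min s d[) ?H1//.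
    apply/seteqP; split=> -[x y] /=; rewrite !in_itv /= gt_max lt_min.
      by move=> [[_ /andP[-> ->]] [-> /andP[-> ->]]].
    by move=> [-> /andP[/andP[-> ->] /andP[-> ->]]].
  - move=> _ [p [q ->]]; rewrite (_ : _ `&` _ = `]p, q[ `*` `]r, s[) ?H1//.
    by apply/seteqP; split=> -[x y] /=; [move=> [[]]|move=> []].
have H3 (A B : set Rm) : measurable A -> measurable B ->
    (\int[M]_(x in A `*` B) (h x)%:E = 0)%E.
  move=> mA mB; rewrite (_ : A `*` B = (A `*` setT) `&` snd @^-1` B); last first.
    by apply/seteqP; split=> -[x y] /=; [move=> []|move=> [[]]].
  apply: (@dynkin_integral0 _ _ (Rm * Rm)%type Rm M (EFin \o h)
    (A `*` setT) snd (@RGenOpens.G R)) => //.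
  - exact: measurableX.
  - exact: itvoo_setI_closed.
  - rewrite HR; last exact: measurableX.
    rewrite (_ : _ `&` _ = (A `&` `]a, b[) `*` `]c, d[) ?H2//; first exact: measurableI.
    by apply/seteqP; split=> -[x y] /=; [move=> [[? ?] [? ?]]|move=> [[? ?] ?]].
  - move=> _ [p [q ->]]; rewrite (_ : _ `&` _ = A `*` `]p, q[) ?H2//.
    by apply/seteqP; split=> -[x y] /=; [move=> [[]]|move=> []].
have H4 A : measurable A -> (\int[M]_(x in A) (h x)%:E = 0)%E.
  move=> mA; rewrite -(setTI A) -[X in _ `&` X]/(id @^-1` A).
  apply: (@dynkin_integral0 _ _ (Rm * Rm)%type (Rm * Rm)%type M (EFin \o h)
    setT id _ _ _ _ (measurable_prod_measurableType Rm Rm)) => //.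
  - move=> _ _ [A1 mA1 [B1 mB1 <-]] [A2 mA2 [B2 mB2 <-]].
    exists (A1 `&` A2); first exact: measurableI.
    exists (B1 `&` B2); first exact: measurableI.
    by apply/seteqP; split=> -[x y] /= [[? ?] [? ?]].
  - by rewrite -setXTT H3.
  - by move=> _ [A1 mA1 [B1 mB1 <-]]; rewrite setTI; exact: H3.
have : ae_eq M setT (EFin \o h) (cst 0%E).
  apply: integral_ae_eq => // E _ mE.
  by rewrite H4// integral0.
by apply: filterS => z /(_ I) [].
Qed.

End Measures.

(** * Primitives and weak derivatives in one direction *)

Section Slab.
Context {R : realType}.
Local Notation Rm := (measurableTypeR R).
Local Notation leb := (@lebesgue_measure R).
Variables a b c d : R.
Local Notation m := (seg a b).
Local Notation n := (seg c d).
Local Notation M := (rect a b c d).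
Implicit Types f g h w z : R * R -> R.

Lemma measurable_integral_section d1 d2 (T1 : measurableType d1)
    (T2 : measurableType d2) (nu : {sigma_finite_measure set T2 -> \bar R})
    (G : T1 * T2 -> \bar R) : measurable_fun setT G ->
  measurable_fun setT (fun p => \int[nu]_s G (p, s))%E.
Proof.
move=> mG.
have -> : (fun p => \int[nu]_s G (p, s))%E =
    ((fun p => \int[nu]_s G^\+ (p, s)) \- (fun p => \int[nu]_s G^\- (p, s)))%E.
  apply/funext => p; rewrite integralE.
  under eq_integral do rewrite funepos_comp/=.
  by under [X in (_ - X)%E = _]eq_integral do rewrite funeneg_comp/=.
apply: emeasurable_funB.
- apply: (@measurable_fun_fubini_tonelli_F _ _ T1 T2 R nu G^\+%E) => //.
  exact: measurable_funepos.
- apply: (@measurable_fun_fubini_tonelli_F _ _ T1 T2 R nu G^\-%E) => //.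
  exact: measurable_funeneg.
Qed.

(* Fubini turns the transpose of [kappa] into the adjoint operator. *)
Definition slab (kappa : R -> R -> bool) w : R * R -> R :=
  fun p => \int[m]_s (w (s, p.2) * (kappa s p.1)%:R).

Definition mkernel (kappa : R -> R -> bool) : Prop :=
  measurable_fun setT (fun z : Rm * Rm => (kappa z.1 z.2)%:R : R).

Lemma measurable_slab kappa w : mkernel kappa -> measurable_fun setT w ->
  measurable_fun setT (slab kappa w).
Proof.
move=> mk mw; rewrite /slab /Rintegral.
apply: (@measurableT_comp _ _ _ _ _ _ (@fine R)); first exact: fine_measurable.
pose G : (Rm * Rm) * Rm -> \bar R :=
  fun q => (w (q.2, q.1.2) * (kappa q.2 q.1.1)%:R)%:E.
apply: (@measurable_integral_section _ _ _ _ m G).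
apply/measurable_EFinP; apply: measurable_funM.
  apply: (@measurableT_comp _ _ _ _ _ _ w) => //.
  apply: measurable_fun_pair => //=.
  by apply: measurableT_comp.
have mg : measurable_fun setT (fun q : (Rm * Rm) * Rm => (q.2, q.1.1)).
  apply: measurable_fun_pair => //=.
  by apply: measurableT_comp.
exact: measurableT_comp mk mg.
Qed.

Lemma measurable_slice w y : measurable_fun setT w ->
  measurable_fun setT (fun x => w (x, y)).
Proof. by move=> mw; apply: measurableT_comp => //; exact: measurable_pair2. Qed.

Lemma measurable_kslice kappa x : mkernel kappa ->
  measurable_fun setT (fun s => (kappa s x)%:R : R).
Proof.
move=> mk; have mg : measurable_fun setT (fun s : Rm => (s, x) : Rm * Rm).
  exact: measurable_pair2.
exact: measurableT_comp mk mg.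
Qed.

Lemma slice_sqint w : sqint M w ->
  \forall y \ae n, sqint m (fun x => w (x, y)).
Proof.
move=> [mw w2].
have := ae_integrable2 w2; apply: filterS => y hy; split=> //.
exact: measurable_slice.
Qed.

Lemma kappa_sqint kappa x : mkernel kappa -> sqint m (fun s => (kappa s x)%:R).
Proof.
move=> mk; have mkx := measurable_kslice x mk.
split=> //; apply: measurable_bounded_integrable => //.
- by rewrite -ge0_fin_numE// fin_num_measure.
- exact: measurable_funX.
- exists 1; split=> // y y1 s _ /=.
  rewrite normrX normr_nat; case: (kappa s x) => /=.
    by rewrite expr1n ltW.
  by rewrite expr0n/= ltW// (lt_trans ltr01).
Qed.

(** Cauchy-Schwarz on a slice; a kernel with values 0 and 1 equals its square. *)
Lemma slab_bound kappa w x y : mkernel kappa -> sqint m (fun s => w (s, y)) ->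
  slab kappa w (x, y) ^+ 2 <=
  \int[m]_s (kappa s x)%:R * \int[m]_s (w (s, y)) ^+ 2.
Proof.
move=> mk hw; have := ip_cs hw (kappa_sqint x mk).
rewrite /ip mulrC [X in X * _](_ : _ = \int[m]_s (kappa s x)%:R).
  by rewrite [X in _ * X](_ : _ = \int[m]_s (w (s, y)) ^+ 2).
by apply: eq_Rintegral => s _; case: (kappa s x); rewrite ?mulr1 ?mulr0.
Qed.

(** The slice bound is a function of x times a function of y, so Tonelli's theorem integrates it to
    a product. The weight [chi] is 1 for the norm of a slab operator and the indicator of a strip
    for the edge estimates. *)
Lemma slab_sqint_bound kappa w (chi k : R -> R) :
  mkernel kappa -> sqint M w -> measurable_fun setT chi ->
  m.-integrable setT (EFin \o k) -> (forall x, 0 <= k x) ->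
  (forall x, a < x < b -> chi x ^+ 2 * \int[m]_s (kappa s x)%:R <= k x) ->
  let f := fun p => chi p.1 * slab kappa w p in
  sqint M f /\ ip M f f <= \int[m]_x k x * ip M w w.
Proof.
move=> mk hw mchi ik k0 hk f.
have mks : measurable_fun setT k by have /integrableP[/measurable_EFinP] := ik.
have [mw w2] := hw.
have mf : measurable_fun setT f.
  by apply: measurable_funM; [exact: measurableT_comp|exact: measurable_slab].
pose Be y := (\int[m]_s ((w (s, y)) ^+ 2)%:E)%E.
have Be0 y : (0 <= Be y)%E by apply: integral_ge0 => s _; rewrite lee_fin sqr_ge0.
have mBe : measurable_fun setT Be.
  apply: (@measurable_fun_fubini_tonelli_G _ _ Rm Rm R m (fun p => (w p ^+ 2)%:E)).
    by apply/measurable_EFinP; exact: measurable_funX.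
  by move=> p; rewrite lee_fin sqr_ge0.
have mkB : measurable_fun setT (fun p : Rm * Rm => (k p.1)%:E * Be p.2)%E.
  apply: emeasurable_funM; last exact: measurableT_comp.
  by apply/measurable_EFinP; exact: measurableT_comp.
have IkB : (\int[M]_p ((k p.1)%:E * Be p.2) = (\int[m]_x k x * ip M w w)%:E)%E.
  rewrite (@fubini_tonelli2 _ _ Rm Rm R m n (fun p => (k p.1)%:E * Be p.2)%E)//; last first.
    by move=> p; rewrite mule_ge0// lee_fin.
  rewrite /fubini_G /=.
  transitivity (\int[n]_y ((\int[m]_x k x)%:E * Be y))%E.
    apply: eq_integral => y _.
    rewrite ge0_integralZr//.
    - by rewrite /Rintegral fineK//; exact: integrable_fin_num.
    - by apply/measurable_EFinP.
    - by move=> x _; rewrite lee_fin.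
  rewrite ge0_integralZl//; last by rewrite lee_fin Rintegral_ge0.
  rewrite EFinM; congr (_ * _)%E.
  rewrite /ip /Rintegral fineK; last first.
    by have := integrable_fin_num measurableT w2.
  rewrite (@fubini_tonelli2 _ _ Rm Rm R m n (fun p => (w p ^+ 2)%:E))//.
  - by apply/measurable_EFinP; exact: measurable_funX.
  - by move=> p; rewrite lee_fin sqr_ge0.
have le1 : (\int[M]_p (f p ^+ 2)%:E <= (\int[m]_x k x * ip M w w)%:E)%E.
  rewrite -IkB; apply: ae_ge0_le_integral => //.
  - by move=> p _; rewrite lee_fin sqr_ge0.
  - by apply/measurable_EFinP; exact: measurable_funX.
  - by move=> p _; rewrite mule_ge0// lee_fin.
  apply: filterS2 (ae_fst c d (seg_ae a b)) (ae_snd a b (slice_sqint hw)) => -[x y] /= hx hy _.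
  have -> : Be y = (\int[m]_s (w (s, y)) ^+ 2)%:E.
    by rewrite /Rintegral fineK//; exact: integrable_fin_num hy.2.
  rewrite -EFinM lee_fin /f /= exprMn.
  apply: (@le_trans _ _ (chi x ^+ 2 * (\int[m]_s (kappa s x)%:R * \int[m]_s (w (s, y)) ^+ 2))).
    by rewrite ler_wpM2l ?sqr_ge0//; exact: slab_bound.
  rewrite mulrA ler_wpM2r ?hk//.
  by apply: Rintegral_ge0 => s _; exact: sqr_ge0.
have sf : sqint M f.
  split=> //; apply/integrableP; split.
    by apply/measurable_EFinP; exact: measurable_funX.
  apply: le_lt_trans (ltry (\int[m]_x k x * ip M w w)).
  apply: le_trans le1; apply: ge0_le_integral => //.
  - by apply: measurableT_comp => //; apply/measurable_EFinP; exact: measurable_funX.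
  - by apply/measurable_EFinP; exact: measurable_funX.
  - by move=> p _; rewrite /= lee_fin ger0_norm// sqr_ge0.
split=> //.
rewrite -lee_fin; apply: le_trans le1.
rewrite /ip /Rintegral fineK//; exact: integrable_fin_num sf.2.
Qed.

End Slab.

(** * Transposition of slab operators *)

Section Adjoint.
Context {R : realType}.
Local Notation Rm := (measurableTypeR R).
Local Notation leb := (@lebesgue_measure R).
Variables a b c d : R.
Local Notation m := (seg a b).
Local Notation n := (seg c d).
Local Notation M := (rect a b c d).
Implicit Types f g h w z : R * R -> R.

Lemma sqint_integrable1 (u : R -> R) : sqint m u -> m.-integrable setT (EFin \o u).
Proof.
move=> hu; have h1 : sqint m (fun s => (true)%:R).
  apply: (@kappa_sqint _ a b (fun _ _ => true) 0).
  exact: measurable_cst.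
have := ip_integrable hu h1; apply: eq_integrable => // x _ /=.
by rewrite mulr1.
Qed.

Lemma slab_adj1 kappa (u v : R -> R) : mkernel kappa ->
  sqint m u -> sqint m v ->
  (\int[m]_x ((\int[m]_s (u s * (kappa s x)%:R))%R * v x)%:E =
   \int[m]_s (u s * (\int[m]_x (v x * (kappa s x)%:R))%R)%:E)%E.
Proof.
move=> mk hu hv.
pose F : Rm * Rm -> \bar R := fun q => (u q.1 * v q.2 * (kappa q.1 q.2)%:R)%:E.
have mkr s : measurable_fun setT (fun x => (kappa s x)%:R : R).
  have mg : measurable_fun setT (fun x : Rm => (s, x) : Rm * Rm).
    exact: measurable_pair1.
  exact: measurableT_comp mk mg.
have ki (x : R) (t : R -> R) (e : R -> bool) : sqint m t ->
    measurable_fun setT (fun s => (e s)%:R : R) ->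
    m.-integrable setT (EFin \o (fun s => t s * (e s)%:R)).
  move=> ht me; apply: (le_integrable measurableT) (sqint_integrable1 ht).
    by apply/measurable_EFinP; apply: measurable_funM => //; exact: sqint_meas ht.
  by move=> s _ /=; rewrite lee_fin normrM; case: (e s); rewrite ?normr1 ?normr0 ?mulr1 ?mulr0.
have mF : measurable_fun setT F.
  apply/measurable_EFinP; apply: measurable_funM; last exact: mk.
  by apply: measurable_funM; apply: measurableT_comp => //;
    [exact: sqint_meas hu|exact: sqint_meas hv].
(* The kernel is at most 1, so |F| is dominated by |u(x)| |v(y)|, a product of integrable
   functions. *)
have iF : (m \x m)%E.-integrable setT F.
  apply/integrable12ltyP => //.
  apply: (@le_lt_trans _ _ (\int[m]_x ((`|u x| * \int[m]_y `|v y|)%R)%:E)%E).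
    apply: ge0_le_integral => //.
    - by move=> x _; apply: integral_ge0.
    - apply: (@measurable_integral_section _ _ _ Rm Rm m (abse \o F)).
      exact: measurableT_comp.
    - apply/measurable_EFinP; apply: measurable_funM => //.
      by apply: measurableT_comp => //; exact: sqint_meas hu.
    move=> x _; rewrite EFinM /Rintegral fineK; last first.
      exact: integrable_fin_num (integrable_norm (sqint_integrable1 hv)).
    rewrite -ge0_integralZl//; last first.
      by apply/measurable_EFinP; apply: measurableT_comp => //; exact: sqint_meas hv.
    apply: ge0_le_integral => //.
    - by apply: measurableT_comp => //; apply: (@measurableT_comp _ _ _ _ _ _ F) => //; exact: measurable_pair1.
    - apply: emeasurable_funM => //; apply/measurable_EFinP.
      by apply: measurableT_comp => //; exact: sqint_meas hv.
    - move=> y _; rewrite /F /= -EFinM lee_fin !normrM.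
      by case: (kappa x y); rewrite ?normr1 ?normr0 ?mulr1 ?mulr0// mulr_ge0.
  under eq_integral do rewrite EFinM.
  rewrite integralZr//; last exact: integrable_norm (sqint_integrable1 hu).
  have := integrable_fin_num measurableT (integrable_norm (sqint_integrable1 hu)).
  by move=> /fineK <-; rewrite -EFinM ltry.
transitivity (\int[m]_x \int[m]_s F (s, x))%E.
  apply: eq_integral => x _; have ikx := ki 0 _ _ hu (measurable_kslice x mk).
  rewrite mulrC EFinM /Rintegral fineK; last exact: integrable_fin_num ikx.
  rewrite -integralZl//; apply: eq_integral => s _.
  by rewrite /F /= -EFinM mulrCA mulrA.
rewrite -(Fubini iF); apply: eq_integral => s _; have ikx := ki 0 _ _ hv (mkr s).
rewrite EFinM /Rintegral fineK; last exact: integrable_fin_num ikx.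
rewrite -integralZl//; apply: eq_integral => x _.
by rewrite /F /= -EFinM mulrA.
Qed.

(** For almost every y both slices are square-integrable, and [slab_adj1] exchanges the integrals on
    that slice; integrating in y finishes. *)
Lemma slab_adj kappa w z : mkernel kappa -> sqint M w -> sqint M z ->
  sqint M (slab a b kappa w) -> sqint M (slab a b (fun s x => kappa x s) z) ->
  ip M (slab a b kappa w) z = ip M w (slab a b (fun s x => kappa x s) z).
Proof.
move=> mk hw hz h1 h2.
have i1 := ip_integrable h1 hz; have i2 := ip_integrable hw h2.
rewrite /ip /Rintegral; congr fine.
rewrite -(integral21_prod_meas1 i1) -(integral21_prod_meas1 i2).
apply: ae_eq_integral => //.
- exact: measurable_fubini_G i1.
- exact: measurable_fubini_G i2.
have FF := ae_filter_ringOfSetsType n.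
apply: (filterS2 (F := almost_everywhere n)) (slice_sqint hw) (slice_sqint hz) => y wy zy _.
by rewrite /fubini_G /= /slab /=; exact: slab_adj1.
Qed.

End Adjoint.

Section WeakEq.
Context d (T : measurableType d) (R : realType).
Variable mu : {measure set T -> \bar R}.
Implicit Types f g h : T -> R.

(* Equality almost everywhere, in the form in which it is used. *)
Definition weq f g : Prop := forall h, sqint mu h -> ip mu f h = ip mu g h.

Lemma weq_ae f g : sqint mu f -> sqint mu g ->
  (\forall x \ae mu, f x = g x) -> weq f g.
Proof. by move=> hf hg fg h hh; exact: ip_ae. Qed.

Lemma weq_ip f g f' g' : sqint mu f -> sqint mu g' ->
  weq f f' -> weq g g' -> ip mu f g = ip mu f' g'.
Proof. by move=> hf hg' ff' gg'; rewrite ipC gg'// ipC ff'. Qed.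

End WeakEq.

(** * Primitives along slices and integration by parts *)

Section Kernels.
Context {R : realType}.
Local Notation Rm := (measurableTypeR R).
Local Notation leb := (@lebesgue_measure R).

Lemma measurable_fun_bool2R d (T : measurableType d) (e : T -> bool) :
  measurable_fun setT e -> measurable_fun setT (fun z => (e z)%:R : R).
Proof.
move=> me; rewrite (_ : (fun _ => _) = (fun z => if e z then 1 else 0)).
  exact: measurable_fun_ifT.
by apply/funext => z; case: (e z).
Qed.

Lemma mkernel_lt : mkernel (fun s x : R => s < x).
Proof. by apply: measurable_fun_bool2R; exact: measurable_fun_ltr. Qed.

Lemma mkernel_gt : mkernel (fun s x : R => x < s).
Proof. by apply: measurable_fun_bool2R; exact: measurable_fun_ltr. Qed.

Lemma mkernel_true : mkernel (fun _ _ : R => true).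
Proof. exact: measurable_cst. Qed.

Variables a b c d : R.
Hypotheses (ab : a < b) (cd : c < d).
Local Notation m := (seg a b).
Local Notation n := (seg c d).
Local Notation M := (rect a b c d).
Implicit Types (f g h w z : R * R -> R) (phi psi : R -> R).

(** The primitive from the edge x = a; next come its adjoint, which integrates from x to b, and the
    integral over the whole slice, not divided by b - a. *)
Definition integral_left := slab a b (fun s x : R => s < x).
Definition integral_right := slab a b (fun s x : R => x < s).
Definition integral_slice := slab a b (fun _ _ : R => true).
Local Notation Jx := integral_left.
Local Notation Jt := integral_right.
Local Notation Av := integral_slice.

Lemma seg_Rcst (k : R) : \int[m]_x k = k * (b - a).
Proof. by rewrite Rintegral_cst//; congr (_ * _); exact: (congr1 fine (seg_setT ab)). Qed.

Lemma kernel_le (e : R -> bool) : measurable_fun setT (fun s => (e s)%:R : R) ->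
  \int[m]_s (e s)%:R <= b - a.
Proof.
move=> me; rewrite -[leRHS]mul1r -seg_Rcst.
apply: le_Rintegral => //.
- apply: measurable_bounded_integrable => //.
    by rewrite -ge0_fin_numE// fin_num_measure.
  exists 1; split=> // y y1 s _ /=.
  by rewrite normr_nat; case: (e s) => /=; apply: ltW => //; exact: lt_trans y1.
- by apply: finite_measure_integrable_cst.
- by move=> s _; case: (e s).
Qed.

Lemma slab_sqint kappa w : mkernel kappa -> sqint M w ->
  sqint M (slab a b kappa w) /\
  ip M (slab a b kappa w) (slab a b kappa w) <= (b - a) ^+ 2 * ip M w w.
Proof.
move=> mk hw.
have ba0 : 0 <= b - a by rewrite subr_ge0 ltW.
have := @slab_sqint_bound R a b c d kappa w (cst 1) (cst (b - a)) mk hw.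
rewrite (_ : (fun p => cst 1 p.1 * slab a b kappa w p) = slab a b kappa w); last first.
  by apply/funext => p; rewrite /= mul1r.
rewrite /= seg_Rcst -expr2; apply=> //.
- by apply: finite_measure_integrable_cst.
- by move=> x _; rewrite expr1n mul1r; apply: kernel_le; exact: measurable_kslice.
Qed.

Lemma Jx_sqint w : sqint M w -> sqint M (Jx w).
Proof. by move=> hw; have [] := slab_sqint mkernel_lt hw. Qed.

Lemma Jt_sqint w : sqint M w -> sqint M (Jt w).
Proof. by move=> hw; have [] := slab_sqint mkernel_gt hw. Qed.

Lemma Av_sqint w : sqint M w -> sqint M (Av w).
Proof. by move=> hw; have [] := slab_sqint mkernel_true hw. Qed.

Lemma Jx_adj w z : sqint M w -> sqint M z -> ip M (Jx w) z = ip M w (Jt z).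
Proof.
move=> hw hz; apply: (slab_adj mkernel_lt) => //.
  exact: Jx_sqint.
exact: Jt_sqint.
Qed.

Lemma Av_adj w z : sqint M w -> sqint M z -> ip M (Av w) z = ip M w (Av z).
Proof.
move=> hw hz; apply: (slab_adj mkernel_true) => //; exact: Av_sqint.
Qed.

(** The two kernels add up to 1 except at s = x, a null set on each slice. *)
Lemma Jx_Jt w : sqint M w -> weq M (Jx w + Jt w) (Av w).
Proof.
move=> hw; have hJ := Jx_sqint hw; have hJt := Jt_sqint hw; have hA := Av_sqint hw.
apply: weq_ae => //; first exact: sqintD.
apply: filterS (ae_snd a b (slice_sqint hw)) => -[x y] /= hy.
have ki (kappa : R -> R -> bool) : mkernel kappa ->
    m.-integrable setT (EFin \o (fun s => w (s, y) * (kappa s x)%:R)).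
  by move=> mk; apply: ip_integrable => //; exact: kappa_sqint.
have k1 := ki _ mkernel_lt; have k2 := ki _ mkernel_gt; have k3 := ki _ mkernel_true.
rewrite fctE /integral_left /integral_right /integral_slice /slab /= -RintegralD//.
rewrite /Rintegral; congr fine; apply: ae_eq_integral => //.
- apply/measurable_EFinP; apply: measurable_funD.
    by have /integrableP[/measurable_EFinP] := k1.
  by have /integrableP[/measurable_EFinP] := k2.
- by have /integrableP[] := k3.
exists [set x : Rm]; split; [exact: measurable_set1|exact: seg_set1|].
move=> s /= h; apply: contrapT => sx; apply: h => _; congr EFin.
have /eqP := sx; rewrite neq_lt => /orP[h|h]; rewrite h.
  by rewrite ltNge (ltW h)/= mulr0 addr0.
by rewrite ltNge (ltW h)/= mulr0 add0r.
Qed.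

(** On a null set of slices the integrals need not exist, so additivity is obtained weakly, by
    transposing the operator onto the test function. *)
Lemma JxD f g : sqint M f -> sqint M g -> weq M (Jx (f + g)) (Jx f + Jx g).
Proof.
move=> hf hg h hh; have hfg := sqintD hf hg.
have hJf := Jx_sqint hf; have hJg := Jx_sqint hg; have ht := Jt_sqint hh.
by rewrite (Jx_adj hfg hh) (ipDl hf hg ht) (ipDl hJf hJg hh) !Jx_adj.
Qed.

Lemma JtD f g : sqint M f -> sqint M g -> weq M (Jt (f + g)) (Jt f + Jt g).
Proof.
move=> hf hg h hh; have hfg := sqintD hf hg.
rewrite (ipC M (Jt (f + g))) -Jx_adj// ipDr//; last exact: Jx_sqint.
rewrite ipDl//; try exact: Jt_sqint.
by rewrite !Jx_adj// (ipC M h) (ipC M h).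
Qed.

Definition xind f : Prop := forall x x' y, f (x, y) = f (x', y).

Lemma Av_xind w : xind (Av w).
Proof. by move=> x x' y; apply: eq_Rintegral => s _. Qed.

Lemma Av_of_xind f : xind f -> Av f = (b - a) *: f.
Proof.
move=> hf; apply/funext => -[x y]; rewrite /integral_slice /slab /=.
transitivity (\int[m]_s f (x, y)); last by rewrite seg_Rcst mulrC.
by apply: eq_Rintegral => s _; rewrite mulr1; exact: hf.
Qed.

(** A function of y alone is its own slice average, and [Av] is self-adjoint. *)
Lemma ip_xind f z : xind f -> sqint M f -> sqint M z ->
  ip M f z = (b - a)^-1 * ip M f (Av z).
Proof.
move=> xf hf hz; rewrite -Av_adj// Av_of_xind// ipZl// mulrA mulVf ?mul1r//.
by rewrite gt_eqF// subr_gt0.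
Qed.

(** Here e and f stand for the traces of u and v at x = a, while e + Av w and f + Av z stand for
    those at x = b. The factor 1/(b - a) turns a product over the rectangle of functions of y alone
    into the product over an edge. *)
Lemma ibp (u w v z e f : R * R -> R) :
  sqint M w -> sqint M z -> sqint M e -> sqint M f ->
  sqint M u -> sqint M v -> xind e -> xind f ->
  weq M u (e + Jx w) -> weq M v (f + Jx z) ->
  ip M u z + ip M w v =
  (b - a)^-1 * (ip M (e + Av w) (f + Av z) - ip M e f).
Proof.
move=> hw hz he hf hu hv xe xf uE vE.
have hJw := Jx_sqint hw; have hJz := Jx_sqint hz.
have hAw := Av_sqint hw; have hAz := Av_sqint hz; have hJtw := Jt_sqint hw.
rewrite uE// (ipC M w v) vE// !ipDl//; try exact: sqintD.
rewrite !(ipDr _ _ he) // !(ipDr _ _ hAw)//.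
(* After this transposition the two double integrals add up to one pairing with [Av w], by
   [Jx_Jt]. *)
have -> : ip M (Jx z) w = ip M (Jt w) z by rewrite Jx_adj// ipC.
have e2 : ip M (Jx w) z + ip M (Jt w) z = ip M (Av w) z.
  by rewrite -Jx_Jt// ipDl.
rewrite (ip_xind xe he hz) (ip_xind xf hf hw).
have := ip_xind (Av_xind w) hAw hz; rewrite -e2 => e3.
rewrite (ipC M f) addrACA e3; ring.
Qed.

Definition wderx u w : Prop := forall phi psi, test1 a b phi -> test1 c d psi ->
  ip M u (tens (derive1 phi) psi) = - ip M w (tens phi psi).

Lemma test_meas x y phi : test1 x y phi -> measurable_fun setT phi.
Proof. by move=> [sp _]; exact: smooth1_meas (sp 0%N). Qed.

Lemma test_bounded (x y : R) phi : x < y -> test1 x y phi ->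
  exists K, forall s, `|phi s| <= K.
Proof.
move=> xy tp; have cp : {within `[x, y], continuous (fun s => `|phi s|)}.
  apply: continuous_subspaceT => s; apply: continuous_comp; first exact: (tp.1 0%N).1.
  exact: norm_continuous.
have [s _ hs] := EVT_max (ltW xy) cp.
exists `|phi s| => t; have [/andP[xt ty]|] := boolP (x <= t <= y).
  by apply: hs; rewrite in_itv /= xt.
rewrite negb_and -!ltNge => h.
rewrite (test1_bounds tp) ?normr0//.
by case/orP: h => h; rewrite (ltW h) ?orbT.
Qed.

Lemma mulb_sqint (G : R * R -> R) K f : measurable_fun setT G ->
  (forall p, `|G p| <= K) -> sqint M f -> sqint M (f * G).
Proof.
move=> mG GK hf.
have K0 : 0 <= K by exact: le_trans (GK (0, 0)).
apply: (@sqint_le _ _ _ M _ (K *: f)); last 2 first.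
- exact: sqintZ.
- move=> p; rewrite !fctE /GRing.scale /= !normrM (ger0_norm K0) mulrC.
  by rewrite ler_wpM2r.
by apply: measurable_funM => //; exact: sqint_meas hf.
Qed.

Lemma bounded_tens_sqint K L (u v : R -> R) :
  measurable_fun setT u -> measurable_fun setT v ->
  (forall x, a < x < b -> `|u x| <= K) -> (forall y, c < y < d -> `|v y| <= L) ->
  sqint M (tens u v).
Proof.
move=> mu mv uK vL; apply: (@bounded_sqint _ _ _ _ _ (K * L)).
  exact: tens_meas.
apply: filterS (rect_ae a b c d) => p [h1 h2].
by rewrite normrM; apply: ler_pM; rewrite ?uK ?vL.
Qed.

Lemma test_sqint phi psi : test1 a b phi -> test1 c d psi -> sqint M (tens phi psi).
Proof.
move=> tp ts.
have [K hK] := test_bounded ab tp; have [L hL] := test_bounded cd ts.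
apply: (@bounded_tens_sqint K L) => //; [exact: test_meas tp|exact: test_meas ts].
Qed.

Lemma weq_test f g : sqint M f -> sqint M g ->
  (forall phi psi, test1 a b phi -> test1 c d psi ->
    ip M f (tens phi psi) = ip M g (tens phi psi)) -> weq M f g.
Proof.
move=> hf hg fg; have hfg := sqintB hf hg.
(* The rectangle has finite measure: pairing with 1 makes f - g integrable, as [rect_uniq]
   requires. *)
have h1 : sqint M (cst 1).
  apply: (@bounded_sqint _ _ _ _ _ 1) => //.
  by apply: nearW => p; rewrite normr1.
apply: weq_ae => //.
have : \forall p \ae M, (f - g) p = 0.
  apply: rect_uniq.
    have := ip_integrable hfg h1; apply: eq_integrable => // p _ /=.
    by rewrite mulr1.
  move=> u v tu tv; have ht := test_sqint tu tv.
  by have /eqP := fg _ _ tu tv; rewrite -subr_eq0 -ipBl// => /eqP.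
by apply: filterS => p /eqP; rewrite !fctE subr_eq0 => /eqP.
Qed.

Lemma Av_tens (u v : R -> R) p : m.-integrable setT (EFin \o u) ->
  Av (tens u v) p = (\int[m]_s u s) * v p.2.
Proof.
move=> iu; rewrite /integral_slice /slab /tens /= -RintegralZr//.
by apply: eq_Rintegral => s _; rewrite mulr1.
Qed.

(** The integral of phi' from x to b is - phi(x), because phi vanishes at b. *)
Lemma Jt_tens_deriv phi (psi : R -> R) p : test1 a b phi -> a < p.1 < b ->
  Jt (tens (derive1 phi) psi) p = - (phi p.1 * psi p.2).
Proof.
move=> tp /andP[ap pb]; have td := test1_derive tp.
rewrite /integral_right /slab /tens /=.
have mdp := test_meas td.
transitivity (\int[leb]_(s in `[a, b]) (derive1 phi s * psi p.2 * (p.1 < s)%R%:R)).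
  rewrite seg_Rintegral//; apply: measurable_funM.
    exact: measurable_funM.
  exact: (measurable_kslice p.1 mkernel_gt).
have id x y : leb.-integrable `[x, y] (EFin \o (derive1 phi)).
  by apply: cont_integrable; exact: (td.1 0%N).1.
transitivity (\int[leb]_(s in `]p.1, b]) (derive1 phi s * psi p.2)).
  rewrite Rintegral_mkcond [RHS]Rintegral_mkcond; apply: eq_Rintegral => s _.
  rewrite !patchE !mem_setE !in_itv /=.
  case: (ltP p.1 s) => ps /=; rewrite ?mulr1 ?mulr0 ?if_same//.
  by rewrite (ltW (lt_trans ap ps)).
rewrite Rintegral_itv_obnd_cbnd; last first.
  have h : leb.-integrable `[p.1, b] (EFin \o (fun s => derive1 phi s * psi p.2)).
    apply: cont_integrable => s; apply: continuousM; last exact: cst_continuous.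
    exact: (td.1 0%N).1.
  by apply: integrableS h => //; apply: subset_itvr; rewrite bnd_simp.
rewrite RintegralZr// FTC_smooth//.
- rewrite (test1_bounds tp) ?lexx ?orbT// sub0r mulNr//.
- exact: tp.1.
- exact: ltW.
Qed.

End Kernels.

Section ContinuousMeasurable.
Context {R : realType}.
Local Notation Rm := (measurableTypeR R).

(* f is the pointwise limit of the functions f(floor(nx)/n, y), which are
   measurable because only countably many values of floor(nx) occur. *)
Lemma continuous2_measurable (f : R * R -> R) : continuous f ->
  measurable_fun (setT : set (Rm * Rm)) f.
Proof.
move=> cf.
pose gr k (x : R) : R := (Num.floor (k.+1%:R * x))%:~R / k.+1%:R.
pose h k (p : Rm * Rm) : R := f (gr k p.1, p.2).
apply: (@measurable_fun_cvg _ _ _ _ h).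
  move=> k _ B mB; rewrite setTI.
  pose E i : set (Rm * Rm) := if @unpickle int i is Some z then
    `[z%:~R / k.+1%:R, (z + 1)%:~R / k.+1%:R[ `*` (fun y => f (z%:~R / k.+1%:R, y)) @^-1` B
    else set0.
  have k0 : 0 < k.+1%:R :> R by rewrite ltr0n.
  have -> : h k @^-1` B = \bigcup_i E i.
    apply/seteqP; split => -[x y] /=.
      move=> hB; exists (pickle (Num.floor (k.+1%:R * x))); first exact: I.
      rewrite /E pickleK; split => //=; rewrite in_itv /=.
      rewrite ler_pdivrMr// ltr_pdivlMr// ![x * _]mulrC.
      by rewrite floor_le// floorD1_gt.
    move=> [i _]; rewrite /E; case: unpickle => [z|//] [/=].
    rewrite in_itv /= ler_pdivrMr// ltr_pdivlMr// ![x * _]mulrC => hz.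
    rewrite /h /gr /= (_ : Num.floor _ = z)//.
    exact: floor_def.
  apply: bigcupT_measurable => i; rewrite /E.
  case: unpickle => [z|]; last exact: measurable0.
  apply: measurableX; first exact: measurable_itv.
  have mz : measurable_fun (setT : set Rm) (fun y : R => f (z%:~R / k.+1%:R, y)).
    apply: continuous_measurable_fun => y.
    have hp : {for y, continuous (fun y : R => (z%:~R / k.+1%:R, y) : R * R)}.
      exact: (cvg_pair (cvg_cst (z%:~R / k.+1%:R : R)) (@cvg_id _ (nbhs y))).
    exact: continuous_comp hp (cf _).
  by rewrite -[X in measurable X]setTI; exact: mz.
move=> [x y] _; rewrite /h /=.
suff hg : gr k x @[k --> \oo] --> x.
  exact: cvg_comp (cvg_pair hg (cvg_cst y)) (cf (x, y)).
apply/cvgrPdist_lt => e e0; near=> k.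
have k0 : 0 < k.+1%:R :> R by rewrite ltr0n.
have h1 : gr k x <= x by rewrite /gr ler_pdivrMr// mulrC floor_le.
have h2 : x < gr k x + k.+1%:R^-1.
  rewrite /gr -[X in _ + X]mul1r -mulrDl ltr_pdivlMr// mulrC.
  by have := floorD1_gt (k.+1%:R * x); rewrite intrD.
rewrite ger0_norm ?subr_ge0// ltrBlDl; apply: lt_trans h2 _.
rewrite ltrD2l -[ltRHS]invrK ltf_pV2 ?posrE ?invr_gt0//.
near: k; exists (Num.trunc `|e^-1|).+1 => // n /= hn.
apply: le_lt_trans (ler_norm _) _.
apply: (@lt_trans _ _ n%:R); last by rewrite ltr_nat.
by apply: lt_le_trans (truncnS_gt _) _; rewrite ler_nat.
Unshelve. all: by end_near. Qed.

End ContinuousMeasurable.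

(** * Structure of functions with a weak x-derivative *)

Section Structure.
Context {R : realType}.
Local Notation Rm := (measurableTypeR R).
Local Notation leb := (@lebesgue_measure R).
Variables a b c d : R.
Hypotheses (ab : a < b) (cd : c < d).
Local Notation m := (seg a b).
Local Notation n := (seg c d).
Local Notation M := (rect a b c d).
Local Notation Jx := (integral_left a b).
Local Notation Jt := (integral_right a b).
Local Notation Av := (integral_slice a b).
Implicit Types (f g h w z u : R * R -> R) (phi psi : R -> R).

Lemma m_integrable (phi : R -> R) : test1 a b phi -> m.-integrable setT (EFin \o phi).
Proof.
move=> tp; have [K hK] := test_bounded ab tp.
apply: measurable_bounded_integrable => //.
- by rewrite -ge0_fin_numE// fin_num_measure.
- exact: test_meas tp.
- exists K; split; first by rewrite num_real.
  by move=> y Ky s _ /=; apply: le_trans (hK s) (ltW Ky).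
Qed.

Lemma test1Z (e : R) x y phi : test1 x y phi -> test1 x y (e *: phi).
Proof.
move=> [sp [pq [h1 h2 h3]]]; split; first by move=> k; exact: smooth1Z.
by exists pq; split=> // s /h3 ps; rewrite fctE ps scaler0.
Qed.

Lemma test1D x y phi psi : test1 x y phi -> test1 x y psi -> test1 x y (phi + psi).
Proof.
move=> [sp [[p q] /= [h1 h2 h3]]] [sp' [[p' q'] /= [h1' h2' h3']]].
split; first by move=> k; exact: smooth1D.
exists (Num.min p p', Num.max q q'); split => /=.
- by rewrite lt_min h1.
- by rewrite gt_max h2.
- move=> s hs; rewrite fctE h3 ?h3' ?addr0//.
    by apply: contra_not hs => /andP[hs1 hs2]; rewrite ge_min le_max hs1 hs2 !orbT.
  by apply: contra_not hs => /andP[hs1 hs2]; rewrite ge_min le_max hs1 hs2.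
Qed.

(** The integrals of the cutoffs tend to b - a > 0, so one of them is positive and can be
    normalized. *)
Lemma unit_test : exists2 eta, test1 a b eta & \int[m]_x eta x = 1.
Proof.
suff [k hk] : exists k, 0 < \int[m]_x cutoff a b k x.
  exists ((\int[m]_x cutoff a b k x)^-1 *: cutoff a b k).
    by apply: test1Z; exact: cutoff_test.
  rewrite RintegralZl//; last by apply: m_integrable; exact: cutoff_test.
  by rewrite mulVf// gt_eqF.
have [] := @dominated_convergence _ _ _ m setT measurableT
  (fun k x => (cutoff a b k x)%:E) (fun x => (\1_(`]a, b[%classic) x)%:E) (cst 1%E).
- by move=> k; apply/measurable_EFinP; exact: test_meas (cutoff_test a b k).
- by apply/measurable_EFinP; apply: measurable_indic; exact: measurable_itv.
- by apply: aeW => x _; apply: cvg_EFin; [exact: nearW|exact: cutoff_cvg].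
- exact: finite_measure_integrable_cst.
- by apply: aeW => x k _; rewrite /= lee_fin; exact: cutoff_bound.
move=> _ _; rewrite (integral_indic m measurableT) ?setIT; last exact: measurable_itv.
rewrite [X in _ --> X](_ : _ = (b - a)%:E); last first.
  by apply: eq_trans (segE _ _ _) _; rewrite setIid lebesgue_measure_itv/= lte_fin ab.
move=> /fine_cvg /= /cvgr_gt /(_ 0); rewrite subr_gt0 => /(_ ab) [k _ /(_ k (leqnn k)) hk].
by exists k.
Qed.

(** Du Bois-Reymond's argument: u - Jx w has weak x-derivative 0 and is therefore a function of y
    alone. *)
Lemma wderx_structure u w : sqint M u -> sqint M w -> wderx a b c d u w ->
  exists e, [/\ sqint M e, xind e & weq M u (e + Jx w)].
Proof.
move=> hu hw uw; have hJ := Jx_sqint ab hw; have hr := sqintB hu hJ.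
set r := u - Jx w in hr.
have r0 phi psi : test1 a b phi -> test1 c d psi ->
    ip M r (tens (derive1 phi) psi) = 0.
  move=> tp ts; have td := test1_derive tp.
  have hd := test_sqint ab cd td ts; have ht := test_sqint ab cd tp ts.
  rewrite ipBl// uw// Jx_adj//.
  have hJt := Jt_sqint ab hd; have hNt := sqintN ht.
  have -> : ip M w (Jt (tens (derive1 phi) psi)) = ip M w (- tens phi psi).
    rewrite (ipC M w) (ipC M w); apply: ip_ae => //.
    by apply: filterS (rect_ae a b c d) => p [hp _]; rewrite Jt_tens_deriv.
  by rewrite ipNr// subrr.
have [eta te e1] := unit_test.
have mi phi : test1 a b phi -> \int[m]_x phi x = \int[leb]_(x in `[a, b]) phi x.
  by move=> tp; apply: seg_Rintegral; exact: test_meas tp.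
(* Subtracting from phi its integral times [eta] leaves mean zero, hence the derivative of a test
   function, which r annihilates: r only sees the integral of phi. *)
have r1 phi psi : test1 a b phi -> test1 c d psi ->
    ip M r (tens phi psi) = (\int[m]_x phi x) * ip M r (tens eta psi).
  move=> tp ts; set I := \int[m]_x phi x.
  have tpe : test1 a b (phi + (- I) *: eta) by apply: test1D => //; exact: test1Z.
  have [|F tF F'] := test1_primitive ab tpe.
    rewrite -mi// RintegralD//; try exact: m_integrable; last first.
      by apply: m_integrable; exact: test1Z.
    by rewrite RintegralZl ?e1 ?mulr1 ?subrr//; exact: m_integrable.
  have := r0 _ _ tF ts; rewrite F'.
  rewrite (_ : tens _ psi = tens phi psi + (- I) *: tens eta psi); last first.
    by apply/funext => p; rewrite /tens !fctE mulrDl /GRing.scale/= mulrA.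
  have hpp := test_sqint ab cd tp ts; have hep := test_sqint ab cd te ts.
  rewrite (ipDr hpp (sqintZ _ hep) hr) ipZr//.
  by move=> /eqP; rewrite mulNr subr_eq0 => /eqP.
have [K hK] := test_bounded ab te.
have me := test_meas te.
(* The function of y alone that r must be is its slice mean with weight [eta]. *)
pose G := tens eta (cst 1).
have hrG : sqint M (r * G).
  apply: (@mulb_sqint _ _ _ _ _ _ K) => //; first exact: tens_meas.
  by move=> p; rewrite /G /tens mulr1.
exists (Av (r * G)); split; first exact: Av_sqint.
  exact: Av_xind.
have hA := Av_sqint ab hrG.
have rA : weq M r (Av (r * G)).
  apply: weq_test => // phi psi tp ts.
  have ht := test_sqint ab cd tp ts; have hte := test_sqint ab cd te ts.
  rewrite r1// Av_adj//.
  have -> : Av (tens phi psi) = (\int[m]_x phi x) *: tens (cst 1) psi.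
    apply/funext => p; rewrite Av_tens; last exact: m_integrable.
    by rewrite fctE /GRing.scale/= /tens mul1r.
  have [L hL] := test_bounded cd ts.
  have h1 : sqint M (tens (cst 1) psi).
    apply: (@bounded_tens_sqint _ _ _ _ _ 1 L) => //; first exact: test_meas ts.
    by move=> x _; rewrite normr1.
  rewrite ipZr//; congr (_ * _); apply: eq_Rintegral => p _.
  by rewrite /G /tens !fctE mulr1 mul1r mulrA.
move=> h hh; rewrite ipDl// -rA// -ipDl//; congr (ip _ _ _).
by rewrite /r subrK.
Qed.

(* u vanishes on both edges x = a and x = b, and w is its x-derivative: u is the
   primitive of w from the edge x = a, and the integral of w over every slice
   is 0. *)
Definition zerox u w : Prop := weq M u (Jx w) /\ weq M (Av w) 0.

(** In [ibp] both traces of u are 0, so the edge terms disappear whatever the traces of f are. *)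
Lemma zerox_ibp u w f g : sqint M u -> sqint M w -> sqint M f -> sqint M g ->
  zerox u w -> wderx a b c d f g -> ip M u g = - ip M w f.
Proof.
move=> hu hw hf hg [uw w0] fg.
have [e [he xe fe]] := wderx_structure hf hg fg.
have hAw := Av_sqint ab hw; have hAg := Av_sqint ab hg.
have h0 := @sqint0 _ _ _ M.
have x0 : xind (0 : R * R -> R) by [].
have u0 : weq M u (0 + Jx w) by rewrite add0r.
have z0 h : sqint M h -> ip M 0 h = 0.
  by move=> hh; rewrite -(scale0r u) ipZl ?mul0r.
have := ibp ab hw hg h0 he hu hf x0 xe u0 fe.
rewrite add0r (w0 _ (sqintD he hAg)) !z0//; last exact: sqintD.
by rewrite subrr mulr0 => /eqP; rewrite addr_eq0 => /eqP.
Qed.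

Lemma Jx_bound w : sqint M w -> ip M (Jx w) (Jx w) <= (b - a) ^+ 2 * ip M w w.
Proof. by move=> hw; have [] := slab_sqint ab mkernel_lt hw. Qed.

Lemma Jt_bound w : sqint M w -> ip M (Jt w) (Jt w) <= (b - a) ^+ 2 * ip M w w.
Proof. by move=> hw; have [] := slab_sqint ab mkernel_gt hw. Qed.

Lemma zerox_poincare u w : sqint M u -> sqint M w -> zerox u w ->
  ip M u u <= (b - a) ^+ 2 * ip M w w.
Proof.
move=> hu hw [uw _]; have hJ := Jx_sqint ab hw.
by rewrite (weq_ip hu hJ uw uw) Jx_bound.
Qed.

Definition wdery_x u w : Prop := forall (G : R -> R) psi K,
  measurable_fun setT G -> (forall x, a < x < b -> `|G x| <= K) ->
  test1 c d psi -> ip M u (tens G (derive1 psi)) = - ip M w (tens G psi).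

Lemma test_sqint1 phi : test1 a b phi -> sqint m phi.
Proof.
move=> tp; have mp := test_meas tp; split=> //.
have [K hK] := test_bounded ab tp.
apply: measurable_bounded_integrable => //.
- by rewrite -ge0_fin_numE// fin_num_measure.
- exact: measurable_funX.
- exists (K ^+ 2); split; first by rewrite num_real.
  move=> y0 Ky s _ /=; apply: le_trans (ltW Ky); rewrite normrX.
  by rewrite lerXn2r ?nnegrE ?(le_trans _ (hK s)).
Qed.

(* The tests allowed in [wdery_x] need not vanish near x = a and x = b: they
   include the primitives of test functions of x. *)
Lemma zerox_yder u w p q : wdery_x u p -> wdery_x w q ->
  sqint M u -> sqint M w -> sqint M p -> sqint M q ->
  zerox u w -> zerox p q.
Proof.
move=> up wq hu hw hp hq [uw w0].
have hJw := Jx_sqint ab hw; have hJq := Jx_sqint ab hq; have hAq := Av_sqint ab hq.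
have hAw := Av_sqint ab hw.
have z0 h : sqint M h -> ip M 0 h = 0.
  by move=> hh; rewrite -(scale0r u) ipZl ?mul0r.
split.
  apply: weq_test => // phi psi tp ts.
  have ht := test_sqint ab cd tp ts.
  have td := test1_derive ts; have htd := test_sqint ab cd tp td.
  have [K hK] := test_bounded ab tp.
  have mp := test_meas tp.
  pose G x := \int[m]_s (phi s * (x < s)%R%:R).
  have ik x : m.-integrable setT (EFin \o (fun s => phi s * (x < s)%R%:R)).
    apply: ip_integrable; first exact: test_sqint1.
    exact: (kappa_sqint a b x mkernel_gt).
  have GE (v : R -> R) : Jt (tens phi v) = tens G v.
    apply/funext => -[x y]; rewrite /integral_right /slab /tens /= /G -RintegralZr//.
    by apply: eq_Rintegral => s _; rewrite mulrAC.
  have mG : measurable_fun setT G.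
    have -> : G = (fun x => Jt (tens phi (cst 1)) (x, 0)).
      by apply/funext => x; rewrite GE /tens mulr1.
    apply: measurable_slice; apply: measurable_slab; first exact: mkernel_gt.
    exact: tens_meas.
  have GK x : a < x < b -> `|G x| <= \int[m]_s `|phi s|.
    move=> _; apply: (le_trans (le_normr_Rintegral measurableT (ik x))).
    apply: le_Rintegral => //.
    - exact: integrable_norm (ik x).
    - exact: integrable_norm (m_integrable tp).
    - by move=> s _; rewrite normrM; case: (x < s); rewrite ?normr1 ?normr0 ?mulr1 ?mulr0.
  rewrite Jx_adj// GE -[LHS]opprK -(up _ _ K)//; last first.
  rewrite uw// Jx_adj// GE (wq _ _ (\int[m]_s `|phi s|))// opprK//.
apply: weq_test => //; first exact: sqint0.
move=> phi psi tp ts.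
have ht := test_sqint ab cd tp ts.
have td := test1_derive ts; have htd := test_sqint ab cd tp td.
rewrite z0// Av_adj//.
have AE (v : R -> R) : Av (tens phi v) = tens (cst (\int[m]_s phi s)) v.
  by apply/funext => x; rewrite Av_tens//; exact: m_integrable.
rewrite AE -[LHS]opprK -(wq _ _ `|\int[m]_s phi s|)// -AE -Av_adj// w0// z0// oppr0//.
Qed.

End Structure.

(** * Traces and Ehrling's inequality *)

Section Traces.
Context {R : realType}.
Local Notation Rm := (measurableTypeR R).
Local Notation leb := (@lebesgue_measure R).
Variables a b c d : R.
Hypotheses (ab : a < b) (cd : c < d).
Local Notation m := (seg a b).
Local Notation n := (seg c d).
Local Notation M := (rect a b c d).
Local Notation Jx := (integral_left a b).
Local Notation Jt := (integral_right a b).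
Local Notation Av := (integral_slice a b).
Implicit Types (f g h w z u : R * R -> R) (phi psi : R -> R).

Lemma seg_Rintegral_lt phi x : continuous phi -> a < x <= b ->
  \int[m]_s (phi s * (s < x)%R%:R) = \int[leb]_(s in `[a, x]) phi s.
Proof.
move=> cp /andP[ax xb].
rewrite seg_Rintegral; last first.
  apply: measurable_funM; first exact: continuous_measurable_fun.
  exact: (measurable_kslice x mkernel_lt).
rewrite -[RHS]Rintegral_itv_bndo_bndc; last first.
  have h := cont_integrable a x cp.
  by apply: integrableS h => //; apply: subset_itvl; rewrite bnd_simp.
rewrite Rintegral_mkcond [RHS]Rintegral_mkcond; apply: eq_Rintegral => s _.
rewrite !patchE !mem_setE !in_itv /=.
case: (boolP (s < x)) => sx; rewrite ?andbT ?andbF ?mulr1 ?mulr0 ?if_same//.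
by rewrite (le_trans (ltW sx) xb) andbT.
Qed.

Lemma slice_ftc f f' y :
  (forall s : R, is_derive s (1 : R) (fun s => f (s, y)) (f' (s, y))) ->
  continuous (fun s => f' (s, y)) ->
  (forall x, a < x < b -> Jx f' (x, y) = f (x, y) - f (a, y)) /\
  (forall x, Av f' (x, y) = f (b, y) - f (a, y)).
Proof.
move=> df cf; have s1 : smooth1 1 (fun s => f (s, y)).
  by apply: smooth1_is_derive df _.
have dE : derive1 (fun s => f (s, y)) = (fun s => f' (s, y)).
  by apply/funext => s; rewrite derive1E; have [] := df s.
split=> x.
  move=> /andP[ax xb]; rewrite /integral_left /slab /=.
  rewrite (seg_Rintegral_lt cf) ?ax ?(ltW xb)//.
  by rewrite -dE FTC_smooth// ltW.
rewrite /integral_slice /slab /=.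
transitivity (\int[leb]_(s in `[a, b]) f' (s, y)).
  rewrite -seg_Rintegral; last exact: continuous_measurable_fun.
  by apply: eq_Rintegral => s _; rewrite mulr1.
by rewrite -dE FTC_smooth// ltW.
Qed.

(** A trace depends continuously on the function and its x-derivative: subtracting the two
    representations expresses e - F through f - w0 and f' - w1. The edge x = a is the case t = 1, K
    = [Jx]; the edge x = b is t = -1, K = [Jt]. *)
Lemma trace_bound (K : (R * R -> R) -> (R * R -> R)) (t : R) w0 w1 e f f' F :
  t ^+ 2 = 1 ->
  (forall w, sqint M w -> sqint M (K w)) ->
  (forall w, sqint M w -> ip M (K w) (K w) <= (b - a) ^+ 2 * ip M w w) ->
  (forall v w, sqint M v -> sqint M w -> weq M (K (v + w)) (K v + K w)) ->
  sqint M w0 -> sqint M w1 -> sqint M e -> sqint M f -> sqint M f' -> sqint M F ->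
  weq M w0 (e + t *: K w1) -> weq M f (F + t *: K f') ->
  ip M e e <= 2 * ip M F F +
    4 * (ip M (f - w0) (f - w0) + (b - a) ^+ 2 * ip M (f' - w1) (f' - w1)).
Proof.
move=> t1 sK bK DK h0 h1 he hf hf' hF w0E fE.
have hJ1 := sK _ h1; have hJf := sK _ hf'.
have hd := sqintB hf h0; have hd' := sqintB hf' h1.
have hJd := sK _ hd'; have htJd := sqintZ t hJd.
have E : weq M (e - F) (t *: K (f' - w1) - (f - w0)).
  move=> h hh; rewrite !ipBl// fE// w0E// !ipDl//; try exact: sqintZ.
  rewrite !ipZl//.
  have := DK _ _ hd' h1 h hh; rewrite subrK ipDl// => ->.
  ring.
have := ip_tri hF (sqintB he hF).
rewrite (addrC F) subrK => le1; apply: (le_trans le1).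
rewrite (weq_ip (sqintB he hF) (sqintB htJd hd) E E).
have := ip_tri htJd (sqintN hd).
have := bK _ hd'.
rewrite ipNl ?ipNr//; last exact: sqintN.
rewrite ipZl// ipZr// mulrA -expr2 t1 opprK; lra.
Qed.

(* [kappa] is s < x or x < s, [chi] the indicator of a strip of width h next to
   the edge on which the trace e is taken. *)
Lemma strip_trace kappa (chi : R -> bool) (t h : R) u w e :
  mkernel kappa -> measurable_fun setT (fun x => (chi x)%:R : R) ->
  t ^+ 2 = 1 -> 0 <= h -> \int[m]_x (chi x)%:R = h ->
  (forall x, a < x < b -> chi x -> \int[m]_s (kappa s x)%:R <= h) ->
  sqint M u -> sqint M w -> sqint M e -> xind e ->
  weq M u (e + t *: slab a b kappa w) ->
  h * ip M e e <= (b - a) * (2 * ip M u u + 2 * h ^+ 2 * ip M w w).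
Proof.
move=> mk mchi t1 h0 chih kh hu hw he xe uE.
have ba0 : 0 < b - a by rewrite subr_gt0.
have [hs _] := slab_sqint ab mk hw.
pose X : R * R -> R := fun p => (chi p.1)%:R.
have mX : measurable_fun setT X by exact: measurableT_comp mchi measurable_fst.
have X1 p : `|X p| <= 1 by rewrite normr_nat /X; case: (chi _).
have XX p : X p * X p = X p by rewrite /X; case: (chi _); rewrite ?mulr1 ?mulr0.
have cut f : sqint M f -> sqint M (f * X) by exact: mulb_sqint mX X1.
have cutip f g : ip M (f * X) g = ip M f (g * X).
  by apply: eq_Rintegral => p _; rewrite !fctE mulrAC mulrA.
have cutle f : sqint M f -> ip M (f * X) (f * X) <= ip M f f.
  move=> hf; apply: le_Rintegral => //.
  - exact: (ip_integrable (cut _ hf) (cut _ hf)).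
  - exact: (ip_integrable hf hf).
  - move=> p _; rewrite !fctE mulrACA XX -expr2 /X.
    by case: (chi _); rewrite ?mulr1 ?mulr0 ?sqr_ge0.
(* As e does not depend on x, the strip carries the fraction h/(b - a) of its squared norm. *)
have eX : ip M (e * X) (e * X) = (b - a)^-1 * h * ip M e e.
  rewrite cutip (_ : e * X * X = e * X); last first.
    by apply/funext => p; rewrite !fctE -mulrA XX.
  rewrite (ip_xind ab xe he (cut _ he)).
  rewrite (_ : Av (e * X) = h *: e) ?ipZr// ?mulrA//.
  apply/funext => -[x y]; rewrite /integral_slice /slab /= fctE /GRing.scale/= -chih.
  rewrite [RHS]mulrC -RintegralZl//.
    apply: eq_Rintegral => s _. by rewrite mulr1 (xe s x).
  apply: measurable_bounded_integrable => //.
    by rewrite -ge0_fin_numE// fin_num_measure.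
  exists 1; split=> // y0 y1 s _ /=.
  by rewrite normr_nat; apply: le_trans (ltW y1); case: (chi s).
have uX : weq M (e * X) (u * X + (- t) *: (slab a b kappa w * X)).
  have cu := cut _ hu; have cs := cut _ hs.
  move=> g hg; have cg := cut _ hg.
  rewrite ipDl//; last exact: sqintZ.
  rewrite ipZl// !cutip uE// ipDl ?ipZl//; last exact: sqintZ.
  ring.
have cu := cut _ hu; have cs := cut _ hs; have ce := cut _ he.
have czs := sqintZ (- t) cs.
have := ip_tri cu czs.
rewrite -(weq_ip ce (sqintD cu czs) uX uX) eX ipZl// ipZr// mulrA -expr2 sqrrN t1 mul1r.
(* One factor h comes from the length of integration in Cauchy-Schwarz, the other from the width of
   the strip. *)
have Js : ip M (slab a b kappa w * X) (slab a b kappa w * X) <= h ^+ 2 * ip M w w.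
  have := @slab_sqint_bound R a b c d kappa w (fun x => (chi x)%:R) (fun x => h * (chi x)%:R) mk hw mchi.
  have ic : m.-integrable setT (EFin \o (fun x => (chi x)%:R)).
    apply: measurable_bounded_integrable => //.
      by rewrite -ge0_fin_numE// fin_num_measure.
    exists 1; split=> // y0 y1 s _ /=.
    by rewrite normr_nat; apply: le_trans (ltW y1); case: (chi s).
  case=> //.
  - have := integrableZl measurableT h ic; exact: eq_integrable.
  - by move=> x; rewrite mulr_ge0.
  - move=> x hx; case: (boolP (chi x)) => cx; last by rewrite expr0n mul0r mulr0.
    by rewrite expr1n mul1r mulr1 kh.
  rewrite RintegralZl// chih -expr2 => _.
  rewrite (_ : (fun p => _) = slab a b kappa w * X)//.
  by apply/funext => p; rewrite fctE mulrC.
have := cutle _ hu.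
move=> h1 h2.
rewrite -ler_pdivrMl// mulrA; move: h2 Js h1; lra.
Qed.

Lemma slab_Jt w : slab a b (fun s x : R => x < s) w = Jt w.
Proof. by []. Qed.

#[local] Opaque ip sqint integral_left integral_right integral_slice.

Lemma strip_l u w e (h : R) : 0 < h <= b - a ->
  sqint M u -> sqint M w -> sqint M e -> xind e -> weq M u (e + Jx w) ->
  h * ip M e e <= (b - a) * (2 * ip M u u + 2 * h ^+ 2 * ip M w w).
Proof.
move=> /andP[h0 hba] hu hw he xe uE.
have lt1 x : a < x <= b -> \int[m]_s (s < x)%R%:R = x - a.
  move=> hx; have := seg_Rintegral_lt (@cst_continuous R R 1) hx.
  under eq_Rintegral do rewrite mul1r.
  have E : leb `[a, x]%classic = (x - a)%:E.
    by rewrite lebesgue_measure_itv/= lte_fin; case/andP: hx => ->.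
  by move=> ->; rewrite Rintegral_cst// mul1r; exact: (congr1 fine E).
apply: (@strip_trace (fun s x => s < x) (fun x => x < a + h) 1) => //.
- exact: mkernel_lt.
- exact: (measurable_kslice (a + h) mkernel_lt).
- by rewrite expr1n.
- exact: ltW.
- rewrite lt1 ?(addrC a) ?addrK//; move: h0 hba; lra.
- move=> x /andP[ax xb] xh; rewrite lt1 ?ax ?(ltW xb)//; move: xh; lra.
- by rewrite scale1r.
Qed.

(** Since Jx + Jt = Av, the representation seen from x = b reads u = (e + Av w) - Jt w; hence t = -1
    in [strip_trace]. *)
Lemma strip_r u w e (h : R) : 0 < h <= b - a ->
  sqint M u -> sqint M w -> sqint M e -> xind e -> weq M u (e + Jx w) ->
  h * ip M (e + Av w) (e + Av w) <=
  (b - a) * (2 * ip M u u + 2 * h ^+ 2 * ip M w w).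
Proof.
move=> /andP[h0 hba] hu hw he xe uE.
have hA := Av_sqint ab hw; have hJ := Jx_sqint ab hw; have hJt := Jt_sqint ab hw.
have gt1 x : a <= x < b -> \int[m]_s (x < s)%R%:R = b - x.
  move=> /andP[ax xb]; rewrite seg_Rintegral; last exact: (measurable_kslice x mkernel_gt).
  transitivity (\int[leb]_(s in `]x, b]) (1 : R)).
    rewrite Rintegral_mkcond [RHS]Rintegral_mkcond; apply: eq_Rintegral => s _.
    rewrite !patchE !mem_setE !in_itv /=.
    case: (boolP (x < s)) => xs /=; last by rewrite if_same.
    by rewrite (le_trans ax (ltW xs)).
  have E : leb `]x, b]%classic = (b - x)%:E.
    by rewrite lebesgue_measure_itv/= lte_fin xb.
  by rewrite Rintegral_cst// mul1r; exact: (congr1 fine E).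
apply: (@strip_trace (fun s x => x < s) (fun x => b - h < x) (-1)) => //.
- exact: mkernel_gt.
- exact: (measurable_kslice (b - h) mkernel_gt).
- by rewrite sqrrN expr1n.
- exact: ltW.
- rewrite gt1; move: h0 hba; lra.
- move=> x /andP[ax xb] xh; rewrite gt1 ?xb ?(ltW ax)//; move: xh; lra.
- exact: sqintD.
- by move=> x x' y; rewrite !fctE (xe x x'); congr (_ + _); exact: Av_xind.
- move=> g hg; rewrite uE// scaleN1r ipBl ?ipDl//; last exact: sqintD.
  have := Jx_Jt ab hw hg; rewrite (ipDl hJ hJt hg) => <-; rewrite slab_Jt.
  by rewrite addrA addrK.
Qed.

End Traces.

(** * Ehrling's inequality *)

Section Ehrling.
Context {R : realType}.
Local Notation Rm := (measurableTypeR R).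
Local Notation leb := (@lebesgue_measure R).
Variables a b c d : R.
Hypotheses (ab : a < b) (cd : c < d).
Local Notation m := (seg a b).
Local Notation n := (seg c d).
Local Notation M := (rect a b c d).
Local Notation Jx := (integral_left a b).
Local Notation Jt := (integral_right a b).
Local Notation Av := (integral_slice a b).
Implicit Types (f g h w z u : R * R -> R) (phi psi : R -> R).

(** By parts, |w1|^2 is -(w0, w2) plus edge products of traces of w0 and w1. Young's inequality with
    a large weight s on w0 makes the traces of w1 cheap, and those of w0 are estimated on strips
    thin enough to cost little |w1|^2. *)
Lemma ehrling eta : 0 < eta -> exists C, forall w0 w1 w2,
  sqint M w0 -> sqint M w1 -> sqint M w2 ->
  wderx a b c d w0 w1 -> wderx a b c d w1 w2 ->
  ip M w1 w1 <= eta * ip M w2 w2 + C * ip M w0 w0.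
Proof.
move=> eta0.
have L0 : 0 < b - a by rewrite subr_gt0.
(* The two summands give s L >= 8 and eta s >= 8 L. With them a squared trace of w1, estimated over
   the full width L and divided by s, is at most L (|w1|^2 / 4 + eta |w2|^2 / 4). *)
pose L := b - a; pose s := 8 / L + 8 * L / eta.
have Lp : 0 < L by [].
have s0 : 0 < s by rewrite addr_gt0// divr_gt0// mulr_gt0.
have sL : 8 <= L * s.
  rewrite /s mulrDr mulrCA mulfV ?gt_eqF// mulr1 lerDl.
  by rewrite mulr_ge0 ?ltW// divr_gt0// mulr_gt0.
have sE : 8 * L <= eta * s.
  have -> : eta * s = eta * (8 / L) + 8 * L by rewrite /s; field; rewrite !gt_eqF.
  by rewrite lerDr mulr_ge0 ?ltW// divr_gt0.
(* This width makes the coefficient of |w1|^2 in s times a squared trace of w0 equal to 2 s h L =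
   L/4. *)
pose h := (8 * s)^-1.
have h0 : 0 < h by rewrite invr_gt0 mulr_gt0.
have hs : h * (8 * s) = 1 by rewrite mulVf// gt_eqF// mulr_gt0.
have hL : 0 < h <= b - a.
  rewrite h0 /= -/L /h -div1r ler_pdivrMr ?mulr_gt0//; move: sL; nra.
have LL : 0 < L <= b - a by rewrite Lp lexx.
(* The edge terms contribute 16 s^2 and the pairing (w0, w2) contributes 1/eta; both double when
   half of |w1|^2 is absorbed on the left. *)
exists (2 / eta + 32 * s ^+ 2) => w0 w1 w2 k0 k1 k2 d01 d12.
have [e [he xe w0E]] := wderx_structure ab cd k0 k1 d01.
have [f [hf xf w1E]] := wderx_structure ab cd k1 k2 d12.
have hA1 := Av_sqint ab k1; have hA2 := Av_sqint ab k2.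
have he1 := sqintD he hA1; have hf1 := sqintD hf hA2.
have := ibp ab k1 k2 he hf k0 k1 xe xf w0E w1E.
have t0 : 0 < 2 / eta by rewrite divr_gt0.
have := ip_young t0 k0 k2; have := ip_young s0 he hf; have := ip_young s0 he1 hf1.
have := strip_l ab hL k0 k1 he xe w0E; have := strip_r ab hL k0 k1 he xe w0E.
have := strip_l ab LL k1 k2 hf xf w1E; have := strip_r ab LL k1 k2 hf xf w1E.
rewrite -/L.
have U0 := ip_ge0 M w0; have W0 := ip_ge0 M w1; have Z0 := ip_ge0 M w2.
move: (ip M w0 w0) (ip M w1 w1) (ip M w2 w2) (ip M w0 w2) U0 W0 Z0 => U W Z Q U0 W0 Z0.
move: (ip M e e) (ip M f f) (ip M e f) (ip M (e + Av w1) (e + Av w1))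
  (ip M (f + Av w2) (f + Av w2)) (ip M (e + Av w1) (f + Av w2)).
move=> ee ff ef ee1 ff1 ef1 f1b fb e1b eb y1 y2 y3 id.
have {}f1b : ff1 <= 2 * W + 2 * L ^+ 2 * Z by rewrite -(ler_pM2l Lp).
have {}fb : ff <= 2 * W + 2 * L ^+ 2 * Z by rewrite -(ler_pM2l Lp).
have eE x : h * x <= L * (2 * U + 2 * h ^+ 2 * W) ->
    s * x <= L * (16 * s ^+ 2 * U + W / 4).
  move=> hx; have : 8 * s ^+ 2 * (h * x) <= 8 * s ^+ 2 * (L * (2 * U + 2 * h ^+ 2 * W)).
    by rewrite ler_pM2l// mulr_gt0// exprn_gt0.
  have -> : 8 * s ^+ 2 * (h * x) = (h * (8 * s)) * s * x by ring.
  have -> : 8 * s ^+ 2 * (L * (2 * U + 2 * h ^+ 2 * W)) =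
    L * (16 * s ^+ 2 * U + (h * (8 * s)) ^+ 2 * W / 4) by field.
  by rewrite hs expr1n !mul1r.
have {}eb := eE _ eb; have {}e1b := eE _ e1b.
have fE x : x <= 2 * W + 2 * L ^+ 2 * Z -> x / s <= L * (W / 4 + eta / 4 * Z).
  move=> hx; rewrite ler_pdivrMr//; apply: (le_trans hx).
  have -> : L * (W / 4 + eta / 4 * Z) * s = (L * s) * W / 4 + L * (eta * s) * Z / 4 by field.
  have h1 : 8 * W <= L * s * W by rewrite ler_wpM2r.
  have h2 : L * (8 * L) * Z <= L * (eta * s) * Z by rewrite ler_wpM2r// ler_pM2l.
  move: h1 h2; rewrite expr2; lra.
have {}fb := fE _ fb; have {}f1b := fE _ f1b.
have young (x y z : R) : `|z| <= s / 2 * x + y / (2 * s) -> s * x <= L * (16 * s ^+ 2 * U + W / 4) ->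
    y / s <= L * (W / 4 + eta / 4 * Z) ->
    `|z| <= L * ((16 * s ^+ 2 * U + W / 4) + (W / 4 + eta / 4 * Z)) / 2.
  have -> : s / 2 * x + y / (2 * s) = (s * x + y / s) / 2 by field; rewrite gt_eqF.
  lra.
have {}y1 := young _ _ _ y1 e1b f1b; have {}y2 := young _ _ _ y2 eb fb.
have : L^-1 * (ef1 - ef) <= (16 * s ^+ 2 * U + W / 4) + (W / 4 + eta / 4 * Z).
  rewrite ler_pdivrMl//; have := ler_norm ef1; have := ler_norm (- ef).
  rewrite normrN; move: y1 y2; lra.
rewrite -id; have := ler_norm (- Q); rewrite normrN.
move: y3; have -> : 2 / eta / 2 * U + Z / (2 * (2 / eta)) = U / eta + eta * Z / 4.
  by field; rewrite gt_eqF.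
have -> : (2 / eta + 32 * s ^+ 2) * U = 2 * (U / eta) + 32 * s ^+ 2 * U by field; rewrite gt_eqF.
set V := U / eta; lra.
Qed.

End Ehrling.

(** * Zero traces *)

Section ZeroTrace.
Context {R : realType}.
Local Notation Rm := (measurableTypeR R).
Local Notation leb := (@lebesgue_measure R).
Variables a b c d : R.
Hypotheses (ab : a < b) (cd : c < d).
Local Notation m := (seg a b).
Local Notation n := (seg c d).
Local Notation M := (rect a b c d).
Local Notation Jx := (integral_left a b).
Local Notation Jt := (integral_right a b).
Local Notation Av := (integral_slice a b).
Implicit Types (f g h w z u : R * R -> R) (phi psi : R -> R).

Lemma continuous_sqint f : continuous f -> sqint M f.
Proof.
move=> cf; have cK : compact (`[a, b] `*` `[c, d]).
  by apply: compact_setX; exact: segment_compact.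
have := continuous_compact (continuous_subspaceT cf) cK.
move=> /compact_bounded [K [_ hK]].
apply: (@bounded_sqint _ _ _ _ _ (K + 1)); first exact: continuous2_measurable.
apply: filterS (rect_ae a b c d) => -[x y] /= [/andP[ax xb] /andP[cy yd]].
apply: hK; first by rewrite ltrDl.
by exists (x, y) => //; split; rewrite /= in_itv /= ?(ltW ax) ?(ltW xb) ?(ltW cy) ?(ltW yd).
Qed.

Definition C1x f f' : Prop :=
  [/\ continuous f, continuous f' &
    forall x y : R, is_derive x (1 : R) (fun s => f (s, y)) (f' (x, y))].

Lemma slice_cont f y : continuous f -> continuous (fun s => f (s, y)).
Proof.
move=> cf s.
have hp : {for s, continuous (fun s : R => (s, y) : R * R)}.
  exact: (cvg_pair (@cvg_id _ (nbhs s)) (cvg_cst (y : R))).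
exact: continuous_comp hp (cf _).
Qed.

Lemma slice_cont2 f x : continuous f -> continuous (fun s => f (x, s)).
Proof.
move=> cf s.
have hp : {for s, continuous (fun s : R => (x, s) : R * R)}.
  exact: (cvg_pair (cvg_cst (x : R)) (@cvg_id _ (nbhs s))).
exact: continuous_comp hp (cf _).
Qed.

Lemma edge_cont f x : continuous f -> continuous (fun p : R * R => f (x, p.2)).
Proof.
move=> cf p; apply: (@continuous_comp _ _ _ snd (fun s => f (x, s)) p).
  exact: cvg_snd.
exact: slice_cont2.
Qed.

Lemma C1x_repr f f' : C1x f f' ->
  weq M f ((fun p => f (a, p.2)) + Jx f') /\
  weq M (fun p => f (b, p.2)) ((fun p => f (a, p.2)) + Av f').
Proof.
move=> [cf cf' df]; have hf := continuous_sqint cf; have hf' := continuous_sqint cf'.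
have hF := continuous_sqint (edge_cont (x:=a) cf); have hF' := continuous_sqint (edge_cont (x:=b) cf).
have hJ := Jx_sqint ab hf'; have hA := Av_sqint ab hf'.
split; apply: weq_ae => //; try exact: sqintD.
  apply: filterS (rect_ae a b c d) => -[x y] /= [hx _].
  have [H _] := slice_ftc ab (fun s => df s y) (slice_cont (y:=y) cf').
  by rewrite fctE /= H// addrC subrK.
apply: nearW => -[x y].
have [_ H] := slice_ftc ab (fun s => df s y) (slice_cont (y:=y) cf').
by rewrite fctE /= H addrC subrK.
Qed.

Lemma ip_edge (phi : R -> R) : measurable_fun setT phi ->
  n.-integrable setT (EFin \o (fun y => phi y ^+ 2)) ->
  ip M (fun p => phi p.2) (fun p => phi p.2) = (b - a) * \int[n]_y (phi y ^+ 2).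
Proof.
move=> mphi iphi; rewrite /ip /Rintegral.
rewrite (@fubini_tonelli1 _ _ Rm Rm R m n (fun p => (phi p.2 * phi p.2)%:E)).
- rewrite /fubini_F /=.
  under eq_integral do under eq_integral do rewrite -expr2.
  rewrite -(fineK (integrable_fin_num measurableT iphi)) integral_cst//=.
  transitivity (fine ((fine (\int[n]_y (phi y ^+ 2)%:E))%:E * (b - a)%:E)%E).
    by congr (fine (_ * _)%E); exact: seg_setT.
  by rewrite /= mulrC.
- apply/measurable_EFinP; apply: measurable_funM; exact: measurableT_comp mphi measurable_snd.
- by move=> p; rewrite lee_fin -expr2 sqr_ge0.
Qed.

Lemma cvg_squeeze0 (I : R) (A B C : nat -> R) k : 0 <= k ->
  (forall i, I <= 2 * C i + 4 * (A i + k * B i)) ->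
  A @ \oo --> (0 : R) -> B @ \oo --> (0 : R) -> C @ \oo --> (0 : R) -> I <= 0.
Proof.
move=> k0 H hA hB hC.
have h : (fun i => 2 * C i + 4 * (A i + k * B i)) @ \oo --> (2 * 0 + 4 * (0 + k * 0) : R).
  apply: cvgD; first by apply: cvgM => //; exact: cvg_cst.
  apply: cvgM; first exact: cvg_cst.
  by apply: cvgD => //; apply: cvgM => //; exact: cvg_cst.
have := cvgr_to_ge h (nearW _ H).
by rewrite !(mulr0, addr0); apply.
Qed.

#[local] Opaque ip sqint integral_left integral_right integral_slice.

(** Only the derivative normal to the edge is retained from [H1_cvg]. The approximants need no
    y-derivative, and a horizontal edge takes this form after exchanging the coordinates. *)
Definition edge_approx (x : R) w0 w1 : Prop :=
  exists F : nat -> (R * R -> R) * (R * R -> R),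
  [/\ forall i, C1x (F i).1 (F i).2,
      (fun i => ip M ((F i).1 - w0) ((F i).1 - w0)) @ \oo --> (0 : R),
      (fun i => ip M ((F i).2 - w1) ((F i).2 - w1)) @ \oo --> (0 : R) &
      (fun i => \int[n]_y ((F i).1 (x, y) ^+ 2)) @ \oo --> (0 : R)].

Lemma ip_edge_cont f x : continuous f ->
  ip M (fun p => f (x, p.2)) (fun p => f (x, p.2)) =
  (b - a) * \int[n]_y (f (x, y) ^+ 2).
Proof.
move=> cf; have cs := slice_cont2 (x:=x) cf.
have ms : measurable_fun setT (fun y => f (x, y)) by exact: continuous_measurable_fun.
apply: (ip_edge (phi := fun y => f (x, y))) => //.
have cI : {within `[c, d], continuous (fun y => f (x, y))} by exact: continuous_subspaceT.
have := continuous_compact cI (@segment_compact _ c d).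
move=> /compact_bounded [K [_ hK]].
apply/integrableP; split; first by apply/measurable_EFinP; exact: measurable_funX.
apply: (@le_lt_trans _ _ (\int[n]_y ((K + 1) ^+ 2)%:E)%E).
  apply: ae_ge0_le_integral => //.
  - apply: measurableT_comp => //; apply/measurable_EFinP; exact: measurable_funX.
  - by move=> y _; rewrite lee_fin sqr_ge0.
  apply: filterS (seg_ae c d) => y /andP[cy yd] _ /=.
  have hy : `|f (x, y)| <= K + 1.
    apply: hK; first by rewrite ltrDl.
    by exists y => //=; rewrite in_itv /= (ltW cy) (ltW yd).
  rewrite lee_fin normrX lerXn2r// ?nnegrE//; exact: le_trans hy.
by apply: integrable_lty => //; exact: finite_measure_integrable_cst.
Qed.

(** Passing to the limit in [trace_bound] at each edge gives e = 0 and e + Av w1 = 0 in L^2, which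
    are the two halves of [zerox]. *)
Lemma edge_approx_zerox w0 w1 : sqint M w0 -> sqint M w1 ->
  wderx a b c d w0 w1 -> edge_approx a w0 w1 -> edge_approx b w0 w1 ->
  zerox a b c d w0 w1.
Proof.
move=> h0 h1 d01 [F [F1 F2 F3 F4]] [G [G1 G2 G3 G4]].
have [e [he xe w0E]] := wderx_structure ab cd h0 h1 d01.
have hJ := Jx_sqint ab h1; have hJt := Jt_sqint ab h1; have hA := Av_sqint ab h1.
have k0 : 0 <= (b - a) ^+ 2 by exact: sqr_ge0.
have z0 h : sqint M h -> ip M 0 h = 0.
  by move=> hh; rewrite -(scale0r w0) ipZl ?mul0r.
have CE (f : nat -> R) : f @ \oo --> (0 : R) -> (fun i => (b - a) * f i) @ \oo --> (0 : R).
  move=> hf; have : (fun i => (b - a) * f i) @ \oo --> ((b - a) * 0 : R).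
    by apply: cvgM => //; exact: cvg_cst.
  by rewrite mulr0.
have e0 : ip M e e = 0.
  apply/eqP; rewrite eq_le ip_ge0 andbT.
  apply: (cvg_squeeze0 k0 _ F2 F3 (CE _ F4)) => i.
  have [cf cf' _] := F1 i; have [r1 _] := C1x_repr (F1 i).
  rewrite -(ip_edge_cont a cf).
  apply: (trace_bound (K := Jx) (t := 1) _ _ _ _ h0 h1 he).
  - by rewrite expr1n.
  - by move=> w; exact: Jx_sqint.
  - by move=> w; exact: Jx_bound.
  - by move=> v w; exact: JxD.
  - exact: continuous_sqint.
  - exact: continuous_sqint.
  - exact: continuous_sqint (edge_cont cf).
  - rewrite scale1r; exact: w0E.
  - rewrite scale1r; exact: r1.
have heA := sqintD he hA.
have e1 : ip M (e + Av w1) (e + Av w1) = 0.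
  apply/eqP; rewrite eq_le ip_ge0 andbT.
  apply: (cvg_squeeze0 k0 _ G2 G3 (CE _ G4)) => i.
  have [cf cf' _] := G1 i; have [r1 r2] := C1x_repr (G1 i).
  have hf := continuous_sqint cf; have hf' := continuous_sqint cf'.
  have hFa := continuous_sqint (edge_cont (x:=a) cf).
  have hFb := continuous_sqint (edge_cont (x:=b) cf).
  have hJf := Jx_sqint ab hf'; have hJtf := Jt_sqint ab hf'; have hAf := Av_sqint ab hf'.
  rewrite -(ip_edge_cont b cf).
  apply: (trace_bound (K := Jt) (t := -1) _ _ _ _ h0 h1 heA hf hf' hFb).
  - by rewrite sqrrN expr1n.
  - by move=> w; exact: Jt_sqint.
  - by move=> w; exact: Jt_bound.
  - by move=> v w; exact: JtD.
  - move=> h hh; rewrite (w0E _ hh) scaleN1r (ipBl heA hJt hh) (ipDl he hJ hh) (ipDl he hA hh).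
    have := Jx_Jt ab h1 hh; rewrite (ipDl hJ hJt hh) => <-.
    by rewrite addrA addrK.
  - move=> h hh; rewrite (r1 _ hh) scaleN1r (ipBl hFb hJtf hh) (r2 _ hh).
    rewrite (ipDl hFa hJf hh) (ipDl hFa hAf hh).
    have := Jx_Jt ab hf' hh; rewrite (ipDl hJf hJtf hh) => <-.
    by rewrite addrA addrK.
split=> h hh.
  by rewrite w0E// ipDl// (ip_eq0 he hh e0) add0r.
have := ip_eq0 heA hh e1; rewrite ipDl// (ip_eq0 he hh e0) add0r => ->.
by rewrite z0.
Qed.

End ZeroTrace.

(** * Exchange of the coordinates *)

Section Swap.
Context {R : realType}.
Local Notation Rm := (measurableTypeR R).
Implicit Types (a b c d : R) (f g h w z u : R * R -> R) (phi psi : R -> R).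

Definition flip (f : R * R -> R) : R * R -> R := fun p => f (p.2, p.1).

Lemma flip_meas f : measurable_fun (setT : set (Rm * Rm)) f ->
  measurable_fun (setT : set (Rm * Rm)) (flip f).
Proof.
move=> mf; have := measurableT_comp mf (@measurable_swap _ _ Rm Rm).
by apply.
Qed.

Lemma flip_integral_ge0 a b c d (g : Rm * Rm -> \bar R) : measurable_fun setT g ->
  (forall p, 0 <= g p)%E ->
  (\int[rect c d a b]_p g (p.2, p.1) = \int[rect a b c d]_p g p)%E.
Proof.
move=> mg g0.
have mgs : measurable_fun setT (fun p : Rm * Rm => g (p.2, p.1)).
  exact: measurableT_comp mg (@measurable_swap _ _ Rm Rm).
rewrite (@fubini_tonelli1 _ _ Rm Rm R (seg a b) (seg c d) g)//.
by rewrite (@fubini_tonelli2 _ _ Rm Rm R (seg c d) (seg a b) (fun p => g (p.2, p.1))).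
Qed.

Lemma flip_sqint a b c d f : sqint (rect a b c d) f -> sqint (rect c d a b) (flip f).
Proof.
move=> [mf f2]; have mff := flip_meas mf; split=> //.
pose g (p : Rm * Rm) := (`|f p ^+ 2|%:E)%E.
have mg : measurable_fun setT g.
  by apply/measurable_EFinP; apply: measurableT_comp => //; exact: measurable_funX.
apply/integrableP; split; first by apply/measurable_EFinP; exact: measurable_funX.
have /integrableP[_] := f2; apply: le_lt_trans.
rewrite -/g -(flip_integral_ge0 a b c d mg) ?lexx// => p.
by rewrite lee_fin.
Qed.

Lemma flip_ip a b c d f g : sqint (rect a b c d) f -> sqint (rect a b c d) g ->
  ip (rect c d a b) (flip f) (flip g) = ip (rect a b c d) f g.
Proof.
move=> hf hg; apply: (congr1 (@fine R)).
have e1 := integral21_prod_meas1 (ip_integrable (flip_sqint hf) (flip_sqint hg)).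
have e2 := integral12_prod_meas1 (ip_integrable hf hg).
exact: etrans (esym e1) e2.
Qed.

Lemma flip_tens phi psi : flip (tens phi psi) = tens psi phi.
Proof. by apply/funext => p; rewrite /flip /tens mulrC. Qed.

End Swap.

(** * Derivatives and boundary values in the y direction *)

Section YDirection.
Context {R : realType}.
Local Notation Rm := (measurableTypeR R).
Variables a b c d : R.
Hypotheses (ab : a < b) (cd : c < d).
Local Notation M := (rect a b c d).
Implicit Types (f g h w z u : R * R -> R) (phi psi : R -> R).

Definition wdery u w : Prop := forall phi psi, test1 a b phi -> test1 c d psi ->
  ip M u (tens phi (derive1 psi)) = - ip M w (tens phi psi).

Lemma wdery_flip u w : sqint M u -> sqint M w -> wdery u w ->
  wderx c d a b (flip u) (flip w).
Proof.
move=> hu hw uw phi psi tp ts; have td := test1_derive tp.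
have h1 := test_sqint ab cd ts td; have h2 := test_sqint ab cd ts tp.
have := uw _ _ ts tp; rewrite -(flip_ip hu h1) -(flip_ip hw h2).
by rewrite !flip_tens.
Qed.

Definition zeroy u w : Prop := zerox c d a b (flip u) (flip w).

Lemma zeroy_ibp u w f g : sqint M u -> sqint M w -> sqint M f -> sqint M g ->
  zeroy u w -> wdery f g -> ip M u g = - ip M w f.
Proof.
move=> hu hw hf hg uw fg.
rewrite -(flip_ip hu hg) -(flip_ip hw hf).
apply: (zerox_ibp cd ab) => //; try exact: flip_sqint.
exact: wdery_flip.
Qed.

Lemma tens_zeroy (G : R -> R) psi K : measurable_fun setT G ->
  (forall x, a < x < b -> `|G x| <= K) -> test1 c d psi ->
  [/\ sqint M (tens G psi), sqint M (tens G (derive1 psi)) &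
      zeroy (tens G psi) (tens G (derive1 psi))].
Proof.
move=> mG GK ts; have td := test1_derive ts.
have sq v : test1 c d v -> sqint M (tens G v).
  move=> tv; have [L hL] := test_bounded cd tv.
  by apply: (@bounded_tens_sqint _ _ _ _ _ K L) => //; exact: test_meas tv.
have h1 := sq _ ts; have h2 := sq _ td.
have k1 := flip_sqint h1; have k2 := flip_sqint h2.
split=> //.
have dpsi (x y : R) : is_derive x (1 : R) (fun s => flip (tens G psi) (s, y))
    (flip (tens G (derive1 psi)) (x, y)).
  have := @is_deriveZ _ _ _ psi (G y) x 1 _ (smooth1_derive x (ts.1 1%N)).
  by apply.
have cpsi y : continuous (fun s => flip (tens G (derive1 psi)) (s, y)).
  move=> s; apply: continuousM; first exact: cst_continuous.
  exact: (td.1 0%N).1.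
have p0 := test1_bounds ts.
split.
  apply: weq_ae => //; first exact: Jx_sqint.
  apply: filterS (rect_ae c d a b) => -[x y] /= [hx _].
  have [H _] := slice_ftc cd (fun s => dpsi s y) (cpsi y).
  by rewrite H// /flip /tens /= (p0 c) ?lexx// mulr0 subr0.
apply: weq_ae; [exact: Av_sqint|exact: sqint0|].
apply: nearW => -[x y].
have [_ H] := slice_ftc cd (fun s => dpsi s y) (cpsi y).
by rewrite H /flip /tens /= (p0 c) ?lexx// (p0 d) ?lexx ?orbT// subrr.
Qed.

(** The product G(x) psi(y) vanishes on y = c and y = d however rough G is, so integration by parts
    in y admits it as a test. *)
Lemma wdery_wdery_x u w : sqint M u -> sqint M w -> wdery u w -> wdery_x a b c d u w.
Proof.
move=> hu hw uw G psi K mG GK ts.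
have [h1 h2 hz] := tens_zeroy mG GK ts.
have := zeroy_ibp h1 h2 hu hw hz uw.
by rewrite (ipC M (tens G psi)) (ipC M (tens G (derive1 psi))) => ->; rewrite opprK.
Qed.

(** Vanishing on the vertical edges passes to the tangential derivative u_y; a second application
    gives u_yy. *)
Lemma zerox_wdery u w p q : sqint M u -> sqint M w -> sqint M p -> sqint M q ->
  zerox a b c d u w -> wdery u p -> wdery w q -> zerox a b c d p q.
Proof.
move=> hu hw hp hq zx up wq.
apply: (zerox_yder ab cd _ _ hu hw hp hq zx); exact: wdery_wdery_x.
Qed.

Lemma ehrling_y eta : 0 < eta -> exists C, forall w0 w1 w2,
  sqint M w0 -> sqint M w1 -> sqint M w2 -> wdery w0 w1 -> wdery w1 w2 ->
  ip M w1 w1 <= eta * ip M w2 w2 + C * ip M w0 w0.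
Proof.
move=> /(ehrling cd ab)[C HC]; exists C => w0 w1 w2 h0 h1 h2 d01 d12.
rewrite -(flip_ip h0 h0) -(flip_ip h1 h1) -(flip_ip h2 h2).
by apply: HC; try exact: flip_sqint; exact: wdery_flip.
Qed.

End YDirection.

(** * Weak derivatives on the plate *)

Section PlateTransfer.
Context {R : realType}.
Local Notation Rm := (measurableTypeR R).
Variable l : R.
Hypothesis l0 : 0 < l.
Local Notation M := (rect 0 pi (- l) l).
Local Notation mu := (plate_measure l).
Local Notation D := (wderiv l).
Implicit Types (f g h w z u v : R * R -> R) (phi psi : R -> R).

Let pi0 : (0 : R) < pi. Proof. exact: pi_gt0. Qed.
Let ll : - l < l. Proof. by move: l0; lra. Qed.

(** The restricted product and the product of the restrictions agree on measurable boxes, and a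
    product measure is determined by these. The second form is the one suited to Fubini's
    theorem. *)
Lemma plate_rect (A : set (Rm * Rm)) : measurable A -> mu A = M A.
Proof.
move=> mA; apply/esym; apply: product_measure_unique => // B C mB mC.
transitivity ((@lebesgue_measure R \x @lebesgue_measure R)%E
    ((B `&` `]0, pi[) `*` (C `&` `](- l), l[))).
  congr (product_measure1 _ _ _); apply/seteqP; split=> -[x y] /=.
    by move=> [[? ?] [? ?]].
  by move=> [[? ?] [? ?]].
apply: product_measure1E; apply: measurableI => //; exact: measurable_itv.
Qed.

Lemma plate_integral (f : Rm * Rm -> \bar R) :
  (\int[mu]_p f p = \int[M]_p f p)%E.
Proof. by apply: eq_measure_integral => A mA _; exact: plate_rect. Qed.

#[local] Opaque rect plate_measure.

Lemma plate_Rintegral f : \int[mu]_p f p = \int[M]_p f p.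
Proof. by rewrite /Rintegral plate_integral. Qed.

Lemma plate_sqint f : L2 l f <-> sqint M f.
Proof.
pose g := EFin \o (fun p => f p ^+ 2).
have E := plate_integral (fun p => `|g p|%E).
rewrite /L2; split=> [/LfunP2 [mf /integrableP[m2 i2]]|[mf /integrableP[m2 i2]]].
  split; [exact: mf|apply/integrableP; split; [exact: m2|]].
  rewrite -E; exact: i2.
apply/LfunP2; split; [exact: mf|apply/integrableP; split; [exact: m2|]].
rewrite E; exact: i2.
Qed.

Lemma plate_L2norm f : sqint M f -> L2norm l f = Num.sqrt (ip M f f).
Proof.
move=> h; have hf : sqint mu f := (LfunP2 mu f).1 ((plate_sqint f).2 h).
apply: etrans (fine_Lnorm2 hf) _.
exact: (congr1 (@Num.sqrt R) (plate_Rintegral (fun p => f p * f p))).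
Qed.

Lemma plate_ae (Q : R * R -> Prop) : (\forall p \ae mu, Q p) -> \forall p \ae M, Q p.
Proof.
move=> [N [mN N0 QN]]; exists N; split=> //.
by rewrite -plate_rect.
Qed.

Lemma Ck_smooth_D f : smooth f -> smooth ('D_e_x f) /\ smooth ('D_e_y f).
Proof. by move=> sf; split=> k; have [_ [_ []]] := sf k.+1. Qed.

Lemma smooth_pderiv i j f : smooth f -> smooth (pderiv i j f).
Proof.
move=> sf; rewrite /pderiv.
have sj : smooth (iter j (fun h => 'D_e_y h) f).
  by elim: j => //= j IH; have [] := Ck_smooth_D IH.
by elim: i => //= i IH; have [] := Ck_smooth_D IH.
Qed.

Lemma smooth_continuous f : smooth f -> continuous f.
Proof. by move=> sf; have [] := sf 0%N. Qed.

Lemma smooth_sqint f : smooth f -> sqint M f.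
Proof. by move=> sf; apply: continuous_sqint; exact: smooth_continuous. Qed.

Lemma test_function_D f : test_function l f ->
  test_function l ('D_e_x f) /\ test_function l ('D_e_y f).
Proof.
move=> [sf [K [cK KP fK]]].
have [sx sy] := Ck_smooth_D sf.
have D0 (v : R * R) p : ~ K p -> 'D_v f p = 0.
  move=> nK.
  have oK : open (~` K) by apply: closed_openC; apply: compact_closed => //; exact: norm_hausdorff.
  have nf : \forall q \near p, cst 0 q = f q.
    have := open_nbhs_nbhs (conj oK nK).
    by apply: filterS => q /fK.
  by have [_ ->] := near_eq_is_derive nf (is_derive_cst (0 : R) p v).
by split; split=> //; exists K; split=> // p; exact: D0.
Qed.

(** This holds for every u, because [wderiv] takes the value 0 when there is no weak derivative in
    L^2. *)
Lemma wderiv_sqint i j u : sqint M (D i j u).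
Proof.
rewrite /wderiv; case: xgetP => [w _ [/plate_sqint]|_] //.
exact: sqint0.
Qed.

Lemma is_wderivE i j u w : sqint M u -> sqint M w ->
  is_wderiv l i j u w <->
  forall f, test_function l f ->
    ip M u (pderiv i j f) = (-1) ^+ (i + j) * ip M w f.
Proof.
by move=> hu hw; split=> H f tf; have := H f tf; rewrite !plate_Rintegral.
Qed.

(** The defining identity of a weak derivative, restricted to product tests: enough to determine w
    up to null sets and to relate consecutive orders of differentiation. *)
Definition wtest i j u w := forall phi psi, test1 0 pi phi -> test1 (- l) l psi ->
  ip M u (tens (derive1n i phi) (derive1n j psi)) =
  (-1) ^+ (i + j) * ip M w (tens phi psi).

Lemma is_wderiv_wtest i j u w : sqint M u -> sqint M w ->
  is_wderiv l i j u w -> wtest i j u w.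
Proof.
move=> hu hw /(is_wderivE _ _ hu hw) H phi psi tp ts.
by rewrite -(tens_pderiv _ _ tp ts) H//; exact: tens_test.
Qed.

Lemma wtest_unique i j u w w' : sqint M w -> sqint M w' ->
  wtest i j u w -> wtest i j u w' -> weq M w w'.
Proof.
move=> hw hw' H H'; apply: weq_test => // phi psi tp ts.
apply: (@mulfI _ ((-1) ^+ (i + j))); first by rewrite signr_eq0.
by rewrite -H// -H'.
Qed.

Lemma wderiv_ex i j u : (exists w, L2 l w /\ is_wderiv l i j u w) ->
  is_wderiv l i j u (D i j u).
Proof. by rewrite /wderiv => -[w hw]; case: xgetP => [v _ []|/(_ w)]. Qed.

Lemma wderiv_wtest i j u : sqint M u ->
  (exists w, L2 l w /\ is_wderiv l i j u w) -> wtest i j u (D i j u).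
Proof.
move=> hu ew; apply: is_wderiv_wtest => //; first exact: wderiv_sqint.
exact: wderiv_ex.
Qed.

Lemma sobolev_wtest m i j u : sobolev l m u -> (i + j <= m)%N -> wtest i j u (D i j u).
Proof. by move=> [/plate_sqint hu H] ij; apply: wderiv_wtest => //; exact: H. Qed.

Lemma sobolev_sqint m u : sobolev l m u -> sqint M u.
Proof. by move=> [/plate_sqint]. Qed.

Lemma is_wderivZD i j k u v w z : sqint M u -> sqint M v -> sqint M w -> sqint M z ->
  is_wderiv l i j u w -> is_wderiv l i j v z ->
  is_wderiv l i j (k *: u + v) (k *: w + z).
Proof.
move=> hu hv hw hz /(is_wderivE _ _ hu hw) H1 /(is_wderivE _ _ hv hz) H2.
have hku := sqintZ k hu; have hkw := sqintZ k hw.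
apply/is_wderivE; [exact: sqintD|exact: sqintD|move=> f tf].
have hf := smooth_sqint tf.1; have hp := smooth_sqint (smooth_pderiv i j tf.1).
rewrite !ipDl// !ipZl// H1// H2//; ring.
Qed.

Lemma sobolevZD m k u v : sobolev l m u -> sobolev l m v -> sobolev l m (k *: u + v).
Proof.
move=> su sv; have hu := sobolev_sqint su; have hv := sobolev_sqint sv.
split=> [|i j ij]; first by apply/plate_sqint; apply: sqintD => //; exact: sqintZ.
have [w [/plate_sqint hw uw]] := su.2 i j ij; have [z [/plate_sqint hz vz]] := sv.2 i j ij.
exists (k *: w + z); split; last exact: is_wderivZD.
by apply/plate_sqint; apply: sqintD => //; exact: sqintZ.
Qed.

(** [wderiv] chooses a representative arbitrarily, so linearity can only be stated weakly and rests
    on uniqueness. *)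
Lemma wderivZD m k i j u v : sobolev l m u -> sobolev l m v -> (i + j <= m)%N ->
  weq M (D i j (k *: u + v)) (k *: D i j u + D i j v).
Proof.
move=> su sv ij.
have hu := sobolev_sqint su; have hv := sobolev_sqint sv.
have h1 := wderiv_sqint i j u; have h2 := wderiv_sqint i j v.
apply: (@wtest_unique i j (k *: u + v)).
- exact: wderiv_sqint.
- by apply: sqintD => //; exact: sqintZ.
- exact: sobolev_wtest (sobolevZD k su sv) ij.
apply: is_wderiv_wtest.
- by apply: sqintD => //; exact: sqintZ.
- by apply: sqintD => //; exact: sqintZ.
by apply: is_wderivZD => //; apply: wderiv_ex; [exact: su.2|exact: sv.2].
Qed.

(** Insert phi' in the first identity and phi in the second: the left-hand sides coincide and the
    signs differ by one factor -1. *)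
Lemma wtest_x i j u w z : wtest i j u w -> wtest i.+1 j u z -> wderx 0 pi (- l) l w z.
Proof.
move=> uw uz phi psi tp ts; have td := test1_derive tp.
have h1 := uw _ _ td ts; have h2 := uz _ _ tp ts.
apply: (@mulfI _ ((-1) ^+ (i + j))); first by rewrite signr_eq0.
rewrite -h1 /derive1n -iterSr h2 addSn exprS; ring.
Qed.

Lemma wtest_y i j u w z : wtest i j u w -> wtest i j.+1 u z -> wdery 0 pi (- l) l w z.
Proof.
move=> uw uz phi psi tp ts; have td := test1_derive ts.
have h1 := uw _ _ tp td; have h2 := uz _ _ tp ts.
apply: (@mulfI _ ((-1) ^+ (i + j))); first by rewrite signr_eq0.
rewrite -h1 /derive1n -iterSr h2 addnS exprS; ring.
Qed.

End PlateTransfer.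

(** * Boundary conditions and Green's formula *)

Section BoundaryConditions.
Context {R : realType}.
Local Notation Rm := (measurableTypeR R).
Variable l : R.
Hypothesis l0 : 0 < l.
Local Notation M := (rect 0 pi (- l) l).
Local Notation mu := (plate_measure l).
Local Notation D := (wderiv l).
Implicit Types (f g h w z u v : R * R -> R) (phi psi : R -> R).

Let pi0 : (0 : R) < pi. Proof. exact: pi_gt0. Qed.
Let ll : - l < l. Proof. by move: l0; lra. Qed.

Lemma smooth_C1x f : smooth f -> C1x f ('D_e_x f).
Proof.
move=> sf; have [_ [df _]] := sf 1%N.
split; [exact: smooth_continuous|exact: smooth_continuous (Ck_smooth_D sf).1|].
move=> x y; have [dx _] := df (x, y).
have E : (fun t : R => t^-1 *: ((f \o shift (x, y)) (t *: e_x) - f (x, y)))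
    = (fun t => t^-1 *: (((fun s => f (s, y)) \o shift x) (t *: 1) - f (x, y))).
  apply/funext => t; congr (_ *: (f _ - _)).
  by rewrite /e_x /=; congr (_, _); rewrite /= [t *: 0](scaler0 _ t) add0r.
by apply: DeriveDef; [rewrite /derivable -E|rewrite /derive -E].
Qed.

Lemma smooth_C1y f : smooth f -> C1x (flip f) (flip ('D_e_y f)).
Proof.
move=> sf; have [_ [df _]] := sf 1%N.
have cflip g : continuous g -> continuous (flip g).
  move=> cg p; have hp : {for p, continuous (fun p : R * R => (p.2, p.1))}.
    exact: (cvg_pair (@cvg_snd _ _ _ _ _) (@cvg_fst _ _ _ _ _)).
  exact: continuous_comp hp (cg _).
split; [exact/cflip/smooth_continuous|exact/cflip/smooth_continuous/(Ck_smooth_D sf).2|].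
move=> x y; have [_ dy] := df (y, x).
have E : (fun t : R => t^-1 *: ((f \o shift (y, x)) (t *: e_y) - f (y, x)))
    = (fun t => t^-1 *: (((fun s => flip f (s, y)) \o shift x) (t *: 1) - flip f (x, y))).
  apply/funext => t; congr (_ *: (f _ - _)).
  by rewrite /e_y /=; congr (_, _); rewrite /= [t *: 0](scaler0 _ t) add0r.
by apply: DeriveDef; [rewrite /derivable -E|rewrite /flip /= /derive -E].
Qed.

Lemma L2norm_cvg0 (F : nat -> R * R -> R) : (forall i, sqint M (F i)) ->
  (fun i => L2norm l (F i)) @ \oo --> (0 : R) ->
  (fun i => ip M (F i) (F i)) @ \oo --> (0 : R).
Proof.
move=> hF H.
have -> : (fun i => ip M (F i) (F i)) = (fun i => L2norm l (F i) * L2norm l (F i)).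
  apply/funext => i; rewrite plate_L2norm// -expr2 sqr_sqrtr//.
  exact: ip_ge0.
have : (fun i => L2norm l (F i) * L2norm l (F i)) @ \oo --> (0 * 0 : R) by exact: cvgM.
by rewrite mul0r.
Qed.

Lemma zero_vertical x w : sqint M w -> zero_on_vertical l x w ->
  edge_approx 0 pi (- l) l x w (D 1 0 w).
Proof.
move=> hw [f_ [sf [H1 H2 _] H3]].
exists (fun i => (f_ i, 'D_e_x (f_ i))); split => /=.
- by move=> i; exact: smooth_C1x.
- by apply: L2norm_cvg0 => // i; apply: sqintB => //; exact: smooth_sqint.
- apply: L2norm_cvg0 => // i; apply: sqintB; last exact: wderiv_sqint.
  exact: smooth_sqint (Ck_smooth_D (sf i)).1.
suff -> : (fun i => \int[seg (- l) l]_y (f_ i (x, y) ^+ 2)) =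
    (fun i => \int[lebesgue_measure]_(s in `](- l), l[) (f_ i (x, s)) ^+ 2) by [].
apply/funext => i; rewrite /Rintegral seg_integral//.
apply/measurable_EFinP; apply: measurable_funX; apply: continuous_measurable_fun.
exact: slice_cont2 (smooth_continuous (sf i)).
Qed.

Lemma zero_horizontal y w : sqint M w -> zero_on_horizontal l y w ->
  edge_approx (- l) l 0 pi y (flip w) (flip (D 0 1 w)).
Proof.
move=> hw [f_ [sf [H1 _ H2] H3]].
exists (fun i => (flip (f_ i), flip ('D_e_y (f_ i)))); split => /=.
- by move=> i; exact: smooth_C1y.
- have hd i : sqint M (f_ i - w) by apply: sqintB => //; exact: smooth_sqint.
  have E : (fun i => ip (rect (- l) l 0 pi) (flip (f_ i) - flip w) (flip (f_ i) - flip w)) =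
      (fun i => ip M (f_ i - w) (f_ i - w)).
    by apply/funext => i; exact: flip_ip (hd i) (hd i).
  apply: (eq_ind_r (fun F : nat -> R => F @ \oo --> (0 : R)) _ E).
  exact: L2norm_cvg0 hd H1.
- have hd i : sqint M ('D_e_y (f_ i) - D 0 1 w).
    apply: sqintB; last exact: wderiv_sqint.
    exact: smooth_sqint (Ck_smooth_D (sf i)).2.
  have E : (fun i => ip (rect (- l) l 0 pi) (flip ('D_e_y (f_ i)) - flip (D 0 1 w))
      (flip ('D_e_y (f_ i)) - flip (D 0 1 w))) =
      (fun i => ip M ('D_e_y (f_ i) - D 0 1 w) ('D_e_y (f_ i) - D 0 1 w)).
    by apply/funext => i; exact: flip_ip (hd i) (hd i).
  apply: (eq_ind_r (fun F : nat -> R => F @ \oo --> (0 : R)) _ E).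
  exact: L2norm_cvg0 hd H2.
suff -> : (fun i => \int[seg 0 pi]_s (flip (f_ i) (y, s) ^+ 2)) =
    (fun i => \int[lebesgue_measure]_(s in `]0, pi[) (f_ i (s, y)) ^+ 2) by [].
apply/funext => i; rewrite /Rintegral seg_integral//.
apply/measurable_EFinP; apply: measurable_funX; apply: continuous_measurable_fun.
exact: slice_cont (smooth_continuous (sf i)).
Qed.

Lemma hinged_zerox w : sqint M w -> (exists z, L2 l z /\ is_wderiv l 1 0 w z) ->
  zero_on_hinged_edges l w -> zerox 0 pi (- l) l w (D 1 0 w).
Proof.
move=> hw ew [z0 z1]; have hd := wderiv_sqint l 1 0 w.
have := wderiv_wtest hw ew => wt.
apply: edge_approx_zerox => //; try exact: zero_vertical.
move=> phi psi tp ts; have := wt _ _ tp ts.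
by rewrite /= expr1 mulN1r.
Qed.

Lemma free_zeroy w : sqint M w -> (exists z, L2 l z /\ is_wderiv l 0 1 w z) ->
  zero_on_free_edges l w -> zeroy 0 pi (- l) l w (D 0 1 w).
Proof.
move=> hw ew [z0 z1]; have hd := wderiv_sqint l 0 1 w.
have := wderiv_wtest hw ew => wt.
apply: edge_approx_zerox => //; try exact: zero_horizontal; try exact: flip_sqint.
apply: wdery_flip => // phi psi tp ts; have := wt _ _ tp ts.
by rewrite /= expr1 mulN1r.
Qed.

(* Only for j = 0: in general one would have to exchange the derivatives of the
   test function. *)
Lemma is_wderiv_Dx i u v z : sqint M u -> sqint M v -> sqint M z ->
  is_wderiv l i 0 u v -> is_wderiv l i.+1 0 u z -> is_wderiv l 1 0 v z.
Proof.
move=> hu hv hz /(is_wderivE _ _ hu hv) uv /(is_wderivE _ _ hu hz) uz.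
apply/(is_wderivE _ _ hv hz) => f tf.
have [tx _] := test_function_D tf.
have h1 := uv _ tx; have h2 := uz _ tf.
apply: (@mulfI _ ((-1) ^+ (i + 0))); first by rewrite signr_eq0.
rewrite -[pderiv 1 0 f]/('D_e_x f) -h1.
rewrite -[pderiv i 0 _]iterSr -[iter i.+1 _ f]/(pderiv i.+1 0 f) h2 addSn exprS.
by rewrite expr1; ring.
Qed.

(** [pderiv] applies the y-derivatives first, so replacing f by its y-derivative raises j by one for
    every i, without exchanging derivatives. *)
Lemma is_wderiv_Dy i j u v z : sqint M u -> sqint M v -> sqint M z ->
  is_wderiv l i j u v -> is_wderiv l i j.+1 u z -> is_wderiv l 0 1 v z.
Proof.
move=> hu hv hz /(is_wderivE _ _ hu hv) uv /(is_wderivE _ _ hu hz) uz.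
apply/(is_wderivE _ _ hv hz) => f tf.
have [_ ty] := test_function_D tf.
have h1 := uv _ ty; have h2 := uz _ tf.
apply: (@mulfI _ ((-1) ^+ (i + j))); first by rewrite signr_eq0.
rewrite -[pderiv 0 1 f]/('D_e_y f) -h1.
have -> : pderiv i j ('D_e_y f) = pderiv i j.+1 f.
  by rewrite /pderiv iterSr.
by rewrite h2 addnS exprS expr1; ring.
Qed.

End BoundaryConditions.

Section ZeroxLin.
Context {R : realType}.
Variables a b c d : R.
Hypotheses (ab : a < b) (cd : c < d).
Local Notation M := (rect a b c d).

Lemma zerox_lin (k : R) u v w z y : sqint M u -> sqint M v -> sqint M w -> sqint M z ->
  sqint M y -> zerox a b c d u w -> zerox a b c d v z -> weq M y (k *: w + z) ->
  zerox a b c d (k *: u + v) y.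
Proof.
move=> hu hv hw hz hy [u1 u2] [v1 v2] yE.
have hku := sqintZ k hu; have hkw := sqintZ k hw.
have z0 h : sqint M h -> ip M 0 h = 0.
  by move=> hh; rewrite -(scale0r u) ipZl ?mul0r.
split=> h hh.
  have hJ := Jt_sqint ab hh.
  by rewrite Jx_adj// yE// !ipDl// !ipZl// u1// v1// !Jx_adj.
have hA := Av_sqint ab hh.
by rewrite z0// Av_adj// yE// ipDl// ipZl// -!Av_adj// u2// v2// !z0// mulr0 addr0.
Qed.

End ZeroxLin.

(** * The algebra of Green's formula *)

Section Expand.
Context d (T : measurableType d) (R : realType).
Variable mu : {measure set T -> \bar R}.
Local Notation ip := (ip mu).
Implicit Types f g : T -> R.

Lemma bending_expand (s : R) u1 u2 u3 w1 w2 w3 :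
  sqint mu u1 -> sqint mu u2 -> sqint mu u3 ->
  sqint mu w1 -> sqint mu w2 -> sqint mu w3 ->
  \int[mu]_p ((u1 + u2) p * (w1 + w2) p
    - (1 - s) * (u1 p * w2 p + u2 p * w1 p - 2 * u3 p * w3 p)) =
  ip u1 w1 + ip u2 w2 + s * (ip u1 w2 + ip u2 w1) + 2 * (1 - s) * ip u3 w3.
Proof.
move=> h1 h2 h3 k1 k2 k3.
have i1 := ip_integrable (sqintD h1 h2) (sqintD k1 k2).
have i2 := ip_integrable h1 k2.
have i3 := ip_integrable h2 k1.
have i4 := ip_integrable (sqintZ 2 h3) k3.
have i23 : mu.-integrable setT (EFin \o (fun p => u1 p * w2 p + u2 p * w1 p)).
  by have := integrableD measurableT i2 i3; apply: eq_integrable.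
have i234 : mu.-integrable setT (EFin \o (fun p => u1 p * w2 p + u2 p * w1 p
    - 2 * u3 p * w3 p)).
  by have := integrableB measurableT i23 i4; apply: eq_integrable.
have i5 : mu.-integrable setT (EFin \o (fun p => (1 - s) * (u1 p * w2 p + u2 p * w1 p
    - 2 * u3 p * w3 p))).
  by have := integrableZl measurableT (1 - s) i234; apply: eq_integrable.
rewrite RintegralB// RintegralZl// RintegralB// RintegralD//.
rewrite -[\int[mu]_x ((u1 + u2) x * (w1 + w2) x)]/(ip (u1 + u2) (w1 + w2)).
rewrite -[\int[mu]_x (2 * u3 x * w3 x)]/(ip (2 *: u3) w3).
rewrite -[\int[mu]_x (u1 x * w2 x)]/(ip u1 w2) -[\int[mu]_x (u2 x * w1 x)]/(ip u2 w1).
rewrite (ipDl h1 h2 (sqintD k1 k2)) (ipDr k1 k2 h1) (ipDr k1 k2 h2) (ipZl _ h3 k3).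
move: (ip u1 w1) (ip u1 w2) (ip u2 w1) (ip u2 w2) (ip u3 w3) => x1 x2 x3 x4 x5.
ring.
Qed.

(** The digits are the orders of the derivative of u, the letter tells its partner: w for p and m,
    w_x for r and y, w_y for n, w_xx for q and c, w_yy for b, w_xy for x. The equations are seven
    integrations by parts, and the third-order terms cancel. *)
Lemma green_algebra (s p40 r30 q20 n03 n21 m04 m22 b02 b20 x11 y12 c02 : R) :
  p40 = - r30 -> q20 = - r30 ->
  n03 + (2 - s) * n21 = - (m04 + (2 - s) * m22) ->
  b02 + s * b20 = - (n03 + s * n21) ->
  n21 = - x11 -> m22 = - y12 -> c02 = - y12 ->
  p40 + 2 * m22 + m04 = q20 + b02 + s * (b20 + c02) + 2 * (1 - s) * x11.
Proof.
move=> -> -> h3 h4 e5 e6 ->; rewrite e6 in h3 *.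
have -> : m04 = - (n03 + (2 - s) * n21) - (2 - s) * - y12.
  by rewrite h3; ring.
have -> : b02 = - (n03 + s * n21) - s * b20 by rewrite -h4; ring.
by rewrite e5; ring.
Qed.

(* The arguments are named after the derivatives of u (u20 = u_xx, ...) and w. *)
Lemma green_core (s : R) (w w10 w01 w20 w11 w02 : T -> R)
    (u40 u30 u20 u11 u02 u12 u03 u21 u04 u22 : T -> R) :
  sqint mu w -> sqint mu w10 -> sqint mu w01 -> sqint mu w20 -> sqint mu w11 ->
  sqint mu w02 -> sqint mu u40 -> sqint mu u30 -> sqint mu u20 -> sqint mu u11 ->
  sqint mu u02 -> sqint mu u12 -> sqint mu u03 -> sqint mu u21 -> sqint mu u04 ->
  sqint mu u22 ->
  ip w u40 = - ip w10 u30 -> ip u20 w20 = - ip u30 w10 ->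
  ip (u03 + (2 - s) *: u21) w01 = - ip (u04 + (2 - s) *: u22) w ->
  ip (u02 + s *: u20) w02 = - ip (u03 + s *: u21) w01 ->
  ip w01 u21 = - ip w11 u11 -> ip w u22 = - ip w10 u12 -> ip u02 w20 = - ip u12 w10 ->
  ip (u40 + 2 *: u22 + u04) w =
  ip u20 w20 + ip u02 w02 + s * (ip u20 w02 + ip u02 w20) + 2 * (1 - s) * ip u11 w11.
Proof.
move=> hw hw10 hw01 hw20 hw11 hw02 h40 h30 h20 h11 h02 h12 h03 h21 h04 h22.
rewrite (ipC _ w) (ipC _ w10) => g1 g2.
have k22 := sqintZ (2 - s) h22; have k21 := sqintZ (2 - s) h21.
have k21' := sqintZ s h21; have k20 := sqintZ s h20; have k22' := sqintZ 2 h22.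
rewrite (ipDl h03 k21 hw01) (ipZl _ h21 hw01) (ipDl h04 k22 hw) (ipZl _ h22 hw) => g3.
rewrite (ipDl h02 k20 hw02) (ipZl _ h20 hw02) (ipDl h03 k21' hw01) (ipZl _ h21 hw01) => g4.
rewrite (ipC _ w01) (ipC _ w11) (ipC _ w) (ipC _ w10) => g5 g6 g7.
rewrite (ipDl (sqintD h40 k22') h04 hw) (ipDl h40 k22' hw) (ipZl _ h22 hw).
exact: green_algebra g1 g2 g3 g4 g5 g6 g7.
Qed.

End Expand.

Section Green.
Context {R : realType}.
Local Notation Rm := (measurableTypeR R).
Variable l : R.
Hypothesis l0 : 0 < l.
Local Notation M := (rect 0 pi (- l) l).
Local Notation D := (wderiv l).
Variable sigma : R.
Implicit Types (f g h w z u v : R * R -> R) (phi psi : R -> R).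

Let pi0 : (0 : R) < pi. Proof. exact: pi_gt0. Qed.
Let ll : - l < l. Proof. by move: l0; lra. Qed.

Local Notation zx := (zerox 0 pi (- l) l).

(** The consequence of [H2s] on which the estimates rest, with [zerox] in place of approximating
    sequences for the boundary condition. *)
Definition hingedH2 u : Prop := sobolev l 2 u /\ zx u (D 1 0 u).

Lemma H2s_hingedH2 u : H2s l u -> hingedH2 u.
Proof.
move=> [su zu]; split=> //; apply: hinged_zerox => //; first exact: sobolev_sqint su.
exact: su.2.
Qed.

Lemma hingedH2_sqint u : hingedH2 u -> sqint M u.
Proof. by move=> [su _]; exact: sobolev_sqint su. Qed.

Lemma hingedH2_ZD k u v : hingedH2 u -> hingedH2 v -> hingedH2 (k *: u + v).
Proof.
move=> [su zu] [sv zv]; split; first exact: sobolevZD.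
have hu := sobolev_sqint su; have hv := sobolev_sqint sv.
apply: (zerox_lin pi0 hu hv _ _ _ zu zv); try exact: wderiv_sqint.
exact: wderivZD su sv _.
Qed.

(* The bending form with the Laplacians multiplied out. *)
Definition bform u w : R :=
  ip M (D 2 0 u) (D 2 0 w) + ip M (D 0 2 u) (D 0 2 w)
  + sigma * (ip M (D 2 0 u) (D 0 2 w) + ip M (D 0 2 u) (D 2 0 w))
  + 2 * (1 - sigma) * ip M (D 1 1 u) (D 1 1 w).

Lemma bendingE u w : bending l sigma u w = bform u w.
Proof.
have h i j v : sqint M (D i j v) by exact: wderiv_sqint.
apply: etrans (plate_Rintegral _ _) _.
exact: (bending_expand sigma (h 2 0 u) (h 0 2 u) (h 1 1 u) (h 2 0 w) (h 0 2 w) (h 1 1 w))%N.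
Qed.

(** Each integration by parts is in one direction and has a factor vanishing on both edges
    concerned. On the hinged edges it is w, u_xx, w_y or u_yy; on the free edges it is one of the
    two combinations in [domA]. No corner terms arise. *)
Lemma green u w : domA l sigma u -> hingedH2 w -> ip M (bilaplacian l u) w = bform u w.
Proof.
move=> [su /H2s_hingedH2 [_ zu] z20 zF zG] [sw zw].
have hU i j : sqint M (D i j u) by exact: wderiv_sqint.
have hW i j : sqint M (D i j w) by exact: wderiv_sqint.
have hu := sobolev_sqint su; have hw := sobolev_sqint sw.
have tU i j : (i + j <= 4)%N -> wtest l i j u (D i j u) by exact: sobolev_wtest.
have tW i j : (i + j <= 2)%N -> wtest l i j w (D i j w) by exact: sobolev_wtest.
have dU i j : (i + j <= 4)%N -> is_wderiv l i j u (D i j u).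
  by move=> ij; apply: wderiv_ex; exact: su.2.
have w00 v : wtest l 0 0 v v by move=> phi psi _ _; rewrite /= expr0 mul1r.
have lU i j : L2 l (D i j u) by apply/plate_sqint.
have d20 : is_wderiv l 1 0 (D 2 0 u) (D 3 0 u).
  by apply: (is_wderiv_Dx hu) => //; exact: dU.
have e20 : exists z, L2 l z /\ is_wderiv l 1 0 (D 2 0 u) z by exists (D 3 0 u).
have zx20 := hinged_zerox l0 (hU 2 0) e20 z20.
(* The hinged condition yields the derivative chosen for u_xx, while Green's formula speaks of the
   one chosen for u; uniqueness identifies them. *)
have q20 : weq M (D 1 0 (D 2 0 u)) (D 3 0 u).
  apply: (@wtest_unique _ l l0 1 0 (D 2 0 u)) => //; first exact: wderiv_sqint.
    exact: wderiv_wtest.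
  exact: is_wderiv_wtest.
have hF : sqint M (D 0 2 u + sigma *: D 2 0 u) by apply: sqintD => //; exact: sqintZ.
have hF' : sqint M (D 0 3 u + sigma *: D 2 1 u) by apply: sqintD => //; exact: sqintZ.
have hG : sqint M (D 0 3 u + (2 - sigma) *: D 2 1 u) by apply: sqintD => //; exact: sqintZ.
have hG' : sqint M (D 0 4 u + (2 - sigma) *: D 2 2 u) by apply: sqintD => //; exact: sqintZ.
have dy i j : (i + j < 4)%N -> is_wderiv l 0 1 (D i j u) (D i j.+1 u).
  move=> ij.
  have ij' : (i + j.+1 <= 4)%N by rewrite addnS.
  exact: (is_wderiv_Dy hu (hU i j) (hU i j.+1) (dU i j (ltnW ij)) (dU i j.+1 ij')).
have dF : is_wderiv l 0 1 (D 0 2 u + sigma *: D 2 0 u) (D 0 3 u + sigma *: D 2 1 u).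
  rewrite [X in is_wderiv _ _ _ X _]addrC [X in is_wderiv _ _ _ _ X]addrC.
  exact: (is_wderivZD sigma (hU 2 0) (hU 0 2) (hU 2 1) (hU 0 3)
    (dy 2 0 isT) (dy 0 2 isT))%N.
have dG : is_wderiv l 0 1 (D 0 3 u + (2 - sigma) *: D 2 1 u) (D 0 4 u + (2 - sigma) *: D 2 2 u).
  rewrite [X in is_wderiv _ _ _ X _]addrC [X in is_wderiv _ _ _ _ X]addrC.
  exact: (is_wderivZD (2 - sigma) (hU 2 1) (hU 0 3) (hU 2 2) (hU 0 4)
    (dy 2 1 isT) (dy 0 3 isT))%N.
have exF := ex_intro (fun z => L2 l z /\ is_wderiv l 0 1 _ z) _
  (conj ((plate_sqint _ _).2 hF') dF).
have exG := ex_intro (fun z => L2 l z /\ is_wderiv l 0 1 _ z) _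
  (conj ((plate_sqint _ _).2 hG') dG).
have zyF := free_zeroy l0 hF exF zF.
have zyG := free_zeroy l0 hG exG zG.
have qF := wtest_unique l0 (wderiv_sqint l 0 1 _) hF' (wderiv_wtest hF exF)
  (is_wderiv_wtest hF hF' dF).
have qG := wtest_unique l0 (wderiv_sqint l 0 1 _) hG' (wderiv_wtest hG exG)
  (is_wderiv_wtest hG hG' dG).
(* From here on, the tangential derivatives w_y, u_y and u_yy are shown to vanish on the hinged
   edges. *)
have zW : zx (D 0 1 w) (D 1 1 w).
  apply: (zerox_wdery pi0 ll hw (hW 1 0) (hW 0 1) (hW 1 1) zw).
    exact: wtest_y (w00 w) (tW 0 1 isT).
  exact: wtest_y (tW 1 0 isT) (tW 1 1 isT).
have zU1 : zx (D 0 1 u) (D 1 1 u).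
  apply: (zerox_wdery pi0 ll hu (hU 1 0) (hU 0 1) (hU 1 1) zu).
    exact: wtest_y (w00 u) (tU 0 1 isT).
  exact: wtest_y (tU 1 0 isT) (tU 1 1 isT).
have zU2 : zx (D 0 2 u) (D 1 2 u).
  apply: (zerox_wdery pi0 ll (hU 0 1) (hU 1 1) (hU 0 2) (hU 1 2) zU1).
    exact: wtest_y (tU 0 1 isT) (tU 0 2 isT).
  exact: wtest_y (tU 1 1 isT) (tU 1 2 isT).
have wx i j : (i + j < 4)%N -> wderx 0 pi (- l) l (D i j u) (D i.+1 j u).
  by move=> ij; apply: (wtest_x (tU i j _) (tU i.+1 j _)) => //; exact: ltnW.
have wW : wderx 0 pi (- l) l (D 1 0 w) (D 2 0 w) by exact: wtest_x (tW 1 0 isT) (tW 2 0 isT).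
have wWy0 : wdery 0 pi (- l) l w (D 0 1 w) by exact: wtest_y (w00 w) (tW 0 1 isT).
have wWy : wdery 0 pi (- l) l (D 0 1 w) (D 0 2 w) by exact: wtest_y (tW 0 1 isT) (tW 0 2 isT).
have g1 := zerox_ibp pi0 ll hw (hW 1 0) (hU 3 0) (hU 4 0) zw (wx 3 0 isT).
have g2 := zerox_ibp pi0 ll (hU 2 0) (wderiv_sqint l 1 0 (D 2 0 u)) (hW 1 0) (hW 2 0) zx20 wW.
have {}g2 := etrans g2 (congr1 -%R (q20 _ (hW 1 0)))%N.
have g3 := zeroy_ibp pi0 ll hG (wderiv_sqint l 0 1 _) hw (hW 0 1) zyG wWy0.
have {}g3 := etrans g3 (congr1 -%R (qG _ hw)).
have g4 := zeroy_ibp pi0 ll hF (wderiv_sqint l 0 1 _) (hW 0 1) (hW 0 2) zyF wWy.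
have {}g4 := etrans g4 (congr1 -%R (qF _ (hW 0 1)))%N.
have g5 := zerox_ibp pi0 ll (hW 0 1) (hW 1 1) (hU 1 1) (hU 2 1) zW (wx 1 1 isT).
have g6 := zerox_ibp pi0 ll hw (hW 1 0) (hU 1 2) (hU 2 2) zw (wx 1 2 isT).
have g7 := zerox_ibp pi0 ll (hU 0 2) (hU 1 2) (hW 1 0) (hW 2 0) zU2 wW.
exact: (green_core hw (hW 1 0) (hW 0 1) (hW 2 0) (hW 1 1) (hW 0 2)
  (hU 4 0) (hU 3 0) (hU 2 0) (hU 1 1) (hU 0 2) (hU 1 2) (hU 0 3) (hU 2 1) (hU 0 4) (hU 2 2)
  g1 g2 g3 g4 g5 g6 g7)%N.
Qed.

End Green.

(** * Coercivity of the bending form *)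

Section QuadraticForms.
Context d (T : measurableType d) (R : realType).
Variable mu : {measure set T -> \bar R}.
Local Notation ip := (ip mu).
Implicit Types f g : T -> R.

(** By Young's inequality the cross term 2 s (f1, f2) is at least -s (|f1|^2 + |f2|^2). *)
Lemma quadratic_coercive (s : R) f1 f2 f3 : 0 < s < 1 -> sqint mu f1 -> sqint mu f2 ->
  (1 - s) * (ip f1 f1 + ip f2 f2 + 2 * ip f3 f3) <=
  ip f1 f1 + ip f2 f2 + s * (ip f1 f2 + ip f2 f1) + 2 * (1 - s) * ip f3 f3.
Proof.
move=> /andP[s0 s1] h1 h2.
have /andP[] : - (1 / 2 * ip f1 f1 + ip f2 f2 / (2 * 1)) <= ip f1 f2
    <= 1 / 2 * ip f1 f1 + ip f2 f2 / (2 * 1).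
  by rewrite -ler_norml; exact: (ip_young ltr01 h1 h2).
rewrite (ipC _ f2 f1); move: (ip f1 f1) (ip f2 f2) (ip f3 f3) (ip f1 f2) => a b c x h _.
have : 0 <= s * (a + b + 2 * x) by apply: mulr_ge0; lra.
by lra.
Qed.

Lemma quadratic_bounds (s e a b c : R) : s < 1 -> 0 <= a -> 0 <= b -> 0 <= c ->
  (1 - s) * (a + b + 2 * c) <= e ->
  [/\ 0 <= e, a <= (1 - s)^-1 * e, b <= (1 - s)^-1 * e & c <= (1 - s)^-1 * e].
Proof.
move=> s1 a0 b0 c0 h; have s1' : 0 < 1 - s by lra.
have [ha hb hc] : [/\ (1 - s) * a <= e, (1 - s) * b <= e & (1 - s) * c <= e].
  have := mulr_ge0 (ltW s1') a0; have := mulr_ge0 (ltW s1') b0.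
  by have := mulr_ge0 (ltW s1') c0; split; lra.
by split; [exact: le_trans (mulr_ge0 (ltW s1') a0) ha|..];
  rewrite mulrC ler_pdivlMr// mulrC.
Qed.

Lemma bending_linear (s k p1 p2 p3 p4 p5 a1 a2 a3 a4 a5 b1 b2 b3 b4 b5 : R) :
  p1 = k * a1 + b1 -> p2 = k * a2 + b2 -> p3 = k * a3 + b3 -> p4 = k * a4 + b4 ->
  p5 = k * a5 + b5 ->
  p1 + p2 + s * (p3 + p4) + 2 * (1 - s) * p5 =
  k * (a1 + a2 + s * (a3 + a4) + 2 * (1 - s) * a5)
  + (b1 + b2 + s * (b3 + b4) + 2 * (1 - s) * b5).
Proof. by move=> -> -> -> -> ->; ring. Qed.

Lemma bendingC (s : R) f1 f2 f3 g1 g2 g3 :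
  ip f1 g1 + ip f2 g2 + s * (ip f1 g2 + ip f2 g1) + 2 * (1 - s) * ip f3 g3 =
  ip g1 f1 + ip g2 f2 + s * (ip g1 f2 + ip g2 f1) + 2 * (1 - s) * ip g3 f3.
Proof.
rewrite (ipC _ g1 f1) (ipC _ g2 f2) (ipC _ g1 f2) (ipC _ g2 f1) (ipC _ g3 f3).
by rewrite [ip f2 g1 + _]addrC.
Qed.

(** Read f = u_xx, g = u, q = |u_x|^2 and r the Poincare constant. Young's inequality with weight r
    leaves at most q/2 from |u|^2, which is absorbed. *)
Lemma xform_algebra (q : R) f g (r : R) : 0 < r -> sqint mu f -> sqint mu g ->
  ip f g = - q -> ip g g <= r * q -> q <= r * ip f f.
Proof.
move=> r0 hf hg h1 h2.
have /andP[+ _] : - (r / 2 * ip f f + ip g g / (2 * r)) <= ip f g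
    <= r / 2 * ip f f + ip g g / (2 * r).
  by rewrite -ler_norml; exact: (ip_young r0 hf hg).
rewrite h1; move: (ip g g) (ip f f) h2 => m a h2 h3.
have : m / (2 * r) <= q / 2 by rewrite ler_pdivrMr ?mulr_gt0//; lra.
by lra.
Qed.

End QuadraticForms.

Section Coercive.
Context {R : realType}.
Variable l : R.
Hypothesis l0 : 0 < l.
Local Notation M := (rect 0 pi (- l) l).
Local Notation D := (wderiv l).
Variable sigma : R.
Hypothesis hsigma : 0 < sigma < 1.
Implicit Types (f g h w z u v : R * R -> R).

Let pi0 : (0 : R) < pi. Proof. exact: pi_gt0. Qed.
Let ll : - l < l. Proof. by move: l0; lra. Qed.
Let hD i j u : sqint M (D i j u). Proof. exact: wderiv_sqint. Qed.

Local Notation Hs := (hingedH2 l).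
Local Notation bf := (bform l sigma).

Lemma bform_ge u : (1 - sigma) * (ip M (D 2 0 u) (D 2 0 u) + ip M (D 0 2 u) (D 0 2 u)
  + 2 * ip M (D 1 1 u) (D 1 1 u)) <= bf u u.
Proof. exact: (quadratic_coercive _ hsigma (hD 2 0 u) (hD 0 2 u)). Qed.

Lemma bform_bounds u : [/\ 0 <= bf u u,
  ip M (D 2 0 u) (D 2 0 u) <= (1 - sigma)^-1 * bf u u,
  ip M (D 0 2 u) (D 0 2 u) <= (1 - sigma)^-1 * bf u u &
  ip M (D 1 1 u) (D 1 1 u) <= (1 - sigma)^-1 * bf u u].
Proof.
have [_ s1] := andP hsigma.
exact: (quadratic_bounds s1 (ip_ge0 M _) (ip_ge0 M _) (ip_ge0 M _) (bform_ge u)).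
Qed.

Lemma bformC u w : bf u w = bf w u.
Proof. exact: (bendingC M sigma). Qed.

Lemma bformZD k u v w : Hs u -> Hs v ->
  bf (k *: u + v) w = k * bf u w + bf v w.
Proof.
move=> [su _] [sv _].
have E i j f : (i + j <= 2)%N -> sqint M f ->
    ip M (D i j (k *: u + v)) f = k * ip M (D i j u) f + ip M (D i j v) f.
  move=> ij hf; rewrite (wderivZD l0 k su sv ij hf) (ipDl (sqintZ k _) _ hf)//.
  by rewrite (ipZl k (hD i j u) hf).
exact: (bending_linear sigma (E 2 0 _ isT (hD 2 0 w)) (E 0 2 _ isT (hD 0 2 w))
  (E 2 0 _ isT (hD 0 2 w)) (E 0 2 _ isT (hD 2 0 w)) (E 1 1 _ isT (hD 1 1 w)))%N.
Qed.

Lemma xform_ibp u w : Hs u -> Hs w -> ip M (D 2 0 u) w = - ip M (D 1 0 u) (D 1 0 w).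
Proof.
move=> [su _] [sw zw]; rewrite ipC (ipC M (D 1 0 u)).
apply: (zerox_ibp pi0 ll (sobolev_sqint sw) (hD 1 0 w) (hD 1 0 u) (hD 2 0 u) zw).
exact: wtest_x (sobolev_wtest su _) (sobolev_wtest su _).
Qed.

Lemma poincare u : Hs u -> ip M u u <= pi ^+ 2 * ip M (D 1 0 u) (D 1 0 u).
Proof.
move=> [su zu]; have := zerox_poincare pi0 (sobolev_sqint su) (hD 1 0 u) zu.
by rewrite subr0.
Qed.

Lemma xform_le u : Hs u ->
  ip M (D 1 0 u) (D 1 0 u) <= pi ^+ 2 / (1 - sigma) * bf u u.
Proof.
move=> Hu; have hu := hingedH2_sqint Hu.
have p2 : (0 : R) < pi ^+ 2 by rewrite exprn_gt0.
have h1 := poincare Hu; have h2 := xform_ibp Hu Hu.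
have [_ h4 _ _] := bform_bounds u.
rewrite -mulrA; apply: le_trans (ler_wpM2l (ltW p2) h4).
exact: xform_algebra p2 (hD 2 0 u) hu h2 h1.
Qed.

Lemma ydiff_le (eta : R) : 0 < eta -> exists2 C, 0 <= C &
  forall u, Hs u -> ip M (D 0 1 u) (D 0 1 u) <= eta * bf u u + C * ip M u u.
Proof.
move=> eta0; have [s0 s1] := andP hsigma.
(* The factor 1 - sigma compensates the constant in the bound of |u_yy|^2 by the bending form. *)
have eta1 : 0 < eta * (1 - sigma) by rewrite mulr_gt0// subr_gt0.
have [C HC] := ehrling_y pi0 ll eta1.
exists (Num.max 0 C) => [|u [su _]]; first by rewrite le_max lexx.
have hu := sobolev_sqint su.
have w0 : wdery 0 pi (- l) l u (D 0 1 u).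
  apply: (@wtest_y _ l 0 0 u) (sobolev_wtest su _) => //.
  by move=> phi psi _ _; rewrite /= expr0 mul1r.
have w1 : wdery 0 pi (- l) l (D 0 1 u) (D 0 2 u).
  exact: wtest_y (sobolev_wtest su _) (sobolev_wtest su _).
have h := HC u _ _ hu (hD 0 1 u) (hD 0 2 u) w0 w1.
have [_ _ h4 _] := bform_bounds u; have n0 := ip_ge0 M u.
move: h h4 n0; move: (ip M u u) (ip M (D 0 1 u) _) (ip M (D 0 2 u) _) => n y a h h4 n0.
apply: le_trans h _; apply: lerD.
  rewrite -mulrA; apply: ler_wpM2l; first exact: ltW.
  by rewrite mulrC -ler_pdivlMr ?subr_gt0// mulrC.
by apply: ler_wpM2r => //; rewrite le_max lexx orbT.
Qed.

End Coercive.

(** * Differentiation along a path and Gronwall's lemma *)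

Section DiffQuotient.
Context {R : realType}.
Variables (F : set_system R) (t : R).
Context {FF : Filter F}.
Hypothesis Ft : s @[s --> F] --> t.

(** With a general filter the same rules serve interior points and, through [within], the one-sided
    derivatives at 0 and T. *)
Definition rder (f : R -> R) (d : R) : Prop :=
  (s - t)^-1 * (f s - f t) @[s --> F] --> d.

Lemma rderD (f g : R -> R) d e : rder f d -> rder g e -> rder (f + g) (d + e).
Proof.
rewrite /rder => hf hg; have h := cvgD hf hg.
apply: cvg_trans (h FF); apply: near_eq_cvg.
by apply: nearW => s /=; rewrite !fctE; ring.
Qed.

Lemma rderZ (k : R) f d : rder f d -> rder (k *: f) (k * d).
Proof.
rewrite /rder => hf; have h := cvgM (cvg_cst k) hf.
apply: cvg_trans (h FF FF); apply: near_eq_cvg.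
by apply: nearW => s /=; rewrite !fctE /GRing.scale/=; ring.
Qed.

Lemma quotientE (f : R -> R) s : f s - f t = (s - t) * ((s - t)^-1 * (f s - f t)).
Proof.
have [->|st] := eqVneq s t; first by rewrite !subrr mul0r.
by rewrite mulrA divff ?mul1r// subr_eq0.
Qed.

Lemma cvg_sub0 : (s - t) @[s --> F] --> (0 : R).
Proof. by rewrite -(subrr t); apply: cvgB => //; exact: cvg_cst. Qed.

Lemma rder_cvg f d : rder f d -> f @ F --> f t.
Proof.
move=> hf.
have : f t + (s - t) * ((s - t)^-1 * (f s - f t)) @[s --> F] --> f t + 0 * d.
  by apply: cvgD; [exact: cvg_cst|apply: cvgM => //; exact: cvg_sub0].
rewrite mul0r addr0; apply: cvg_trans; apply: near_eq_cvg.
by apply: nearW => s /=; rewrite -quotientE; ring.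
Qed.

Lemma rder_sqr f d : rder f d -> rder (fun s => f s ^+ 2) (2 * f t * d).
Proof.
move=> hf.
have : ((s - t)^-1 * (f s - f t)) * (f s + f t) @[s --> F] --> d * (f t + f t).
  by apply: cvgM => //; apply: cvgD; [exact: rder_cvg hf|exact: cvg_cst].
have -> : d * (f t + f t) = 2 * f t * d by ring.
apply: cvg_trans; apply: near_eq_cvg.
by apply: nearW => s /=; ring.
Qed.

Lemma sqr_cvg0 (x a : R -> R) : (\forall s \near F, x s ^+ 2 <= a s) ->
  a @ F --> (0 : R) -> x @ F --> (0 : R).
Proof.
move=> xa a0; apply/cvgr0Pnorm_lt => e e0.
have e20 : 0 < e ^+ 2 by rewrite exprn_gt0.
move/cvgr0Pnorm_lt : a0 => /(_ _ e20) a0.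
apply: filterS2 xa a0 => s xa ha.
have : `|x s| ^+ 2 < e ^+ 2.
  by rewrite real_normK ?num_real//; apply: le_lt_trans xa _; exact: le_lt_trans (ler_norm _) ha.
by rewrite ltr_sqr ?nnegrE// ltW.
Qed.

Section Paths.
Context d (T : measurableType d).
Variable mu : {measure set T -> \bar R}.
Local Notation ip := (ip mu).

Definition l2der (f : R -> T -> R) (f1 : T -> R) : Prop :=
  [/\ \forall s \near F, sqint mu (f s), sqint mu (f t), sqint mu f1 &
   (ip ((s - t)^-1 *: (f s - f t) - f1) ((s - t)^-1 *: (f s - f t) - f1))
     @[s --> F] --> (0 : R)].

Lemma l2der_cst f : sqint mu f -> l2der (fun=> f) 0.
Proof.
move=> hf; split=> //; [exact: nearW|exact: sqint0|].
have E s : ip ((s - t)^-1 *: (f - f) - 0) ((s - t)^-1 *: (f - f) - 0) = 0.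
  have h0 := @sqint0 _ _ _ mu.
  by rewrite subrr scaler0 subrr -(scale0r (0 : T -> R)) ipZl ?mul0r//; exact: sqintZ.
by under eq_fun do rewrite E; exact: cvg_cst.
Qed.

(** The product rule as an exact identity, with remainders rf and rg of the difference quotients.
    The condition at c = 0 describes the case of coinciding times, where the inverse of 0 is 0. *)
Lemma ip_quotient (c : R) f f' f1 g g' g1 : sqint mu f -> sqint mu f' -> sqint mu f1 ->
  sqint mu g -> sqint mu g' -> sqint mu g1 -> (c = 0 -> f' = f /\ g' = g) ->
  let rf := c^-1 *: (f' - f) - f1 in let rg := c^-1 *: (g' - g) - g1 in
  c^-1 * (ip f' g' - ip f g) =
  ip f1 g + ip f g1 + (ip rf g + ip f rg + c * (ip f1 g1 + ip f1 rg + ip rf g1 + ip rf rg)).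
Proof.
move=> hf hf' hf1 hg hg' hg1 c0 rf rg.
have hdf := sqintB hf' hf; have hdg := sqintB hg' hg.
have hcf := sqintZ c^-1 hdf; have hcg := sqintZ c^-1 hdg.
have hrf : sqint mu rf := sqintB hcf hf1; have hrg : sqint mu rg := sqintB hcg hg1.
have ef : c^-1 *: (f' - f) = f1 + rf by rewrite /rf [f1 + _]addrC subrK.
have eg : c^-1 *: (g' - g) = g1 + rg by rewrite /rg [g1 + _]addrC subrK.
have -> : ip f1 g + ip f g1 + (ip rf g + ip f rg
    + c * (ip f1 g1 + ip f1 rg + ip rf g1 + ip rf rg)) =
    ip (f1 + rf) g + ip f (g1 + rg) + c * ip (f1 + rf) (g1 + rg).
  rewrite (ipDl hf1 hrf hg) (ipDr hg1 hrg hf) (ipDl hf1 hrf (sqintD hg1 hrg)).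
  rewrite (ipDr hg1 hrg hf1) (ipDr hg1 hrg hrf).
  by move: (ip f1 g) (ip f g1) (ip rf g) (ip f rg) (ip f1 g1) (ip f1 rg) (ip rf g1)
    (ip rf rg) => *; ring.
rewrite -ef -eg (ipZl _ hdf hg) (ipZr _ hdg hf) (ipZl _ hdf hcg) (ipZr _ hdg hdf).
rewrite (ipBl hf' hf hg) (ipBr hg' hg hf) (ipBl hf' hf hdg) (ipBr hg' hg hf') (ipBr hg' hg hf).
have [/c0[-> ->]|c1] := eqVneq c 0; first by rewrite !subrr !mulr0 !addr0.
move: (ip f' g') (ip f g) (ip f' g) (ip f g') => *; field.
exact: c1.
Qed.

(** In [ip_quotient] every term containing a remainder tends to 0 by Cauchy-Schwarz, and the
    second-order part carries the factor s - t. *)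
Lemma rder_ip f f1 g g1 : l2der f f1 -> l2der g g1 ->
  rder (fun s => ip (f s) (g s)) (ip f1 (g t) + ip (f t) g1).
Proof.
move=> [hf hft hf1 rf0] [hg hgt hg1 rg0].
pose rf s := (s - t)^-1 *: (f s - f t) - f1; pose rg s := (s - t)^-1 *: (g s - g t) - g1.
have hrf : \forall s \near F, sqint mu (rf s).
  by apply: filterS hf => s hs; apply: sqintB => //; apply: sqintZ; exact: sqintB.
have hrg : \forall s \near F, sqint mu (rg s).
  by apply: filterS hg => s hs; apply: sqintB => //; apply: sqintZ; exact: sqintB.
have zf h : sqint mu h -> ip (rf s) h @[s --> F] --> (0 : R).
  move=> hh; apply: (@sqr_cvg0 _ (fun s => ip (rf s) (rf s) * ip h h)).
    by apply: filterS hrf => s hs; exact: ip_cs.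
  by rewrite -(mul0r (ip h h)); apply: cvgM => //; exact: cvg_cst.
have zg h : sqint mu h -> ip h (rg s) @[s --> F] --> (0 : R).
  move=> hh; apply: (@sqr_cvg0 _ (fun s => ip h h * ip (rg s) (rg s))).
    by apply: filterS hrg => s hs; exact: ip_cs.
  by rewrite -(mulr0 (ip h h)); apply: cvgM => //; exact: cvg_cst.
have zfg : ip (rf s) (rg s) @[s --> F] --> (0 : R).
  apply: (@sqr_cvg0 _ (fun s => ip (rf s) (rf s) * ip (rg s) (rg s))).
    by apply: filterS2 hrf hrg => s hs hs'; exact: ip_cs.
  by rewrite -(mulr0 0); apply: cvgM.
pose Q s := ip f1 (g t) + ip (f t) g1 + (ip (rf s) (g t) + ip (f t) (rg s)
  + (s - t) * (ip f1 g1 + ip f1 (rg s) + ip (rf s) g1 + ip (rf s) (rg s))).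
have : Q s @[s --> F] --> ip f1 (g t) + ip (f t) g1
    + (0 + 0 + 0 * (ip f1 g1 + 0 + 0 + 0)).
  apply: cvgD; first exact: cvg_cst.
  apply: cvgD; first by apply: cvgD; [exact: zf|exact: zg].
  apply: cvgM; first exact: cvg_sub0.
  by apply: cvgD; [apply: cvgD; [apply: cvgD; [exact: cvg_cst|exact: zg]|exact: zf]|].
rewrite mul0r !addr0; apply: cvg_trans; apply: near_eq_cvg.
apply: filterS2 hf hg => s hs hs'; rewrite /Q.
apply/esym; apply: ip_quotient => //.
by move=> /eqP; rewrite subr_eq0 => /eqP ->.
Qed.

End Paths.
End DiffQuotient.

(** * Gronwall's lemma *)

Section Gronwall.
Context {R : realType}.
Implicit Types V : R -> R.

Lemma rder_interior (T t : R) V (e : R) : 0 < t < T ->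
  rder (within `[0, T] t^') t V e -> is_derive t 1 V e.
Proof.
move=> /andP[t0 tT] h.
suff H : (x^-1 *: ((V \o shift t) (x *: 1) - V t)) @[x --> 0^'] --> e.
  by split; [apply/cvg_ex; exists e|exact: cvg_lim].
apply/cvgrPdist_lt => eps eps0.
move/cvgrPdist_lt : h => /(_ _ eps0) [r /= r0 hr].
pose m := Num.min r (Num.min t (T - t)).
have m0 : 0 < m by rewrite !lt_min r0 t0/= subr_gt0.
exists m => //= x /=; rewrite sub0r normrN => xm xn.
have {}xm : [/\ `|x| < r, `|x| < t & `|x| < T - t].
  by move: xm; rewrite !lt_min => /andP[? /andP[? ?]].
have [x1 x2 x3] := xm.
have := hr (x + t); rewrite /= opprD addrCA subrr addr0 normrN => /(_ x1).
have -> : x + t - t = x by rewrite addrK.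
rewrite /GRing.scale /= mulr1; apply.
  by rewrite -subr_eq0 addrK.
rewrite in_itv/=; move: x2 x3; rewrite !ltr_norml => /andP[? ?] /andP[? ?].
by apply/andP; split; lra.
Qed.

Lemma dnbhs_cvg (T t : R) : s @[s --> within `[0, T] t^'] --> t.
Proof.
apply/cvgrPdist_lt => e e0; exists e => //= s st _ _; exact: st.
Qed.

(** The function exp(delta s) (V(s) - C/delta) has nonpositive derivative inside ]0, T[. The
    quotients at the ends serve to make it continuous on the closed interval. *)
Lemma gronwall (T delta C : R) V V' : 0 < T -> 0 < delta ->
  (forall t, 0 <= t <= T -> rder (within `[0, T] t^') t V (V' t)) ->
  (forall t, 0 <= t <= T -> V' t + delta * V t <= C) ->
  V T - C / delta <= expR (- delta * T) * (V 0 - C / delta).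
Proof.
move=> T0 d0 dV hV.
pose f s := expR (delta * s) * (V s - C / delta).
have dE (s : R) : is_derive s 1 (fun s => expR (delta * s)) (delta * expR (delta * s)).
  have : is_derive s 1 (fun s => delta * s) delta.
    have : is_derive s 1 (delta \*: (id : R -> R)) (delta *: 1) by exact: is_deriveZ.
    by rewrite /GRing.scale /= mulr1.
  move=> h; have := is_derive1_comp (is_derive_expR (delta * s)) h.
  by rewrite mulrC.
have df (s : R) : 0 < s < T ->
    is_derive s 1 f (expR (delta * s) * (V' s + delta * V s - C)).
  move=> s01; have s01' : 0 <= s <= T by move: s01 => /andP[? ?]; rewrite !ltW.
  have h1 := rder_interior s01 (dV _ s01').
  have h2 := is_deriveB h1 (is_derive_cst (C / delta) s 1).
  have := is_deriveM (dE s) h2.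
  rewrite /GRing.scale /= subr0 => h; apply: is_derive_eq.
  rewrite !fctE; have : delta * (C / delta) = C by rewrite mulrCA divff ?mulr1// gt_eqF.
  move: (C / delta) => c <-; ring.
suff : f T <= f 0.
  rewrite /f mulr0 expR0 mul1r => h.
  rewrite -(ler_pM2l (expR_gt0 (delta * T))) mulrA -expRD mulNr subrr expR0 mul1r.
  exact: h.
apply: (@ler0_derive1_nincr R f 0 T) => //; last exact: ltW.
- by move=> s; rewrite in_itv/= => /df [].
- move=> s; rewrite in_itv/= => hs; rewrite derive1E.
  have [_ ->] := df _ hs.
  rewrite pmulr_rle0 ?expR_gt0// subr_le0; apply: hV.
  by move: hs => /andP[? ?]; rewrite !ltW.
apply/subspace_continuousP => s /= hs.
have hs' : 0 <= s <= T by move: hs; rewrite in_itv.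
have cV : V @ within `[0, T] (nbhs s) --> V s.
  have : V @ within `[0, T] s^' --> V s.
    exact: (@rder_cvg _ _ _ (within_filter _ _) (@dnbhs_cvg T s) _ _ (dV s hs')).
  move=> /cvgrPdist_lt h; apply/cvgrPdist_lt => e e0.
  have [r /= r0 hr] := h _ e0; exists r => //= x xr xT.
  have [->|xs] := eqVneq x s; first by rewrite subrr normr0.
  exact: hr.
apply: cvgM; last by apply: cvgB => //; exact: cvg_cst.
apply: cvg_within_filter.
have [+ _] := dE s; move=> /derivable1_diffP/differentiable_continuous; exact.
Qed.

End Gronwall.

(** Minkowski's inequality for a semidefinite form, with a and c the squared norms and b the product
    of two vectors; nonnegativity of the quadratic in t is Cauchy-Schwarz in disguise. *)
Lemma sqrt_triangle {R : realType} (a b c : R) : 0 <= a -> 0 <= c ->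
  (forall t, 0 <= t ^+ 2 * c + 2 * t * b + a) ->
  Num.sqrt (a + 2 * b + c) <= Num.sqrt a + Num.sqrt c.
Proof.
move=> a0 c0 h.
have bac : b ^+ 2 <= a * c.
  move: c0; rewrite le_eqVlt => /predU1P[c0|c0].
    have [->|b0] := eqVneq b 0; first by rewrite expr0n -c0 mulr0.
    (* For c = 0 the polynomial is affine; if b were nonzero, it would take the value -1 at this
       point. *)
    have := h (- (a + 1) / (2 * b)).
    rewrite -c0 mulr0 add0r [X in 0 <= X](_ : _ = -1); first by lra.
    by field.
  have := h (- b / c) => /(mulr_ge0 (ltW c0)).
  rewrite [X in 0 <= X](_ : _ = a * c - b ^+ 2) ?subr_ge0//.
  by field; rewrite gt_eqF.
have bs : b <= Num.sqrt a * Num.sqrt c.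
  by rewrite -sqrtrM// (le_trans (ler_norm b))// -sqrtr_sqr ler_wsqrtr.
rewrite -(ler_sqr _ _) ?nnegrE ?addr_ge0 ?sqrtr_ge0// sqr_sqrtr.
  rewrite sqrrD !sqr_sqrtr// -mulr_natl; lra.
by have := h 1; lra.
Qed.

(** * The phase space *)

Section Phase.
Context {R : realType}.
Variable l : R.
Hypothesis l0 : 0 < l.
Local Notation M := (rect 0 pi (- l) l).
Local Notation D := (wderiv l).
Variable sigma : R.
Hypothesis hsigma : 0 < sigma < 1.
Implicit Types (f g h w u v : R * R -> R) (z : @state R).
Local Notation Hs := (hingedH2 l).
Local Notation bf := (bform l sigma).

Definition phase z : Prop := Hs z.1 /\ sqint M z.2.

Lemma Yspace_phase z : Yspace l z -> phase z.
Proof.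
by case=> h1 h2; exact: (conj (H2s_hingedH2 l0 h1) ((plate_sqint l _).1 h2)).
Qed.

Definition phase_sqnorm z : R := bf z.1 z.1 + ip M z.2 z.2.

Lemma bform_ge0 u : 0 <= bf u u.
Proof. have [h _ _ _] := bform_bounds l hsigma u; exact: h. Qed.

Lemma phase_sqnorm_ge0 z : 0 <= phase_sqnorm z.
Proof. exact: addr_ge0 (bform_ge0 _) (ip_ge0 _ _). Qed.

Lemma YnormE z : sqint M z.2 -> Ynorm l sigma z = Num.sqrt (phase_sqnorm z).
Proof.
move=> hz; rewrite /Ynorm /H2s_norm (bendingE) (plate_L2norm hz).
by rewrite (sqr_sqrtr (bform_ge0 _)) (sqr_sqrtr (ip_ge0 _ _)).
Qed.

Lemma phase_sqnorm_ZD k z z' : phase z -> phase z' ->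
  phase_sqnorm (k *: z + z') = k ^+ 2 * phase_sqnorm z
    + 2 * k * (bf z.1 z'.1 + ip M z.2 z'.2) + phase_sqnorm z'.
Proof.
move=> [h1 h2] [h1' h2'].
have e1 : bf (k *: z.1 + z'.1) (k *: z.1 + z'.1)
    = k ^+ 2 * bf z.1 z.1 + 2 * k * bf z.1 z'.1 + bf z'.1 z'.1.
  rewrite (bformZD l0 sigma k _ h1 h1') (bformC _ _ z.1 (_ + _)) (bformC _ _ z'.1 (_ + _)).
  rewrite !(bformZD l0 sigma k _ h1 h1') (bformC _ _ z'.1 z.1).
  by move: (bf z.1 z.1) (bf z.1 z'.1) (bf z'.1 z'.1) => *; ring.
have hk := sqintZ k h2.
have e2 : ip M (k *: z.2 + z'.2) (k *: z.2 + z'.2)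
    = k ^+ 2 * ip M z.2 z.2 + 2 * k * ip M z.2 z'.2 + ip M z'.2 z'.2.
  rewrite (ip_sqD hk h2') (ipZl k h2 hk) (ipZr k h2 h2) (ipZl k h2 h2').
  by move: (ip M z.2 z.2) (ip M z.2 z'.2) (ip M z'.2 z'.2) => *; ring.
rewrite /phase_sqnorm /= e1 e2.
by move: (bf z.1 z.1) (bf z.1 z'.1) (bf z'.1 z'.1) (ip M z.2 z.2) (ip M z.2 z'.2)
  (ip M z'.2 z'.2) => *; ring.
Qed.

Lemma phase_ZD k z z' : phase z -> phase z' -> phase (k *: z + z').
Proof.
move=> [h1 h2] [h1' h2'].
exact: (conj (hingedH2_ZD l0 k h1 h1') (sqintD (sqintZ k h2) h2')).
Qed.

Lemma phase_B z z' : phase z -> phase z' -> phase (z - z').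
Proof. by move=> hz hz'; rewrite addrC -scaleN1r; exact: phase_ZD. Qed.

Lemma Ynorm_triangle z z' : phase z -> phase z' ->
  Ynorm l sigma (z + z') <= Ynorm l sigma z + Ynorm l sigma z'.
Proof.
move=> hz hz'.
have hzz' : phase (z + z') by rewrite -[z]scale1r; exact: phase_ZD.
rewrite (YnormE hzz'.2) (YnormE hz.2) (YnormE hz'.2) [leRHS]addrC.
have E := phase_sqnorm_ZD 1 hz hz'; rewrite scale1r expr1n mul1r mulr1 in E.
rewrite E [_ + phase_sqnorm z']addrC (addrC (phase_sqnorm z)) addrA.
apply: sqrt_triangle (phase_sqnorm_ge0 _) (phase_sqnorm_ge0 _) _ => t.
by rewrite -phase_sqnorm_ZD//; exact: phase_sqnorm_ge0.
Qed.

Lemma YnormBC z z' : phase z -> phase z' ->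
  Ynorm l sigma (z - z') = Ynorm l sigma (z' - z).
Proof.
move=> hz hz'.
have E x y : x - y = (-1) *: y + x :> @state R by rewrite scaleN1r addrC.
rewrite (YnormE (phase_B hz hz').2) (YnormE (phase_B hz' hz).2).
rewrite (E z z') (E z' z) (phase_sqnorm_ZD _ hz hz') (phase_sqnorm_ZD _ hz' hz).
rewrite (bformC _ _ z'.1 z.1) (ipC M z'.2 z.2).
by congr Num.sqrt; move: (bf _ _ + ip _ _ _) (phase_sqnorm z) (phase_sqnorm z') => x y w; ring.
Qed.

End Phase.

(** * Bounded linear maps along a differentiable path *)

Section Path.
Context {R : realType}.
Variable l : R.
Hypothesis l0 : 0 < l.
Local Notation M := (rect 0 pi (- l) l).
Local Notation D := (wderiv l).
Variable sigma : R.
Hypothesis hsigma : 0 < sigma < 1.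
Implicit Types (f g h w u v : R * R -> R) (z : @state R).
Local Notation Hs := (hingedH2 l).
Local Notation bf := (bform l sigma).
Local Notation phase := (phase l).
Local Notation phase_sqnorm := (phase_sqnorm l sigma).

Let hD i j u : sqint M (D i j u). Proof. exact: wderiv_sqint. Qed.

Lemma phase_sqnorm_ge1 z : bf z.1 z.1 <= phase_sqnorm z.
Proof. by rewrite lerDl; exact: ip_ge0. Qed.

Lemma phase_sqnorm_ge2 z : ip M z.2 z.2 <= phase_sqnorm z.
Proof. by rewrite lerDr; exact: bform_ge0. Qed.

(** Linear maps bounded from the energy space to L^2; linearity is weak because weak derivatives are
    chosen representatives. Such maps carry derivatives in Y to derivatives in L^2. *)
Definition lin_map (L : (R * R -> R) -> R * R -> R) : Prop :=
  [/\ forall u, Hs u -> sqint M (L u),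
      forall k u v h, Hs u -> Hs v -> sqint M h ->
        ip M (L (k *: u + v)) h = k * ip M (L u) h + ip M (L v) h &
      exists C, forall u, Hs u -> ip M (L u) (L u) <= C * bf u u].

Lemma hingedH2_0 u : Hs u -> Hs 0.
Proof.
move=> hu; have -> : (0 : R * R -> R) = (-1) *: u + u by rewrite scaleN1r addNr.
exact: hingedH2_ZD.
Qed.

Lemma hingedH2_comb (c : R) u v w : Hs u -> Hs v -> Hs w -> Hs (c *: (u - v) - w).
Proof.
move=> hu hv hw.
have e : c *: (u - v) - w = (-1) *: w + (c *: ((-1) *: v + u) + 0).
  by rewrite !scaleN1r addr0 addrC [- v + u]addrC.
rewrite e; apply: (hingedH2_ZD l0 _ hw).
exact: (hingedH2_ZD l0 _ (hingedH2_ZD l0 _ hv hu) (hingedH2_0 hu)).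
Qed.

Lemma lin_comb L (c : R) u v w h : lin_map L -> Hs u -> Hs v -> Hs w -> sqint M h ->
  ip M (L (c *: (u - v) - w)) h = ip M (c *: (L u - L v) - L w) h.
Proof.
move=> [hL linL _] hu hv hw hh.
have L0 : ip M (L 0) h = 0.
  have -> : (0 : R * R -> R) = (-1) *: u + u by rewrite scaleN1r addNr.
  by rewrite (linL _ _ _ _ hu hu hh) mulN1r addNr.
have e : c *: (u - v) - w = (-1) *: w + (c *: ((-1) *: v + u) + 0).
  by rewrite !scaleN1r addr0 addrC [- v + u]addrC.
have hvu := hingedH2_ZD l0 (-1) hv hu.
rewrite e (linL _ _ _ _ hw (hingedH2_ZD l0 c hvu (hingedH2_0 hu)) hh).
rewrite (linL _ _ _ _ hvu (hingedH2_0 hu) hh) (linL _ _ _ _ hv hu hh) L0.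
have k1 := sqintB (hL _ hu) (hL _ hv).
rewrite (ipBl (sqintZ c k1) (hL _ hw) hh) (ipZl c k1 hh) (ipBl (hL _ hu) (hL _ hv) hh).
by move: (ip M _ h) (ip M _ h) (ip M _ h) => *; ring.
Qed.

Lemma lin_map_id : lin_map id.
Proof.
split=> [u /hingedH2_sqint //|k u v h /hingedH2_sqint hu /hingedH2_sqint hv hh|].
  by rewrite (ipDl (sqintZ k hu) hv hh) (ipZl k hu hh).
exists (pi ^+ 2 * (pi ^+ 2 / (1 - sigma))) => u hu.
rewrite -mulrA.
exact: (le_trans (poincare hu) (ler_wpM2l (sqr_ge0 _) (xform_le l0 hsigma hu))).
Qed.

Lemma lin_map_D i j C : (i + j <= 2)%N ->
  (forall u, Hs u -> ip M (D i j u) (D i j u) <= C * bf u u) -> lin_map (D i j).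
Proof.
move=> ij hC; split=> [u _|k u v h [su _] [sv _] hh|]; [exact: hD| |by exists C].
rewrite (wderivZD l0 k su sv ij hh) (ipDl (sqintZ k (hD i j u)) (hD i j v) hh).
by rewrite (ipZl k (hD i j u) hh).
Qed.

Lemma lin_map_D10 : lin_map (D 1 0).
Proof. by apply: (lin_map_D (C := pi ^+ 2 / (1 - sigma))) => // u; exact: xform_le. Qed.

Lemma lin_map_D20 : lin_map (D 2 0).
Proof.
apply: (lin_map_D (C := (1 - sigma)^-1)) => // u _.
by have [_ h _ _] := bform_bounds l hsigma u; exact: h.
Qed.

Lemma lin_map_D02 : lin_map (D 0 2).
Proof.
apply: (lin_map_D (C := (1 - sigma)^-1)) => // u _.
by have [_ _ h _] := bform_bounds l hsigma u; exact: h.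
Qed.

Lemma lin_map_D11 : lin_map (D 1 1).
Proof.
apply: (lin_map_D (C := (1 - sigma)^-1)) => // u _.
by have [_ _ _ h] := bform_bounds l hsigma u; exact: h.
Qed.

Section At.
Variables (F : set_system R) (t : R) (y : R -> @state R) (y1 : @state R).
Context {FF : Filter F}.
Hypothesis yF : \forall s \near F, phase (y s).
Hypotheses (yt : phase (y t)) (hy1 : phase y1).
Hypothesis dy : Ynorm l sigma ((s - t)^-1 *: (y s - y t) - y1) @[s --> F] --> (0 : R).

Let r s := (s - t)^-1 *: (y s - y t) - y1.

Lemma remainder_phase s : phase (y s) -> phase (r s).
Proof.
move=> [h1 h2].
exact: (conj (hingedH2_comb (s - t)^-1 h1 yt.1 hy1.1)
  (sqintB (sqintZ (s - t)^-1 (sqintB h2 yt.2)) hy1.2)).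
Qed.

Lemma remainder_sqnorm : phase_sqnorm (r s) @[s --> F] --> (0 : R).
Proof.
have : Ynorm l sigma (r s) * Ynorm l sigma (r s) @[s --> F] --> (0 : R) * 0.
  exact: cvgM.
rewrite mulr0; apply: cvg_trans; apply: near_eq_cvg.
apply: filterS yF => s /remainder_phase hs.
by rewrite (YnormE hsigma hs.2) -expr2 sqr_sqrtr//; exact: phase_sqnorm_ge0.
Qed.

Lemma bound_cvg0 (C : R) (a : R -> R) :
  (\forall s \near F, 0 <= a s <= C * phase_sqnorm (r s)) -> a @ F --> (0 : R).
Proof.
move=> h.
have cC : C * phase_sqnorm (r s) @[s --> F] --> (0 : R).
  by rewrite -(mulr0 C); apply: cvgM; [exact: cvg_cst|exact: remainder_sqnorm].
apply: (@squeeze_cvgr _ F FF _ (fun=> 0) (fun s => C * phase_sqnorm (r s)) a h 0) => //.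
exact: cvg_cst.
Qed.

Lemma l2der_velocity : l2der F t M (fun s => (y s).2) y1.2.
Proof.
split; [by apply: filterS yF => s []|exact: yt.2|exact: hy1.2|].
apply: (bound_cvg0 (C := 1)); apply: filterS yF => s hs.
rewrite mul1r ip_ge0/=; exact: (phase_sqnorm_ge2 (r s)).
Qed.

Lemma l2der_lin L : lin_map L -> l2der F t M (fun s => L (y s).1) (L y1.1).
Proof.
move=> HL; have [hL linL [C hC]] := HL.
split; [by apply: filterS yF => s [/hL]|exact: hL yt.1|exact: hL hy1.1|].
(* The constant in [lin_map] has no prescribed sign. *)
apply: (bound_cvg0 (C := Num.max 0 C)); apply: filterS yF => s hs.
have hr := remainder_phase hs.
have h1 := sqintB (sqintZ (s - t)^-1 (sqintB (hL _ hs.1) (hL _ yt.1))) (hL _ hy1.1).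
have h2 := hL _ hr.1.
(* Linearity being weak, the remainder of L y is replaced by L of the remainder in one factor of the
   product at a time. *)
rewrite ip_ge0/= -(lin_comb _ HL hs.1 yt.1 hy1.1 h1) ipC.
rewrite -(lin_comb _ HL hs.1 yt.1 hy1.1 h2).
apply: le_trans (hC _ hr.1) _.
apply: le_trans (ler_wpM2r (bform_ge0 l hsigma _) _) (ler_wpM2l _ (phase_sqnorm_ge1 (r s))).
  by rewrite le_max lexx orbT.
by rewrite le_max lexx.
Qed.

End At.
End Path.

Lemma rder_eq {R : realType} (F : set_system R) (t : R) (f : R -> R) (a b : R) :
  rder F t f a -> a = b -> rder F t f b.
Proof. by move=> h <-. Qed.

(* To be read with K = |v|^2, E1, ..., E5 the terms of the bending form,
   q = |u_x|^2, G = (g, u) and c = (u, v). *)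
Lemma rder_energy {R : realType} (F : set_system R) (t : R) {FF : Filter F}
    (Ft : s @[s --> F] --> t) (P S eps s : R)
    (K E1 E2 E3 E4 E5 q G c : R -> R) (dK d1 d2 d3 d4 d5 dq dG dc : R) :
  rder F t K dK -> rder F t E1 d1 -> rder F t E2 d2 -> rder F t E3 d3 ->
  rder F t E4 d4 -> rder F t E5 d5 -> rder F t q dq -> rder F t G dG -> rder F t c dc ->
  rder F t (fun r => K r / 2 + (E1 r + E2 r + s * (E3 r + E4 r) + 2 * (1 - s) * E5 r) / 2
    - P / 2 * q r + S / 4 * q r ^+ 2 - G r + eps * c r)
  (dK / 2 + (d1 + d2 + s * (d3 + d4) + 2 * (1 - s) * d5) / 2
    - P / 2 * dq + S / 4 * (2 * q t * dq) - dG + eps * dc).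
Proof.
move=> hK h1 h2 h3 h4 h5 hq hG hc.
pose proof rderD (rderD (rderD h1 h2) (rderZ (k := s) (rderD h3 h4)))
  (rderZ (k := 2 * (1 - s)) h5) as hE.
pose proof rderD (rderD (rderD (rderD (rderD (rderZ (k := 2^-1) hK) (rderZ (k := 2^-1) hE))
  (rderZ (k := - (P / 2)) hq)) (rderZ (k := S / 4) (rder_sqr Ft hq)))
  (rderZ (k := -1) hG)) (rderZ (k := eps) hc) as h.
have E : (fun r => K r / 2 + (E1 r + E2 r + s * (E3 r + E4 r) + 2 * (1 - s) * E5 r) / 2
    - P / 2 * q r + S / 4 * q r ^+ 2 - G r + eps * c r) =
  2^-1 *: K + 2^-1 *: (E1 + E2 + s *: (E3 + E4) + (2 * (1 - s)) *: E5)
    + - (P / 2) *: q + (S / 4) *: (fun r => q r ^+ 2) + (-1) *: G + eps *: c.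
  by apply/funext => r; rewrite !fctE /GRing.scale /=; ring.
rewrite E; apply: (rder_eq h); ring.
Qed.

(** * The perturbed energy *)

Section Energy.
Context {R : realType}.
Variable l : R.
Hypothesis l0 : 0 < l.
Local Notation M := (rect 0 pi (- l) l).
Local Notation D := (wderiv l).
Variable sigma : R.
Hypothesis hsigma : 0 < sigma < 1.
Implicit Types (f h w u v : R * R -> R) (z : @state R).
Local Notation Hs := (hingedH2 l).
Local Notation bf := (bform l sigma).
Local Notation phase := (phase l).
Local Notation phase_sqnorm := (phase_sqnorm l sigma).
Variables (k S P alpha : R) (g : R * R -> R).
Hypothesis hg : sqint M g.

(* The physical energy is the part without [eps]; the cross term [eps (u, v)] is
   what makes its derivative control the whole of the energy. *)
Definition energy (eps : R) z : R :=
  ip M z.2 z.2 / 2 + bf z.1 z.1 / 2 - P / 2 * ip M (D 1 0 z.1) (D 1 0 z.1)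
  + S / 4 * ip M (D 1 0 z.1) (D 1 0 z.1) ^+ 2 - ip M g z.1 + eps * ip M z.1 z.2.

(* The derivative of [energy] along a path with velocity [(z.2, w)]. *)
Definition denergy (eps : R) z w : R :=
  ip M w z.2 + bf z.1 z.2 - P * ip M (D 1 0 z.1) (D 1 0 z.2)
  + S * ip M (D 1 0 z.1) (D 1 0 z.1) * ip M (D 1 0 z.1) (D 1 0 z.2)
  - ip M g z.2 + eps * (ip M z.2 z.2 + ip M w z.1).

Lemma denergyE (eps P' S' s kk b11 b12 b21 b22 b33 c11 c12 c21 c22 c33 x x' q wu wv vw uw z0
    gv : R) :
  vw = wv -> uw = wu -> x' = x -> z0 = 0 ->
  c11 = b11 -> c12 = b21 -> c21 = b12 -> c22 = b22 -> c33 = b33 ->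
  (wv + vw) / 2 + ((c11 + b11) + (c22 + b22) + s * ((c12 + b12) + (c21 + b21))
    + 2 * (1 - s) * (c33 + b33)) / 2 - P' / 2 * (x' + x) + S' / 4 * (2 * q * (x' + x))
    - (z0 + gv) + eps * (kk + uw) =
  wv + (b11 + b22 + s * (b12 + b21) + 2 * (1 - s) * b33) - P' * x + S' * q * x - gv
   + eps * (kk + wu).
(* The product rule produces each pairing in both orders; symmetry merges them, and z0 is the
   contribution of the constant path g. *)
Proof.
move=> -> -> -> -> -> -> -> -> ->.
lra.
Qed.

Section At.
Variables (F : set_system R) (t : R) (y : R -> @state R) (y1 : @state R).
Context {FF : Filter F}.
Hypothesis Ft : s @[s --> F] --> t.
Hypothesis yF : \forall s \near F, phase (y s).
Hypotheses (yt : phase (y t)) (hy1 : phase y1).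
Hypothesis y1E : y1.1 = (y t).2.
Hypothesis dy : Ynorm l sigma ((s - t)^-1 *: (y s - y t) - y1) @[s --> F] --> (0 : R).

Lemma energy_rder eps : rder F t (fun s => energy eps (y s)) (denergy eps (y t) y1.2).
Proof.
pose proof (l2der_velocity l0 hsigma yF yt hy1 dy) as lv.
have lL L : lin_map l sigma L -> l2der F t M (fun s => L (y s).1) (L (y t).2).
  by move=> hL; rewrite -y1E; exact: (l2der_lin l0 hsigma yF yt hy1 dy hL).
have lu := lL id (lin_map_id l0 hsigma).
have l20 := lL _ (lin_map_D20 l0 hsigma); have l02 := lL _ (lin_map_D02 l0 hsigma).
have l11 := lL _ (lin_map_D11 l0 hsigma); have l10 := lL _ (lin_map_D10 l0 hsigma).
pose proof (@l2der_cst _ F t _ _ _ M _ hg) as lg.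
pose proof (rder_energy Ft (P := P) (S := S) (eps := eps) (s := sigma)
  (rder_ip Ft lv lv) (rder_ip Ft l20 l20)
  (rder_ip Ft l02 l02) (rder_ip Ft l20 l02) (rder_ip Ft l02 l20) (rder_ip Ft l11 l11)
  (rder_ip Ft l10 l10) (rder_ip Ft lg lu) (rder_ip Ft lu lv)) as h.
have z0 u : sqint M u -> ip M 0 u = 0.
  by move=> hu; rewrite -(scale0r u) (ipZl 0 hu hu) mul0r.
move: h => /= h; move: yt h; case: (y t) => u v /= hz h.
exact: (rder_eq h (denergyE _ _ _ _ _ _ _ (ipC M v y1.2) (ipC M u y1.2)
  (ipC M (D 1 0 v) (D 1 0 u)) (z0 _ (hingedH2_sqint hz.1)) (ipC M (D 2 0 v) (D 2 0 u))
  (ipC M (D 2 0 v) (D 0 2 u)) (ipC M (D 0 2 v) (D 2 0 u)) (ipC M (D 0 2 v) (D 0 2 u))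
  (ipC M (D 1 1 v) (D 1 1 u))))%N.
Qed.

End At.

End Energy.

Section AbstractEquation.
Context d (T : measurableType d) (R : realType).
Variable mu : {measure set T -> \bar R}.
Local Notation ip := (ip mu).

Lemma equation_ip (k Q alpha : R) (w v b x g y h : T -> R) :
  sqint mu w -> sqint mu v -> sqint mu b -> sqint mu x -> sqint mu g -> sqint mu y ->
  sqint mu h ->
  (\forall p \ae mu, w p + k * v p + b p + Q * x p = g p + alpha * y p) ->
  ip w h = - k * ip v h - ip b h - Q * ip x h + ip g h + alpha * ip y h.
Proof.
move=> hw hv hb hx hg hy hh E.
have kv := sqintZ (- k) hv; have ka := sqintZ alpha hy; have kx := sqintZ (- Q) hx.
have s1 := sqintB kv hb; have s2 := sqintD s1 kx; have s3 := sqintD s2 hg.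
have s4 := sqintD s3 ka.
have -> : ip w h = ip ((- k) *: v - b + (- Q) *: x + g + alpha *: y) h.
  apply: (ip_ae hw s4 hh); apply: filterS E => p E.
  rewrite !fctE /GRing.scale/=; lra.
rewrite (ipDl s3 ka hh) (ipDl s2 hg hh) (ipDl s1 kx hh) (ipBl kv hb hh).
rewrite (ipZl _ hv hh) (ipZl _ hx hh) (ipZl _ hy hh).
by rewrite [- Q * _]mulNr.
Qed.

(** Young's inequality with weight (A + 1)/(2 delta); the 1 keeps the weight positive when A = 0. *)
Lemma young_le (A delta : R) : 0 <= A -> 0 < delta -> exists2 C, 0 <= C &
  forall f g, sqint mu f -> sqint mu g -> A * `|ip f g| <= C * ip f f + delta * ip g g.
Proof.
move=> A0 d0; have t0 : 0 < (A + 1) / (2 * delta).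
  by rewrite divr_gt0 ?mulr_gt0// ltr_wpDl.
exists (A * ((A + 1) / (2 * delta) / 2)); first by rewrite mulr_ge0// divr_ge0// ltW.
move=> f g hf hg.
have h := ler_wpM2l A0 (ip_young t0 hf hg).
have : A * (ip g g / (2 * ((A + 1) / (2 * delta)))) <= delta * ip g g.
  have -> : A * (ip g g / (2 * ((A + 1) / (2 * delta)))) = A / (A + 1) * (delta * ip g g).
    by field; rewrite !gt_eqF//= ltr_wpDl.
  rewrite ler_piMl ?mulr_ge0 ?ip_ge0 ?(ltW d0)//.
  by rewrite ler_pdivrMr ?mul1r ?ltr_wpDl// lerDl.
by lra.
Qed.

End AbstractEquation.

(** * Real inequalities behind the energy estimates *)

Section RealInequalities.
Context {R : realType}.

Lemma quadratic_le (a b q : R) : 0 < a -> - a * q ^+ 2 + b * q <= b ^+ 2 / (4 * a).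
Proof.
move=> a0; rewrite -subr_ge0.
have -> : b ^+ 2 / (4 * a) - (- a * q ^+ 2 + b * q) = (2 * a * q - b) ^+ 2 / (4 * a).
  by field; rewrite gt_eqF.
by rewrite divr_ge0 ?sqr_ge0// mulr_ge0// ltW.
Qed.

(** Read K = |v|^2, E = a(u, u), B = a(u, v), q = |u_x|^2, x = (u_x, v_x), n = |u|^2, Y = |u_y|^2, c
    = (u, v), G = (g, u), gv = (g, v); wv and wu pair u_tt with v and u, ae1 and ae2 pair alpha u_y
    with them, and b is the Poincare constant. The terms in g, B and x cancel. What is left in q is
    at most a concave quadratic, whose maximum is the right-hand side. *)
Lemma dissipation_le (k S P ae1 ae2 A1 A2 A3 A4 K E q n Y G c wv wu B x gv b : R) :
  0 < k -> 0 < S -> 0 <= K -> n <= b * q -> 0 <= q -> 0 <= A2 -> 0 <= A4 ->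
  ae1 <= A1 * Y + k / 8 * K ->
  3 * k ^+ 2 / 16 * `|c| <= A2 * n + k / 8 * K ->
  k / 4 * ae2 <= A3 * Y + n ->
  (A1 + A3) * Y <= k / 8 * E + A4 * n ->
  wv = - k * K - B - (P - S * q) * - x + gv + ae1 ->
  wu = - k * c - E - (P - S * q) * - q + G + ae2 ->
  wv + B - P * x + S * q * x - gv + k / 4 * (K + wu)
    + k / 4 * (K / 2 + E / 2 - P / 2 * q + S / 4 * q ^+ 2 - G + k / 4 * c)
  <= ((A2 + A4 + 1) * b + k * `|P| / 8) ^+ 2 / (4 * (3 * k * S / 16)).
Proof.
move=> k0 S0 K0 nq q0 A20 A40 h1 h2 h3 h4 -> ->.
have kS : 0 < 3 * k * S / 16 by rewrite divr_gt0 ?mulr_gt0.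
apply: le_trans (quadratic_le _ q kS).
have c1 : - (3 * k ^+ 2 / 16 * c) <= 3 * k ^+ 2 / 16 * `|c|.
  have k2 : 0 <= 3 * k ^+ 2 / 16 by have := sqr_ge0 k; lra.
  by have := ler_wpM2l k2 (ler_norm (- c)); rewrite normrN mulrN.
have n1 : (A2 + A4 + 1) * n <= (A2 + A4 + 1) * (b * q) by rewrite ler_wpM2l// addr_ge0// addr_ge0.
have p1 : k / 8 * (P * q) <= k / 8 * (`|P| * q).
  by rewrite ler_wpM2l ?divr_ge0 ?(ltW k0)// ler_wpM2r// ler_norm.
have kK : 0 <= k * K by rewrite mulr_ge0// ltW.
lra.
Qed.

(** All indefinite terms are at most linear in q apart from a quarter of K, so the quartic energy S
    q^2 / 4 bounds their sum from below. *)
Lemma energy_lower (k S P K E q n G c N b gg A2 : R) :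
  0 < k -> 0 < S -> 0 <= q -> n <= b * q -> 0 <= A2 -> 0 <= E ->
  `|G| <= gg / 2 + n / 2 -> k / 4 * `|c| <= A2 * n + K / 4 -> N = E + K ->
  N / 4 - gg / 2 - ((A2 + 2^-1) * b + `|P| / 2) ^+ 2 / S
    <= K / 2 + E / 2 - P / 2 * q + S / 4 * q ^+ 2 - G + k / 4 * c.
Proof.
move=> k0 S0 q0 nq A20 E0 hG hc ->.
have S4 : 0 < S / 4 by rewrite divr_gt0.
have := quadratic_le ((A2 + 2^-1) * b + `|P| / 2) q S4.
have -> : 4 * (S / 4) = S by field.
have n1 : (A2 + 2^-1) * n <= (A2 + 2^-1) * (b * q) by rewrite ler_wpM2l// addr_ge0// invr_ge0.
have p1 : P * q <= `|P| * q by rewrite ler_wpM2r// ler_norm.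
have c1 : - (k / 4 * c) <= k / 4 * `|c|.
  have k2 : 0 <= k / 4 by lra.
  by have := ler_wpM2l k2 (ler_norm (- c)); rewrite normrN mulrN.
have G1 := le_trans (ler_norm _) hG.
lra.
Qed.

(** The power 2 comes from q^2, since q is at most a multiple of N; every lower power of N is
    bounded by (1 + N)^2. *)
Lemma energy_upper (k S P K E q n G c N b b' gg A2 : R) :
  0 < k -> 0 < S -> 0 <= q -> n <= b * q -> q <= b' * E -> 0 <= b -> 0 <= b' ->
  0 <= A2 -> 0 <= E -> 0 <= K -> 0 <= gg ->
  `|G| <= gg / 2 + n / 2 -> k / 4 * `|c| <= A2 * n + K / 4 -> N = E + K ->
  K / 2 + E / 2 - P / 2 * q + S / 4 * q ^+ 2 - G + k / 4 * c <=
  (1 + `|P| / 2 * b' + S / 4 * b' ^+ 2 + gg / 2 + (A2 + 2^-1) * b * b') * (1 + N) ^+ 2.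
Proof.
move=> k0 S0 q0 nq qE b0 b'0 A20 E0 K0 gg0 hG hc NE.
have N0 : 0 <= N by rewrite NE addr_ge0.
have qN : q <= b' * N by rewrite (le_trans qE)// ler_wpM2l// NE lerDl.
have nN : n <= b * b' * N by rewrite (le_trans nq)// -mulrA ler_wpM2l.
have q2 : q ^+ 2 <= b' ^+ 2 * N ^+ 2 by rewrite -exprMn ler_sqr ?nnegrE ?mulr_ge0.
have N1 : N <= (1 + N) ^+ 2 by have := sqr_ge0 N; lra.
have N2 : N ^+ 2 <= (1 + N) ^+ 2 by lra.
have N3 : 1 <= (1 + N) ^+ 2 by have := sqr_ge0 N; lra.
have i1 : - (P / 2 * q) <= `|P| / 2 * b' * (1 + N) ^+ 2.
  have h : - (P * q) <= `|P| * q.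
    by rewrite -mulNr ler_wpM2r// -(normrN P) ler_norm.
  have h' : `|P| * q <= `|P| * (b' * (1 + N) ^+ 2).
    by rewrite ler_wpM2l// (le_trans qN)// ler_wpM2l.
  lra.
have i2 : S / 4 * q ^+ 2 <= S / 4 * b' ^+ 2 * (1 + N) ^+ 2.
  have S4 : 0 <= S / 4 by lra.
  by rewrite -[leRHS]mulrA; apply: ler_wpM2l => //; rewrite (le_trans q2)// ler_wpM2l ?sqr_ge0.
have i3 : (A2 + 2^-1) * n <= (A2 + 2^-1) * b * b' * (1 + N) ^+ 2.
  have A2' : 0 <= A2 + 2^-1 by lra.
  rewrite -mulrA -[leRHS]mulrA; apply: ler_wpM2l => //; rewrite (le_trans nN)// mulrA.
  by rewrite ler_wpM2l ?mulr_ge0.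
have i4 : gg / 2 <= gg / 2 * (1 + N) ^+ 2 by rewrite ler_peMr// divr_ge0.
have c1 : k / 4 * c <= k / 4 * `|c| by rewrite ler_wpM2l ?divr_ge0 ?(ltW k0)// ler_norm.
have G1 : - G <= gg / 2 + n / 2 by rewrite (le_trans _ hG)// -(normrN G) ler_norm.
have i5 : K / 2 + E / 2 + K / 4 <= (1 + N) ^+ 2 by lra.
lra.
Qed.

End RealInequalities.

Lemma le_mul_norm {R : realDomainType} (x y : R) : x * y <= `|x| * `|y|.
Proof. by rewrite -normrM ler_norm. Qed.

(** * Dissipation and the absorbing ball *)

Section Dissipation.
Context {R : realType}.
Variable l : R.
Hypothesis l0 : 0 < l.
Local Notation M := (rect 0 pi (- l) l).
Local Notation D := (wderiv l).
Variable sigma : R.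
Hypothesis hsigma : 0 < sigma < 1.
Implicit Types (f h w u v : R * R -> R) (z : @state R).
Local Notation Hs := (hingedH2 l).
Local Notation bf := (bform l sigma).
Local Notation phase := (phase l).
Local Notation phase_sqnorm := (phase_sqnorm l sigma).
Variables (k S P alpha : R) (g : R * R -> R).
Hypotheses (hk : 0 < k) (hS : 0 < S) (hg : sqint M g).
Local Notation energy := (energy l sigma S P g).
Local Notation denergy := (denergy l sigma S P g).

Let hD i j u : sqint M (D i j u). Proof. exact: wderiv_sqint. Qed.

Lemma domA_hingedH2 u : domA l sigma u -> Hs u.
Proof. by case=> _ hu _ _ _; exact: (H2s_hingedH2 l0 hu). Qed.

Lemma stretchE u :
  \int[plate_measure l]_p (D 1 0 u p) ^+ 2 = ip M (D 1 0 u) (D 1 0 u).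
Proof.
by apply: etrans (plate_Rintegral _ _) _; apply: eq_Rintegral => p _; exact: expr2.
Qed.

(** It will be used with h = v and h = u. That v is admissible is a property of strong solutions:
    their velocity lies in [H2s]. *)
Lemma equation_weak u v w h : domA l sigma u -> Hs v -> sqint M w ->
  plate_equation l k S P alpha g u v w -> Hs h ->
  ip M w h = - k * ip M v h - bf u h
    - (P - S * ip M (D 1 0 u) (D 1 0 u)) * - ip M (D 1 0 u) (D 1 0 h)
    + ip M g h + alpha * ip M (D 0 1 u) h.
Proof.
move=> du hv hw /plate_ae E hh.
have hb : sqint M (bilaplacian l u).
  by apply: sqintD (hD 0 4 u); apply: sqintD (hD 4 0 u) (sqintZ 2 (hD 2 2 u)).
rewrite -(green l0 du hh) -(xform_ibp l0 (domA_hingedH2 du) hh).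
move: E; rewrite (stretchE u) => E.
exact: (equation_ip hw (hingedH2_sqint hv) hb (hD 2 0 u) hg (hD 0 1 u) (hingedH2_sqint hh) E).
Qed.

Lemma dissipation : exists2 C, 0 <= C & forall u v w, domA l sigma u -> Hs v -> sqint M w ->
  plate_equation l k S P alpha g u v w ->
  denergy (k / 4) (u, v) w + k / 4 * energy (k / 4) (u, v) <= C.
Proof.
have k8 : 0 < k / 8 by rewrite divr_gt0.
have [A1 A10 Y1] := young_le M (normr_ge0 alpha) k8.
have k2 : 0 <= 3 * k ^+ 2 / 16 by have := sqr_ge0 k; lra.
have [A2 A20 Y2] := young_le M k2 k8.
have k4 : 0 <= k / 4 * `|alpha| by rewrite mulr_ge0// divr_ge0// ltW.
have k4' : 0 < k / 4 by rewrite divr_gt0.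
have [A3 A30 Y3] := young_le M k4 ltr01.
have A13 : 0 < A1 + A3 + 1 by rewrite ltr_wpDl// addr_ge0.
(* [A1] and [A3] are the multiples of |u_y|^2 spent on alpha (u_y, v) and (k/4) alpha (u_y, u); with
   this eta they cost at most (k/8) a(u, u). The 1 avoids a division by 0. *)
have eta0 : 0 < k / 8 / (A1 + A3 + 1) by rewrite divr_gt0.
have [A C0 Y4] := ydiff_le l0 hsigma eta0.
(* The constant is left open and read off from [dissipation_le]; its sign is checked afterwards. *)
eexists; last first => [u v w du hv hw eq|].
  have hu := domA_hingedH2 du.
  have sv := hingedH2_sqint hv; have su := hingedH2_sqint hu.
  have eqv := equation_weak du hv hw eq hv; have equ := equation_weak du hv hw eq hu.
  rewrite (ipC M v u) in equ.
  have h1 : alpha * ip M (D 0 1 u) v <= A1 * ip M (D 0 1 u) (D 0 1 u) + k / 8 * ip M v v.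
    exact: le_trans (le_mul_norm _ _) (Y1 _ _ (hD 0 1 u) sv).
  have h2 := Y2 _ _ su sv.
  have h3 : k / 4 * (alpha * ip M (D 0 1 u) u)
      <= A3 * ip M (D 0 1 u) (D 0 1 u) + ip M u u.
    have := le_trans _ (Y3 _ _ (hD 0 1 u) su); rewrite mul1r; apply.
    by rewrite -[leRHS]mulrA; exact: (ler_wpM2l (ltW k4') (le_mul_norm _ _)).
  have h4 : (A1 + A3) * ip M (D 0 1 u) (D 0 1 u)
      <= k / 8 * bf u u + (A1 + A3) * A * ip M u u.
    have A130 : 0 <= A1 + A3 by rewrite addr_ge0.
    apply: le_trans (ler_wpM2l A130 (Y4 u hu)) _.
    rewrite mulrDr [X in _ + X <= _]mulrA lerD2r mulrA.
    apply: ler_wpM2r; first exact: bform_ge0.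
    rewrite mulrCA ler_piMr ?(ltW k8)//.
    by rewrite ler_pdivrMr// mul1r lerDl.
  exact: (dissipation_le hk hS (ip_ge0 M v) (poincare hu) (ip_ge0 M (D 1 0 u)) A20
    (mulr_ge0 (addr_ge0 A10 A30) C0) h1 h2 h3 h4 eqv equ).
by rewrite divr_ge0 ?sqr_ge0// !mulr_ge0// ?invr_ge0// ltW.
Qed.

Lemma energy_bounds : exists a b, [/\ 0 <= a, 0 <= b & forall z, phase z ->
  phase_sqnorm z / 4 - b <= energy (k / 4) z <= a * (1 + phase_sqnorm z) ^+ 2].
Proof.
have k40 : 0 <= k / 4 by rewrite divr_ge0// ltW.
have i4 : (0 : R) < 4^-1 by rewrite invr_gt0.
have [A2 A20 Y2] := young_le M k40 i4.
have p2 := sqr_ge0 (pi : R).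
have [s0 s1] := andP hsigma.
have b'0 : 0 <= pi ^+ 2 / (1 - sigma) by rewrite divr_ge0// subr_ge0 ltW.
have gg0 := ip_ge0 M g.
pose b' : R := pi ^+ 2 / (1 - sigma).
exists (1 + `|P| / 2 * b' + S / 4 * b' ^+ 2 + ip M g g / 2 + (A2 + 2^-1) * pi ^+ 2 * b').
exists (ip M g g / 2 + ((A2 + 2^-1) * pi ^+ 2 + `|P| / 2) ^+ 2 / S); split.
- have t1 : 0 <= `|P| / 2 * b' by rewrite mulr_ge0// divr_ge0.
  have t2 : 0 <= S / 4 * b' ^+ 2 by rewrite mulr_ge0 ?sqr_ge0// divr_ge0// ltW.
  have t3 : 0 <= (A2 + 2^-1) * pi ^+ 2 * b'.
    by apply: mulr_ge0 => //; apply: mulr_ge0 => //; move: A20; lra.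
  by move: gg0 t1 t2 t3; lra.
- by rewrite addr_ge0// divr_ge0// ?sqr_ge0// ltW.
- move=> [u v] [/= hu sv].
  have su := hingedH2_sqint hu.
  have hG : `|ip M g u| <= ip M g g / 2 + ip M u u / 2.
    by have := ip_young ltr01 hg su; rewrite mulr1 mul1r [2^-1 * _]mulrC.
  have hc : k / 4 * `|ip M u v| <= A2 * ip M u u + ip M v v / 4.
    by have := Y2 _ _ su sv; rewrite [4^-1 * _]mulrC.
  apply/andP; split.
    rewrite opprD addrA.
    exact: (energy_lower P hk hS (ip_ge0 M (D 1 0 u)) (poincare hu) A20 (bform_ge0 l hsigma u)
      hG hc erefl).
  exact: (energy_upper P hk hS (ip_ge0 M (D 1 0 u)) (poincare hu) (xform_le l0 hsigma hu)
    p2 b'0 A20 (bform_ge0 l hsigma u) (ip_ge0 M v) gg0 hG hc erefl).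
Qed.

(** Gronwall's lemma between the lower energy bound at T and the upper one at 0. That a and b depend
    neither on T nor on the solution is what makes absorption uniform; the factor 4 undoes the
    quarter in the lower bound. *)
Lemma strong_bound : exists a b, [/\ 0 <= a, 0 <= b & forall T y, 0 < T ->
  strong_solution l sigma k S P alpha g T y ->
  phase_sqnorm (y T) <= expR (- (k / 4) * T) * (a * (1 + phase_sqnorm (y 0)) ^+ 2) + b].
Proof.
have [C C0 HC] := dissipation.
have [a [b [a0 b0 Hab]]] := energy_bounds.
have k4 : 0 < k / 4 by rewrite divr_gt0.
exists (4 * a), (4 * (C / (k / 4) + b)); split.
- by rewrite mulr_ge0.
- by rewrite mulr_ge0// addr_ge0// divr_ge0// ltW.
move=> T y T0 [utt hy].
have yphase t : 0 <= t <= T -> phase (y t).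
  move=> /hy[[h1 h2] _ _ _ _].
  exact: (conj (domA_hingedH2 h1) (hingedH2_sqint (H2s_hingedH2 l0 h2))).
have dV t : 0 <= t <= T ->
    rder (within `[0, T] t^') t (fun s => energy (k / 4) (y s)) (denergy (k / 4) (y t) (utt t)).
  move=> ht; have [[h1 h2] /plate_sqint hw dy _ _] := hy t ht.
  have hF : \forall s \near within `[0, T] t^', phase (y s).
    apply: filterS (withinT _ _) => s; rewrite /= in_itv /=; exact: yphase.
  have hz : phase ((y t).2, utt t) := conj (H2s_hingedH2 l0 h2) hw.
  pose proof (energy_rder l0 hsigma (S := S) (P := P) hg (@dnbhs_cvg R T t) hF
    (yphase t ht) hz erefl dy) as hE.
  exact: hE.
have hV t : 0 <= t <= T ->
    denergy (k / 4) (y t) (utt t) + k / 4 * energy (k / 4) (y t) <= C.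
  move=> ht; have [[h1 h2] /plate_sqint hw _ _ eq] := hy t ht.
  by have := HC _ _ _ h1 (H2s_hingedH2 l0 h2) hw eq; rewrite -surjective_pairing.
have G := gronwall T0 k4 dV hV.
have T01 : 0 <= T <= T by rewrite (ltW T0) lexx.
have T00 : 0 <= (0 : R) <= T by rewrite lexx (ltW T0).
have /andP[lowT _] := Hab _ (yphase T T01).
have /andP[_ up0] := Hab _ (yphase 0 T00).
have C4 : 0 <= C / (k / 4) by rewrite divr_ge0// ltW.
move: G lowT up0 C4; move: (C / (k / 4)) (energy _ (y T)) (energy _ (y 0)) => c VT V0.
move: (phase_sqnorm (y T)) (phase_sqnorm (y 0)) => NT N0 G lowT up0 c0.
have e0 := expR_gt0 (- (k / 4) * T).
have : expR (- (k / 4) * T) * (V0 - c) <= expR (- (k / 4) * T) * (a * (1 + N0) ^+ 2).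
  by apply: ler_wpM2l; [exact: ltW|lra].
move: (expR _) G => e G h; lra.
Qed.

End Dissipation.

(** The bound exp(x) >= 1 + x suffices, and gives an explicit entry time without logarithms. *)
Lemma expR_decay {R : realType} (delta A t : R) : 0 < delta -> 0 <= t -> A / delta < t ->
  expR (- delta * t) * A <= 1.
Proof.
move=> d0 t0; rewrite ltr_pdivrMr// => At.
rewrite mulNr expRN mulrC ler_pdivrMr ?expR_gt0// mul1r.
by apply: le_trans (expR_ge1Dx _); rewrite mulrC in At; lra.
Qed.

Unset Implicit Arguments.

Theorem proposition4p7 (R : realType) (l sigma : R) (hl : 0 < l)
    (hsigma : 0 < sigma < 1)
    (k S P alpha : R) (g : R * R -> R)
    (hk : 0 < k) (hS : 0 < S) (hg : L2 l g)
    (St : R -> @state R -> @state R)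
    (hSt : solution_semigroup l sigma k S P alpha g St) :
  exists B : set (@state R),
    [/\ B `<=` Yspace l, Yclosed l sigma B, Ybounded l sigma B &
        uniformly_absorbing l sigma St B].
Proof.
have {}hg := (plate_sqint l g).1 hg.
have [a [b [a0 b0 bound]]] := strong_bound hl hsigma P alpha hk hS hg.
pose N := Ynorm l sigma.
have N0 z : 0 <= N z by exact: sqrtr_ge0.
have sqnormE z : phase l z -> phase_sqnorm l sigma z = N z ^+ 2.
  by move=> hz; rewrite /N (YnormE hsigma hz.2) sqr_sqrtr//; exact: phase_sqnorm_ge0.
have tri z z' : phase l z -> phase l z' -> N z <= N (z - z') + N z'.
  move=> hz hz'; have := Ynorm_triangle hl hsigma (phase_B hl hz hz') hz'.
  by rewrite subrK.
have Yp z : Yspace l z -> phase l z by exact: Yspace_phase.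
(* Once the decaying term is at most 1, strong solutions have squared norm at most 1 + b; the last 1
   is the distance from the generalized solution to its approximant. *)
pose r : R := Num.sqrt (1 + b) + 1.
exists [set z | Yspace l z /\ N z <= r]; split.
- by move=> z [].
- move=> z hz near_z; split=> //; rewrite -subr_le0.
  apply/ler_addgt0Pr => e e0; rewrite add0r.
  have [w [hw wr] zw] := near_z e e0.
  have := tri _ _ (Yp _ hz) (Yp _ hw); move: zw wr; rewrite -/N.
  move: (N z) (N (z - w)) (N w) => x x' x''; lra.
- by exists r => z [].
move=> A AY [m Am].
(* A nonnegative bound for the initial norm of the approximant, which starts within distance 1 of
   the data. *)
pose m' := Num.max 0 m + 1.
(* The initial factor in [strong_bound] is at most q, so by [expR_decay] its contribution is at most
   1 after the time q/(k/4), which depends on the bounded set through m only. *)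
pose q : R := a * (1 + m' ^+ 2) ^+ 2.
exists (q / (k / 4)) => t t0 qt _ [y0 Ay0 <-].
have k4 : 0 < k / 4 by rewrite divr_gt0.
have q0 : 0 <= q by rewrite mulr_ge0// sqr_ge0.
have t_gt0 : 0 < t by apply: le_lt_trans qt; rewrite divr_ge0// ltW.
have [[genY gen] init] := hSt y0 (AY _ Ay0).
have hY := genY t t0; split=> //.
(* The horizon is the current time t itself; the approximants may change with t, since the bounds on
   them do not. *)
have [y_ [sy cy]] := gen t t_gt0.
have [n _ /(_ n (leqnn n)) /= yn] := cy 1 ltr01.
have T0 : 0 <= (0 : R) <= t by rewrite lexx t0.
have T1 : 0 <= t <= t by rewrite t0 lexx.
have ph s : 0 <= s <= t -> phase l (y_ n s).
  move=> hs; have [utt /(_ s hs) [[h1 h2] _ _ _ _]] := sy n.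
  exact: (conj (domA_hingedH2 hl h1) (hingedH2_sqint (H2s_hingedH2 hl h2))).
have py0 := Yp _ (AY _ Ay0).
have pS s : 0 <= s -> phase l (St s y0) by move=> /genY/Yp.
have h0 : N (y_ n 0) <= m'.
  (* Two triangle inequalities, because [St 0 y0] is only at Y-distance 0 from y0, not equal to it
     as a pair of functions. *)
  have i1 := tri _ _ (ph 0 T0) (pS 0 (lexx 0)); have i2 := tri _ _ (pS 0 (lexx 0)) py0.
  have i3 := yn 0 T0; have i4 := Am _ Ay0.
  have i5 : m <= Num.max 0 m by rewrite le_max lexx orbT.
  rewrite /m'; move: i1 i2 i3 i4 i5; rewrite -/(N _) -/(N _) [N (St 0 y0 - y0)]init.
  move: (N _) (N _) (N _) (N _) (Num.max _ _) => *; lra.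
have h1 : N (y_ n t) <= Num.sqrt (1 + b).
  have := bound t (y_ n) t_gt0 (sy n); rewrite (sqnormE _ (ph t T1)) (sqnormE _ (ph 0 T0)) => h.
  rewrite -(ger0_norm (N0 (y_ n t))) -sqrtr_sqr ler_wsqrtr//.
  apply: le_trans h _; rewrite lerD2r.
  apply: le_trans (expR_decay k4 t0 qt).
  apply: ler_wpM2l; first exact/ltW/expR_gt0.
  apply: ler_wpM2l => //.
  by rewrite ler_sqr ?nnegrE ?addr_ge0 ?sqr_ge0// lerD2l ler_sqr ?nnegrE// (le_trans _ h0).
apply: le_trans (tri _ _ (pS t t0) (ph t T1)) _.
rewrite /r addrC lerD// /N YnormBC//; try exact: ph; try exact: pS.
exact/ltW/yn.
Qed.
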